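(* Consider a simple, non-degenerate, doubling and conductively uniform iterated graph system with limit space $(X,d,\mu)$, and let $p\in(1,\infty)$. There exists $C\ge1$ such that for all $f\in L^p(X,\mu)$, $$C^{-1}\mathscr{E}_p(f)\le\liminf_{r\to0^+}\int_X\frac1{\mu(B(x,r))}\int_{B(x,r)}\frac{|f(x)-f(y)|^p}{r^{d_{w,p}}}\,\mu(dy)\,\mu(dx)$$ $$\le\sup_{r>0}\int_X\frac1{\mu(B(x,r))}\int_{B(x,r)}\frac{|f(x)-f(y)|^p}{r^{d_{w,p}}}\,\mu(dy)\,\mu(dx)\le C\,\mathscr{E}_p(f).$$
   Context: Graphs. A graph $G=(V,E)$ has a finite nonempty vertex set $V$ and a finite multiset $E$ of unordered pairs $\{v,w\}$ of distinct vertices (parallel edges are counted separately). $\deg(v)$ is the number of edges containing $v$; $d_G$ is the shortest-path metric of a connected graph; a vertex set is independent if no edge joins two of its elements, and connected if any two of its points are joined by a path inside it. Iterated graph systems (IGS). An IGS consists of a connected graph $G_1=(V_1,E_1)$ (the generator), a nonempty finite set $I$, and for all $e\in E_1$, $v\in e$ an injective map $\phi_{v,e}:I\to V_1$ with independent image such that $\phi_{v,e}(I)\cap\phi_{w,e}(I)=\emptyset$ if $e=\{v,w\}$. It is simple if there are $\phi_+,\phi_-:I\to V_1$ with $\{\phi_{v,e},\phi_{w,e}\}=\{\phi_+,\phi_-\}$ for all $e=\{v,w\}\in E_1$; then $I_\pm:=\phi_\pm(I)$ and the ends of $e$ are named $e^+,e^-$ so that $\phi_{e^\pm,e}=\phi_\pm$.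 It is doubling if $\deg(v)=1$ for all $v\in I_+\cup I_-$ (then $\mathfrak{n}(v)$ is the unique neighbour of $v$), and non-degenerate if no edge joins $I_+$ to $I_-$. Put $L_*:=\operatorname{dist}(I_+,I_-,d_{G_1})\ge2$. Potentials and flows. Let $p\in(1,\infty)$, $q=p/(p-1)$. For $U:V\to\mathbb{R}$ on a graph $(V,E)$ and $e=\{v,w\}\in E$ put $\nabla U(v,w)=U(w)-U(v)$, $|\nabla U(e)|=|\nabla U(v,w)|$, $\mathcal{E}_p(U)=\sum_{e\in E}|\nabla U(e)|^p$. A unit flow from $A$ to $B$ (disjoint nonempty vertex sets) is $\mathcal{J}:V\times V\to\mathbb{R}$ antisymmetric, with $\mathcal{J}(v,w)=0$ unless $\{v,w\}\in E$, $\operatorname{div}(\mathcal{J})(v):=\sum_{\{v,w\}\in E}\mathcal{J}(v,w)=0$ for $v\notin A\cup B$, and $\sum_{v\in A}\operatorname{div}(\mathcal{J})(v)=1$; $|\mathcal{J}(e)|:=|\mathcal{J}(v,w)|$ and $\mathcal{E}_q(\mathcal{J})=\sum_{e\in E}|\mathcal{J}(e)|^q$. On $G_1$, $U_p$ is the unique minimizer of $\mathcal{E}_p$ among $U$ with $U|_{I_+}\equiv1$, $U|_{I_-}\equiv0$; $\mathcal{M}_p:=\mathcal{E}_p(U_p)$; the $p$-walk dimension is $d_{w,p}:=\log(|E_1|\mathcal{M}_p^{-1})/\log(L_* )$; $\mathcal{J}_p$ is the unique minimizer of $\mathcal{E}_q$ among unit flows from $I_+$ to $I_-$. The IGS is conductively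 uniform if for all $p\in(1,\infty)$ and $a\in I$, $\mathcal{J}_p(\phi_+(a),\mathfrak{n}(\phi_+(a)))=-\mathcal{J}_p(\phi_-(a),\mathfrak{n}(\phi_-(a)))$; this value is denoted $\mathcal{J}_p(a)$, and $a\mapsto\mathcal{J}_p(a)$ is a probability density on $I$. Replacement graphs. $G_0$ has vertices $v_+,v_-$ and one edge $e_0$ with $e_0^\pm=v_\pm$. Given $G_n=(V_n,E_n)$ whose edges have named ends $e^\pm$ (write $\phi_{v,e}=\phi_\pm$ if $v=e^\pm$), put $V_{n+1}=(V_1\times E_n)/\sim$, where $(\phi_{v,e}(a),e)\sim(\phi_{v,f}(a),f)$ for $e,f\in E_n$ sharing an end $v$ and $a\in I$; classes are written $[z,e]$. For each $e\in E_n$, $f\in E_1$ there is one edge $e\cdot f=\{[f^+,e],[f^-,e]\}\in E_{n+1}$ with $(e\cdot f)^\pm=[f^\pm,e]$. So $E_n$ is identified with words of length $n$ in $E_1$, and $e\cdot f$ denotes concatenation for $e\in E_n$, $f\in E_m$. For $e\in E_n$ define $\sigma_{e,m}:V_m\to V_{n+m}$ by $\sigma_{e,0}(v_\pm)=e^\pm$, $\sigma_{e,m+1}([z,f])=[z,e\cdot f]$, and $e\cdot G_m:=\sigma_{e,m}(V_m)$. For $v\in V_n$, $a\in I$ put $v\cdot a:=[\phi_{v,e}(a),e]\in V_{n+1}$ (any $e\in E_n$ containing $v$), and $v\cdot(a_1\cdots a_m):=(\cdots(v\cdot a_1)\cdots)\cdot a_m$. Write $|e|=n$ for $e\in E_n$.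 Limit space. $\Sigma$ is the set of sequences $(e_i)_{i\ge0}$, $e_i\in E_i$, with $e_i$ the length-$i$ prefix of $e_{i+1}$; $X:=\Sigma/\sim$ with $(e_i)\sim(f_i)$ iff $e_i\cap f_i\neq\emptyset$ for all $i$; $\chi:\Sigma\to X$ is the projection. $\mu$ is the push-forward under $\chi$ of the uniform Bernoulli probability measure on $\Sigma\cong E_1^{\mathbb{N}}$. The metric is $d(\chi((e_i)),\chi((f_i))):=\lim_n\min_{v\in e_n,w\in f_n}d_n(v,w)$, where for $v\ne w$ in $V_n$, $d_n(v,w)=\inf_\Omega\sum_{e\in\Omega}L_*^{-|e|}$ over $\Omega\subseteq\bigcup_{j=0}^nE_j$ such that $\bigcup_{e\in\Omega}e\cdot G_{n-|e|}$ is connected in $G_n$ and contains $v,w$; $d_n(v,v)=0$. $B(x,r)$ is the open ball. Energy. For $v\in e\in E_n$ let $T_{v,e}:I^{\mathbb{N}}\to\Sigma$ send $(a_i)$ to the sequence whose $n$-th term is $e$ and whose $i$-th term, $i>n$, is the unique edge of the form $e\cdot f$, $f\in E_{i-n}$, containing $v\cdot(a_1\cdots a_{i-n})$. $\operatorname{Fib}(v):=\chi(T_{v,e}(I^{\mathbb{N}}))$, and $\mathcal{J}_{p,v}$ is the push-forward by $\chi\circ T_{v,e}$ of the product probability measure on $I^{\mathbb{N}}$ with one-dimensional marginals $\mathcal{J}_p(\cdot)$ (both independent of $e$). For $f\in C(X)$ let $V_n[f](v):=\int_{\operatorname{Fib}(v)}f\,d\mathcal{J}_{p,v}$, $v\in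 V_n$, and $\mathsf{E}_p(f):=\lim_n\mathcal{M}_p^{-n}\mathcal{E}_p(V_n[f])\in[0,\infty]$ (a non-decreasing limit). Let $\mathscr{C}_p=\{f\in C(X):\mathsf{E}_p(f)<\infty\}$. For $f\in L^p(X,\mu)$, $\mathscr{E}_p(f):=\lim_i\mathsf{E}_p(f_i)$ for any sequence $f_i\in\mathscr{C}_p$ with $\mathsf{E}_p(f_i-f_j)\to0$ as $i,j\to\infty$ and $f_i\to f$ in $L^p(X,\mu)$ (independent of the sequence by closability of $\mathsf{E}_p$), and $\mathscr{E}_p(f):=\infty$ if none exists. *)

(* Defs.v *)
From HB Require Import structures.
From mathcomp Require Import all_boot all_order all_algebra.
From mathcomp Require Import all_classical all_reals all_analysis.

Set Implicit Arguments.
Unset Strict Implicit.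
Unset Printing Implicit Defensive.
Import Order.TTheory GRing.Theory Num.Theory.
Import numFieldNormedType.Exports.

Local Open Scope classical_set_scope.
Local Open Scope ring_scope.

(* A finite multigraph: [edge] indexes the edges, so that parallel edges are
   distinct indices with the same value of [ends]. *)
Record mgraph := MGraph {
  vertex : finType;
  edge : finType;
  ends : edge -> {set vertex} }.

Definition is_graph (G : mgraph) : Prop :=
  (0 < #|vertex G|)%N /\ forall e : edge G, #|ends e| = 2%N.

(* A multigraph in which the ends e^+ = [oend true e] and e^- = [oend false e]
   of every edge are named; throughout, [true] stands for the sign + and
   [false] for the sign -. *)
Record ograph := OGraph {
  overtex : finType;
  oedge : finType;
  oend : bool -> oedge -> overtex }.

Definition mgraph_of (G : ograph) : mgraph :=
  MGraph (fun e : oedge G => [set oend true e; oend false e]%SET).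
Coercion mgraph_of : ograph >-> mgraph.

Section GraphNotions.
Context (G : mgraph).
Implicit Types (v w : vertex G) (A B : {set vertex G}).

Definition adj v w : bool := [exists e : edge G, ends e == [set v; w]%SET].

Definition deg v : nat := #|[set e : edge G | v \in ends e]%SET|.

Definition independent A : bool :=
  [forall v in A, forall w in A, ~~ adj v w].

Definition connected_in A : bool :=
  [forall v in A, forall w in A,
    connect [rel x y | [&& x \in A, y \in A & adj x y]] v w].

Definition connected_graph : bool := connected_in [set: vertex G]%SET.

Definition walk (n : nat) v w : bool :=
  [exists s : n.-tuple (vertex G), path adj v s && (last v s == w)].

(* Shortest-path distance; in a connected graph it is less than the number of
   vertices, and #|vertex G| is the value for vertices not joined by a path. *)
Definition gdist v w : nat :=
  find (fun n => walk n v w) (iota 0 #|vertex G|).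

Definition sdist A B : nat :=
  \big[minn/#|vertex G|]_(v in A) \big[minn/#|vertex G|]_(w in B) gdist v w.

(* The unique neighbour of a vertex of degree one. *)
Definition nbr v : vertex G := odflt v [pick w | adj v w].

End GraphNotions.

(* [gate v e] is the map phi_{v,e}; its values are relevant for v \in e only. *)
Record igs := IGS {
  generator :> mgraph;
  symbol : finType;
  gate : vertex generator -> edge generator -> symbol -> vertex generator;
  generator_graph : is_graph generator;
  generator_connected : connected_graph generator;
  symbol_gt0 : (0 < #|symbol|)%N;
  gate_inj : forall (e : edge generator) v,
    v \in ends e -> injective (gate v e);
  gate_indep : forall (e : edge generator) v,
    v \in ends e -> independent [set gate v e a | a in symbol]%SET;
  gate_disjoint : forall (e : edge generator) v w,
    ends e = [set v; w]%SET ->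
    ([set gate v e a | a in symbol] :&: [set gate w e a | a in symbol])%SET
      = finset.set0 }.

(* An IGS with a witness of its simplicity: the maps phi_+, phi_- and the
   names e^+, e^- of the ends of the edges such that phi_{e^+-,e} = phi_+-. *)
Record simple_igs := SimpleIGS {
  igs_of :> igs;
  phi : bool -> symbol igs_of -> vertex igs_of;
  pole : bool -> edge igs_of -> vertex igs_of;
  poleE : forall e, ends e = [set pole true e; pole false e]%SET;
  gate_pole : forall s e, gate (pole s e) e =1 phi s }.

Definition G1 (S : simple_igs) : ograph := OGraph (@pole S).

Definition Iset (S : simple_igs) (s : bool) : {set vertex (G1 S)} :=
  [set phi s a | a in symbol S]%SET.

Definition doubling (S : simple_igs) : Prop :=
  forall (s : bool) (v : vertex (G1 S)), v \in Iset S s -> deg v = 1%N.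

Definition non_degenerate (S : simple_igs) : Prop :=
  forall v w : vertex (G1 S),
    v \in Iset S true -> w \in Iset S false -> ~~ adj v w.

Definition Lstar (S : simple_igs) : nat := sdist (Iset S true) (Iset S false).

Section PotentialsFlows.
Context (R : realType).

Definition energy (G : ograph) (p : R) (U : vertex G -> R) : R :=
  \sum_(e : oedge G) `|U (oend true e) - U (oend false e)| `^ p.

(* Sums over {v, w} in E count parallel edges separately. *)
Definition div (G : mgraph) (J : vertex G -> vertex G -> R) (v : vertex G) : R :=
  \sum_(w : vertex G) \sum_(e : edge G | ends e == [set v; w]%SET) J v w.

Definition unit_flow (G : mgraph) (A B : {set vertex G})
    (J : vertex G -> vertex G -> R) : Prop :=
  [/\ forall v w, J v w = - J w v,
      forall v w, ~~ adj v w -> J v w = 0,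
      forall v, v \notin A -> v \notin B -> div J v = 0
    & \sum_(v in A) div J v = 1].

Definition flow_energy (G : ograph) (q : R) (J : vertex G -> vertex G -> R) : R :=
  \sum_(e : oedge G) `|J (oend true e) (oend false e)| `^ q.

Context (S : simple_igs) (p : R).

Definition admissible (U : vertex (G1 S) -> R) : Prop :=
  (forall v, v \in Iset S true -> U v = 1) /\
  (forall v, v \in Iset S false -> U v = 0).

Definition Up : vertex (G1 S) -> R :=
  xget (fun=> 0) [set U : vertex (G1 S) -> R | admissible U /\
    forall U', admissible U' -> energy p U <= energy p U'].

Definition Mp : R := energy p Up.

Definition dwalk : R := ln (#|edge (G1 S)|%:R / Mp) / ln (Lstar S)%:R.

Definition Jp : vertex (G1 S) -> vertex (G1 S) -> R :=
  let q := p / (p - 1) in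
  xget (fun _ _ => 0) [set J : vertex (G1 S) -> vertex (G1 S) -> R |
    unit_flow (Iset S true) (Iset S false) J /\
    forall J', unit_flow (Iset S true) (Iset S false) J' ->
      flow_energy q J <= flow_energy q J'].

Definition gate_flow (s : bool) (a : symbol S) : R :=
  let v : vertex (G1 S) := phi s a in Jp v (nbr v).

(* a |-> J_p(a), for a conductively uniform system. *)
Definition Jdens (a : symbol S) : R := gate_flow true a.

End PotentialsFlows.

Definition conductively_uniform (R : realType) (S : simple_igs) : Prop :=
  forall p : R, 1 < p -> forall a : symbol S,
    gate_flow p true a = - gate_flow p false a.

Section Replacement.
Context (S : simple_igs).

Definition G0 : ograph := OGraph (fun (s : bool) (_ : unit) => s).

Section Step.
Context (G : ograph).

Definition glue : rel (vertex S * oedge G) := fun x y =>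
  [exists a : symbol S, exists s : bool, exists t : bool,
    [&& oend s x.2 == oend t y.2, x.1 == phi s a & y.1 == phi t a]].

(* [glue] is symmetric; its equivalence closure is [connect glue]. *)
Definition glue_class (x : vertex S * oedge G) : {set vertex S * oedge G} :=
  [set y | connect glue x y]%SET.

Definition step_vertex : finType :=
  {C : {set vertex S * oedge G} |
    C \in [set glue_class x | x in {: vertex S * oedge G}]%SET}.

Definition class (z : vertex S) (e : oedge G) : step_vertex :=
  exist _ (glue_class (z, e)) (imset_f _ (erefl _)).

(* The pair (e, f) is the edge e.f of the next graph. *)
Definition step : ograph :=
  @OGraph step_vertex (oedge G * edge S)%type
    (fun s ef => class (pole s ef.2) ef.1).

End Step.

Fixpoint Gr (n : nat) : ograph := if n is m.+1 then step (Gr m) else G0.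

Definition cls (n : nat) (z : vertex S) (e : edge (Gr n)) : vertex (Gr n.+1) :=
  class z e.

Fixpoint word (n : nat) : edge (Gr n) -> seq (edge S) :=
  if n is m.+1 return edge (Gr n) -> seq (edge S)
  then fun e => rcons (word e.1) e.2 else fun=> [::].

(* e . G_{n - |e|} as a set of vertices of G_n, where e is an edge of level
   |e| <= n given by its word w.  If |e| = n it is {e^+, e^-} (first set, the
   second being empty); if |e| < n it is the set of the classes [z, e.f] with
   z in V_1 and f in E_{n - |e| - 1} (second set, the first being empty). *)
Definition cell (n : nat) : seq (edge S) -> {set vertex (Gr n)} :=
  if n is m.+1 return seq (edge S) -> {set vertex (Gr n)}
  then fun w =>
    ([set oend s g | s in {: bool}, g in [set g | @word m.+1 g == w]]
     :|: [set cls z g | z in {: vertex S}, g in [set g | prefix w (@word m g)]])%SET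
  else fun w => [set v | w == [::]]%SET.

End Replacement.

(* The letter [a0] only serves as the [point] that the measurable types of the
   library carry. *)
Definition seqspace (A : finType) (a0 : A) : Type := nat -> A.

Section Sequences.
Context (A : finType) (a0 : A).

HB.instance Definition _ := gen_eqMixin (seqspace a0).
HB.instance Definition _ := gen_choiceMixin (seqspace a0).
HB.instance Definition _ := isPointed.Build (seqspace a0) (fun=> a0).

Definition cylinder (u : seq A) : set (seqspace a0) :=
  [set s | mkseq s (size u) = u].

Definition mseqspace := g_sigma_algebraType (range cylinder).

(* The product probability measure with one-dimensional marginals w is the one
   whose values on cylinders are the products of the w-values; the default
   [point] is void when w is a probability density. *)
Definition product_measure (R : realType) (w : A -> R) : probability mseqspace R :=
  xget point [set P : probability mseqspace R |
    forall u : seq A, P (cylinder u) = (\prod_(a <- u) w a)%:E].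

End Sequences.

Lemma doubling_edge (S : simple_igs) : doubling S -> exists e : edge S, True.
Proof.
move=> D; have /card_gt0P[a _] := symbol_gt0 S.
have /(_ true (phi true a)) := D.
have aI : phi true a \in Iset S true by apply: imset_f.
move=> /(_ aI) /eqP; rewrite /deg => /eqP d1.
have /card_gt0P[e _] : (0 < #|[set e : edge (G1 S) | (phi true a : vertex (G1 S)) \in ends e]%SET|)%N.
  by rewrite d1.
by exists e.
Qed.

Lemma symbol_inhabited (S : igs) : exists a : symbol S, True.
Proof. by have /card_gt0P[a _] := symbol_gt0 S; exists a. Qed.

Section LimitSpace.
Context (S : simple_igs) (D : doubling S).

Definition edge0 : edge S := projT1 (cid (doubling_edge D)).
Definition symbol0 : symbol S := projT1 (cid (symbol_inhabited S)).

(* Sigma, identified with E_1^N: the sequence (e_i) is recovered from the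
   sequence s of its letters as e_i = [pre s i]. *)
Definition Sigma := seqspace edge0.

Fixpoint pre (s : Sigma) (n : nat) : edge (Gr S n) :=
  if n is m.+1 return edge (Gr S n) then (pre s m, s m) else tt.

Definition sim (s t : Sigma) : Prop :=
  forall i, (ends (pre s i) :&: ends (pre t i))%SET != finset.set0.

(* X = Sigma / ~ is the set of the classes [set t | sim s t]. *)
Definition X : Type := {C : set Sigma | exists s, C = [set t | sim s t]}.
HB.instance Definition _ := gen_eqMixin X.
HB.instance Definition _ := gen_choiceMixin X.

Definition chi (s : Sigma) : X :=
  exist _ [set t | sim s t] (ex_intro _ s (erefl _)).

Definition rep (x : X) : Sigma := projT1 (cid (proj2_sig x)).

HB.instance Definition _ := isPointed.Build X (chi point).

Section Metric.
Context (R : realType).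

(* Omega is a set of words of length at most n, that is a subset of the union
   of E_0, ..., E_n. *)
Definition links (n : nat) (v w : vertex (Gr S n)) (Om : {set n.-bseq (edge S)}) :
    Prop :=
  let C := (\bigcup_(e in Om) cell n e)%SET in
  [/\ connected_in C, v \in C & w \in C].

Definition dn (n : nat) (v w : vertex (Gr S n)) : R :=
  if v == w then 0
  else inf [set \sum_(e in Om) (Lstar S)%:R ^- size e | Om in links v w].

Definition dn_edge (n : nat) (e f : edge (Gr S n)) : R :=
  inf [set x | exists v w, [/\ v \in ends e, w \in ends f & x = dn v w]].

Definition dist (x y : X) : R :=
  limn (fun n => dn_edge (pre (rep x) n) (pre (rep y) n)).

Definition dball (x : X) (r : R) : set X := [set y | dist x y < r].

End Metric.
End LimitSpace.

(* X with the topology generated by the open balls of the metric d, and with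
   its Borel sigma-algebra. *)
Definition limit_space (R : realType) (S : simple_igs) (D : doubling S) : Type :=
  X D.

Section Borel.
Context (R : realType) (S : simple_igs) (D : doubling S).

HB.instance Definition _ := Pointed.on (limit_space R D).
HB.instance Definition _ := isSubBaseTopological.Build (limit_space R D)
  [set: limit_space R D * R] (fun xr => @dball S D R xr.1 xr.2).

Definition borel_space := g_sigma_algebraType (@open (limit_space R D)).

End Borel.

Section Energy.
Context (R : realType) (S : simple_igs) (D : doubling S) (p : R).
Local Notation X := (borel_space R D).

Definition bernoulli : probability (mseqspace (edge0 D)) R :=
  product_measure (edge0 D) (fun=> #|edge S|%:R^-1).

Definition mu : set X -> \bar R :=
  @pushforward _ _ (mseqspace (edge0 D)) X R bernoulli (@chi S D).

(* v . a, computed from some edge containing v; the [None] case is void as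
   every vertex of G_n is an end of an edge. *)
Definition vmul (n : nat) (v : vertex (Gr S n)) (a : symbol S) :
    vertex (Gr S n.+1) :=
  if [pick x : bool * edge (Gr S n) | oend x.1 x.2 == v] is Some x
  then cls (phi x.1 a) x.2
  else cls (phi true a) (pre (point : Sigma D) n).

(* v . (a_1 ... a_m), with a_i = [a i.-1]. *)
Fixpoint vmuls (n : nat) (v : vertex (Gr S n)) (a : nat -> symbol S) (m : nat) :
    vertex (Gr S (m + n)) :=
  if m is k.+1 return vertex (Gr S (m + n))
  then vmul (vmuls v a k) (a k) else v.

Definition Tmap (n : nat) (v : vertex (Gr S n)) (e : edge (Gr S n))
    (a : nat -> symbol S) : Sigma D :=
  xget point [set s : Sigma D | pre s n = e /\
    forall m, (0 < m)%N -> vmuls v a m \in ends (pre s (m + n))].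

Definition flow_measure (n : nat) (v : vertex (Gr S n)) (e : edge (Gr S n)) :
    set X -> \bar R :=
  @pushforward _ _ (mseqspace (symbol0 S)) X R
    (product_measure (symbol0 S) (Jdens p)) (fun a => chi (Tmap v e a)).

Definition Fib (n : nat) (v : vertex (Gr S n)) (e : edge (Gr S n)) : set X :=
  range (fun a : nat -> symbol S => chi (Tmap v e a) : X).

(* V_n[f](v), computed from some edge e containing v. *)
Definition Vn (n : nat) (f : X -> R) (v : vertex (Gr S n)) : R :=
  if [pick e : edge (Gr S n) | v \in ends e] is Some e
  then fine (\int[flow_measure v e]_(x in Fib v e) (f x)%:E)
  else 0.

Definition Ecal (f : X -> R) : \bar R :=
  limn (fun n => ((Mp S p) ^- n * energy p (@Vn n f))%:E).

Definition Cp : set (X -> R) :=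
  [set f | continuous (f : limit_space R D -> R) /\ (Ecal f < +oo)%E].

Definition Lp (f : X -> R) : Prop :=
  measurable_fun [set: X] f /\ (\int[mu]_x (`|f x| `^ p)%:E < +oo)%E.

Definition approximates (f : X -> R) (fs : nat -> X -> R) : Prop :=
  [/\ forall i, Cp (fs i),
      forall eps : R, 0 < eps -> exists N, forall i j,
        (N <= i)%N -> (N <= j)%N -> (Ecal (fs i \- fs j)%R < eps%:E)%E
    & (fun i => \int[mu]_x (`|fs i x - f x| `^ p)%:E)%E @ \oo --> (0 : \bar R)%E].

(* The closure of the energy: the limit does not depend on the approximating
   sequence. *)
Definition closed_energy (f : X -> R) : \bar R :=
  match pselect (exists fs, approximates f fs) with
  | left H => limn (fun i => Ecal (projT1 (cid H) i))
  | right _ => +oo%E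
  end.

Definition korevaar_schoen (f : X -> R) (r : R) : \bar R :=
  (\int[mu]_x ((fine (mu (dball x r)))^-1%:E *
     \int[mu]_(y in dball x r)
        (`|f x - f y| `^ p / r `^ dwalk S p)%:E))%E.

End Energy.

(* Main.v *)
(* Pull everything back to the symbol space of X with its Bernoulli measure, and put N = |E_1|, M =
   M_p, L = L_*. The metric is comparable with L^-n for the last level n at which the cells of two
   sequences meet, and N / M = L^d_w. Hence the Korevaar-Schoen integral of f at scale L^-n is
   comparable with D_n f, which is (N^2 / M)^n times the double integral of |f(x) - f(y)|^p over
   pairs whose level-n cells meet.

   Energy bounds D_n: the energies E_n f = M^-n E_p(V_n f) increase, because V_n f is the average of
   V_(n+1) f against the optimal flow, and averaging W against that flow yields at most E_p(W) / M.
   Consecutive V_n f differ in L^p by a geometric factor (M / N)^(1/p) < 1, since M < N by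
   non-degeneracy; summation gives the Poincare inequality D_n f <= C E(f).

   D_n bounds energy: pick in each level-n cell a point where the inner integral of D_n f is nearly
   minimal, give every vertex of G_n the value of f at the point of one cell containing it, and
   extend to finer levels by U_p. The extension multiplies the discrete energy by exactly M at each
   level, so its limit h satisfies E(h) <= C D_n f, and h approaches f in L^p (uniformly if f is
   continuous) as n grows.

   Both bounds pass to the closed energy. When liminf D_n f is finite, the approximants have bounded
   energy, and the uniform convexity of |.|^p makes near-minimizers of the energy among functions
   L^p-close to f an energy-Cauchy sequence. *)

Require Import Defs.
From HB Require Import structures.
From mathcomp Require Import all_boot all_order all_algebra.
From mathcomp Require Import finmap measurable_realfun.
From mathcomp Require Import all_classical all_reals all_analysis.
From mathcomp Require Import ring lra zify.

Set Implicit Arguments.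
Unset Strict Implicit.
Unset Printing Implicit Defensive.
Import Order.TTheory GRing.Theory Num.Theory.
Import numFieldNormedType.Exports.
Local Open Scope classical_set_scope.
Local Open Scope ring_scope.

(** * Inequalities for p-th powers *)

(** [D_n f] need not be monotone in n, so all comparisons run through sup D_n <= C E(f) and E(f) <=
    C' liminf D_n. At a fixed level D_n is continuous in L^p, while the energy is at first only
    available on continuous functions; the passage to L^p therefore always goes through D_n with n
    fixed. Every bound is proved for an arbitrary approximating sequence and so applies to the one
    chosen in [closed_energy]. The metric needs its own test functions: the distance to I_- in the
    generator, cut off at L and divided by L, has gradients at most 1 / L, and its iterated
    extension bounds level-n distances from below. As [dist] is a limit of these distances, their
    convergence has to be shown too; they increase with n up to summable errors, which is the
    hardest combinatorial point. Volumes are controlled because doubling keeps degrees bounded by N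
    at all levels: at most 2 N cells meet a given one, each of mass N^-n. *)

Section Powers.
Context (R : realType).
Implicit Types (p x y t : R).

Lemma ln_lt_sub1 x : 0 < x -> x != 1 -> ln x < x - 1.
Proof.
move=> x0 x1; have : ln x != 0.
  by apply/eqP => /(congr1 expR); rewrite lnK ?posrE// expR0 => /eqP; apply/negP.
by move=> /expR_gt1Dx; rewrite lnK ?posrE//; lra.
Qed.

Lemma ln_le_sub1 x : 0 < x -> ln x <= x - 1.
Proof.
move=> x0; have [->|/(ln_lt_sub1 x0)/ltW//] := eqVneq x 1; by rewrite ln1 subrr.
Qed.

(* Concavity of ln at t: both ln (w / t) and ln (1 / t) lie below their tangents, where t is the barycentre of w and 1 with weights 1/p and 1 - 1/p. *)
Lemma bernoulli_lt p t : 1 < p -> t != 1 -> 1 + p * (t - 1) < `|t| `^ p.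
Proof.
move=> p1 t1; have p0 : 0 < p by lra.
set w := 1 + p * (t - 1).
have [w0|w0] := lerP w 0.
  have [t0|t0] := eqVneq t 0; first by rewrite /w t0; have := powR_ge0 `|0:R| p; nra.
  by apply: (le_lt_trans w0); rewrite powR_gt0// normr_gt0.
have [t0|t0] := lerP t 0.
  by move: w0; rewrite /w; nra.
rewrite gtr0_norm// -ltr_ln ?posrE ?powR_gt0// ln_powR.
have wt : 0 < w / t by rewrite divr_gt0.
have w1 : ln (w / t) <= w / t - 1 by apply: ln_le_sub1.
have v1 : ln t^-1 < t^-1 - 1.
  by apply: ln_lt_sub1; rewrite ?invr_gt0// -(inj_eq invr_inj) invrK invr1.
move: w1 v1; rewrite ln_div ?posrE// lnV ?posrE// => w1 v1.
have e : w / t - 1 + (p - 1) * (t^-1 - 1) = 0 by rewrite /w; field; lra.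
have : (p - 1) * - ln t < (p - 1) * (t^-1 - 1) by rewrite ltr_pM2l //; lra.
by move: w1 e; lra.
Qed.

(** The derivative of |x|^p / p. It turns gradients of potentials into flows; with the conjugate
    exponent q it inverts itself ([sgpowK]), since (p - 1)(q - 1) = 1. *)
Definition sgpow p x : R := Num.sg x * `|x| `^ (p - 1).

Lemma sgpow0 p : sgpow p 0 = 0.
Proof. by rewrite /sgpow sgr0 mul0r. Qed.

Lemma sgpowN p x : sgpow p (- x) = - sgpow p x.
Proof. by rewrite /sgpow sgrN normrN mulNr. Qed.

Lemma sgpowM p x y : sgpow p (x * y) = sgpow p x * sgpow p y.
Proof. by rewrite /sgpow sgrM normrM powRM//; ring. Qed.

Lemma sgpow_mul p x : 0 < p -> sgpow p x * x = `|x| `^ p.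
Proof. by move=> p0; rewrite /sgpow mulrAC -mulrC -normrEsg mulrC mulr_powRB1. Qed.

Lemma sgpowK p x : 1 < p -> sgpow (p / (p - 1)) (sgpow p x) = x.
Proof.
move=> p1; rewrite {2}/sgpow; rewrite /sgpow.
have [->|x0] := eqVneq x 0; first by rewrite sgr0 !mul0r sgr0 mul0r.
have xp : 0 < `|x| `^ (p - 1) by rewrite powR_gt0 // normr_gt0.
rewrite sgrM (gtr0_sg xp) mulr1 sgr_id normrM normr_sg x0 mul1r (gtr0_norm xp).
rewrite -powRrM (_ : (p - 1) * (p / (p - 1) - 1) = 1); last by field; lra.
by rewrite powRr1 // -numEsg.
Qed.

Lemma sgpow_gt0 p x : 0 < x -> 0 < sgpow p x.
Proof. by move=> x0; rewrite /sgpow gtr0_sg// mul1r powR_gt0// gtr0_norm. Qed.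

Lemma sgpow_ge0 p x : 0 <= x -> 0 <= sgpow p x.
Proof. by move=> x0; rewrite /sgpow mulr_ge0 ?sgr_ge0// powR_ge0. Qed.

(** Homogeneity: multiply the Bernoulli inequality at y / x by |x|^p. Strictness is the source of
    the uniqueness of minimizers below. *)
Lemma powR_tangent_lt p x y : 1 < p -> y != x ->
  `|x| `^ p + p * sgpow p x * (y - x) < `|y| `^ p.
Proof.
move=> p1 yx; have [x0|x0] := eqVneq x 0.
  rewrite x0 sgpow0 mulr0 mul0r addr0 normr0 powR0; last by lra.
  have [y0|y0] := eqVneq y 0; last by rewrite powR_gt0 // normr_gt0.
  by rewrite y0 x0 eqxx in yx.
have := @bernoulli_lt p (y / x) p1.
have -> : y / x != 1 by rewrite -subr_eq0 -(mulfV x0) -mulrBl mulf_neq0 ?invr_eq0 ?subr_eq0//.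
move=> /(_ isT); have xp : 0 < `|x| `^ p by rewrite powR_gt0// normr_gt0.
rewrite -(ltr_pM2l xp) -powRM// -normrM mulrCA mulfV// mulr1; apply: le_lt_trans.
rewrite -!(sgpow_mul x (p:=p)); last lra.
by rewrite le_eqVlt; apply/orP; left; apply/eqP; field.
Qed.
 
Lemma powR_tangent p x y : 1 < p ->
  `|x| `^ p + p * sgpow p x * (y - x) <= `|y| `^ p.
Proof.
move=> p1; have [->|yx] := eqVneq y x; first by rewrite subrr mulr0 addr0.
exact/ltW/powR_tangent_lt.
Qed.

(** Add the tangent inequalities at the midpoint: the linear terms cancel, and the one towards x is
    strict. *)
Lemma powR_midpoint_lt p x y : 1 < p -> x != y ->
  `|(x + y) / 2| `^ p < (`|x| `^ p + `|y| `^ p) / 2.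
Proof.
move=> p1 xy; set m := (x + y) / 2.
have := @powR_tangent_lt p m x p1; have := @powR_tangent p m y p1.
have -> : x != m by rewrite /m -subr_eq0; apply: contra_neq xy; lra.
move=> + /(_ isT).
have -> : y - m = - (x - m) by rewrite /m; lra.
rewrite mulrN; lra.
Qed.

Lemma powR_midpoint p x y : 1 < p ->
  `|(x + y) / 2| `^ p <= (`|x| `^ p + `|y| `^ p) / 2.
Proof.
move=> p1; have [->|/(powR_midpoint_lt p1)/ltW//] := eqVneq x y.
have h (z : R) : (z + z) / 2 = z by lra.
by rewrite !h.
Qed.

Lemma norm_powR_le p x y : 0 <= p -> `|x| <= `|y| -> `|x| `^ p <= `|y| `^ p.
Proof. by move=> p0; apply: ge0_ler_powR => //; rewrite nnegrE. Qed.

Lemma powRD_le p x y : 0 <= p ->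
  `|x + y| `^ p <= 2 `^ p * (`|x| `^ p + `|y| `^ p).
Proof.
move=> p0; have h a b : `|a| <= `|b| -> `|a + b| `^ p <= 2 `^ p * (`|a| `^ p + `|b| `^ p).
  move=> ab; apply: (@le_trans _ _ (2 `^ p * `|b| `^ p)).
    rewrite -powRM//; apply: ge0_ler_powR; rewrite ?nnegrE ?mulr_ge0//.
    by have := ler_normD a b; lra.
  by rewrite ler_wpM2l ?powR_ge0// lerDr powR_ge0.
have [/h//|/ltW/h] := lerP `|x| `|y|.
by rewrite addrC [in X in _ <= X]addrC.
Qed.

Lemma powRB_le p x y : 0 <= p ->
  `|x - y| `^ p <= 2 `^ p * (`|x| `^ p + `|y| `^ p).
Proof. by move=> p0; have := powRD_le x (- y) p0; rewrite normrN. Qed.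

(** Keeps the factor of |x|^p as near to 1 as desired, for geometric summation and for comparing
    energies. With (1 + d)^p = lam, either |y| <= d |x| and the first term suffices, or |x| < |y| /
    d and the second absorbs everything. *)
Lemma powRD_le_scale p lam : 0 < p -> 1 < lam ->
  exists2 C, 0 <= C & forall x y, `|x + y| `^ p <= lam * `|x| `^ p + C * `|y| `^ p.
Proof.
move=> p0 l1; set d := lam `^ p^-1 - 1.
have d0 : 0 < d.
  have : 1 `^ p^-1 < lam `^ p^-1.
    by apply: gt0_ltr_powR; rewrite ?invr_gt0 ?nnegrE//; lra.
  by rewrite powR1 -subr_gt0.
exists ((1 + d^-1) `^ p); first exact: powR_ge0.
move=> x y; have [xy|xy] := lerP `|y| (d * `|x|).
  apply: (@le_trans _ _ (lam * `|x| `^ p)); last by rewrite lerDl mulr_ge0 // powR_ge0.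
  have -> : lam = (1 + d) `^ p.
    rewrite /d addrCA subrr addr0 -powRrM mulVf ?powRr1//; lra.
  rewrite -powRM ?(normr_ge0)//; last lra.
  apply: ge0_ler_powR; rewrite ?nnegrE ?mulr_ge0//; try lra.
  by have := ler_normD x y; lra.
have dv : 0 <= 1 + d^-1 by rewrite addr_ge0// invr_ge0 ltW.
apply: (@le_trans _ _ ((1 + d^-1) `^ p * `|y| `^ p)).
  rewrite -powRM//; apply: ge0_ler_powR; rewrite ?nnegrE ?mulr_ge0//; first exact: ltW.
  have : `|x| <= d^-1 * `|y| by rewrite mulrC ler_pdivlMr// mulrC ltW.
  by have := ler_normD x y; lra.
by rewrite lerDr mulr_ge0 ?powR_ge0//; lra.
Qed.

Lemma continuous_norm_powR p : 0 < p -> continuous (fun x : R => `|x| `^ p).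
Proof.
move=> p0 x; have [->|x0] := eqVneq x 0.
  rewrite /continuous_at normr0 powR0 ?gt_eqF//.
  apply/cvgrPdist_lt => e e0; near=> y.
  rewrite sub0r normrN ger0_norm ?powR_ge0//.
  have -> : e = (e `^ p^-1) `^ p by rewrite -powRrM mulVf ?gt_eqF// powRr1// ltW.
  apply: gt0_ltr_powR; rewrite ?nnegrE ?powR_ge0//.
  near: y; exists (e `^ p^-1); first exact: powR_gt0.
  by move=> z /=; rewrite sub0r normrN.
have nx : 0 < `|x| by rewrite normr_gt0.
apply: (@continuous_comp _ _ _ (fun x : R => `|x|) (fun y => y `^ p)).
  exact: norm_continuous.
apply: differentiable_continuous; apply/derivable1_diffP.
by apply: derivable_powR; rewrite in_itv/= andbT.
Unshelve. all: by end_near. Qed.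

(** Made for continuity at 0, where the sign jumps: the two summands are continuous everywhere. *)
Lemma sgpowE p x : 1 < p ->
  sgpow p x = `|Num.max x 0| `^ (p - 1) - `|Num.max (- x) 0| `^ (p - 1).
Proof.
move=> p1; have z : `|0 : R| `^ (p - 1) = 0 by rewrite normr0 powR0//; lra.
rewrite /sgpow; have [x0|x0|->] := ltrgtP x 0.
- have nx : 0 <= - x by lra.
  by rewrite ltr0_sg// z (max_idPl nx) normrN mulN1r sub0r.
- have nx : - x <= 0 by lra.
  by rewrite gtr0_sg// (max_idPr nx) z mul1r subr0.
- by rewrite sgr0 mul0r oppr0 maxxx z subrr.
Qed.

Lemma continuous_sgpow p : 1 < p -> continuous (sgpow p).
Proof.
move=> p1; have -> : sgpow p = (fun x : R => `|Num.max x 0| `^ (p - 1) -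
    `|Num.max (- x) 0| `^ (p - 1)).
  by apply/funext => x; exact: sgpowE.
have c : continuous (fun x : R => `|Num.max x 0| `^ (p - 1)).
  move=> x; apply: (@continuous_comp _ _ _ (fun x : R => Num.max x 0)
    (fun x : R => `|x| `^ (p - 1))).
    by apply: continuous_max; [exact: cvg_id | exact: cvg_cst].
  by apply: continuous_norm_powR; lra.
move=> x; apply: cvgB; first exact: c.
apply: (@continuous_comp _ _ _ (fun x : R => - x)
  (fun x : R => `|Num.max x 0| `^ (p - 1))); last exact: c.
exact: opp_continuous.
Qed.

(* By homogeneity the claim concerns the compact set of pairs (1, x) with x <= 1 - d, on which the midpoint defect has a positive minimum. *)
Lemma powR_uniform_convex p e : 1 < p -> 0 < e -> exists2 C, 0 <= C &
  forall x y, `|x - y| `^ p <= e * (`|x| `^ p + `|y| `^ p) +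
    C * ((`|x| `^ p + `|y| `^ p) / 2 - `|(x + y) / 2| `^ p).
Proof.
move=> p1 e0; have p0 : 0 < p by lra.
pose df x := (`|1 : R| `^ p + `|x| `^ p) / 2 - `|(1 + x) / 2| `^ p.
have dfge0 x : 0 <= df x by rewrite subr_ge0 powR_midpoint.
suff [C C0 hC] : exists2 C, 0 <= C & forall x, `|x| <= 1 ->
    `|1 - x| `^ p <= e * (`|1:R| `^ p + `|x| `^ p) + C * df x.
  have hC' x y : `|y| <= `|x| -> `|x - y| `^ p <= e * (`|x| `^ p + `|y| `^ p) +
      C * ((`|x| `^ p + `|y| `^ p) / 2 - `|(x + y) / 2| `^ p).
    have [->|x0] := eqVneq x 0.
      rewrite normr0 normr_le0 => /eqP ->.
      by rewrite subrr addr0 mul0r normr0 powR0 ?gt_eqF//; nra.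
    move=> yx; have nx : 0 < `|x| by rewrite normr_gt0.
    have /hC : `|y / x| <= 1 by rewrite normrM normfV ler_pdivrMr// mul1r.
    have xp : 0 < `|x| `^ p by rewrite powR_gt0.
    have h z : `|x| `^ p * `|z| `^ p = `|x * z| `^ p by rewrite -powRM// normrM.
    have E1 : `|x| `^ p * `|1 - y / x| `^ p = `|x - y| `^ p by rewrite h; do 2 f_equal; field.
    have E2 : `|x| `^ p * `|y / x| `^ p = `|y| `^ p by rewrite h; do 2 f_equal; field.
    have E3 : `|x| `^ p * `|(1 + y / x) / 2| `^ p = `|(x + y) / 2| `^ p.
      by rewrite h; do 2 f_equal; field.
    rewrite -(ler_pM2l xp) E1 => /le_trans; apply.
    rewrite le_eqVlt; apply/orP; left; apply/eqP.
    by rewrite /df normr1 powR1 -E2 -E3; ring.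
  exists C => // x y; have [|/ltW] := lerP `|y| `|x|; first exact: hC'.
  move=> /hC'; rewrite distrC (addrC (`|y| `^ p)) (addrC y); exact.
set d := Num.min 1 (e `^ p^-1).
have d0 : 0 < d by rewrite lt_min ltr01 powR_gt0.
have dp : d `^ p <= e.
  have <- : (e `^ p^-1) `^ p = e by rewrite -powRrM mulVf ?gt_eqF// powRr1// ltW.
  by apply: ge0_ler_powR; rewrite ?nnegrE ?powR_ge0 ?ge_min ?lexx ?orbT//; exact: ltW.
have d1 : d <= 1 by rewrite ge_min lexx.
have [] := @EVT_min R df (-1) (1 - d); first by lra.
  apply: continuous_subspaceT => x; apply: cvgB.
    apply: cvgM; last exact: cvg_cst.
    by apply: cvgD; [exact: cvg_cst | exact: continuous_norm_powR].
  apply: (@continuous_comp _ _ _ (fun x : R => (1 + x) / 2) (fun x : R => `|x| `^ p));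
    last exact: continuous_norm_powR.
  apply: cvgM; last exact: cvg_cst.
  by apply: cvgD; [exact: cvg_cst | exact: cvg_id].
move=> c; rewrite in_itv /= => /andP[c1 c2] hc.
have dc : 0 < df c by rewrite subr_gt0; apply: powR_midpoint_lt => //; apply/eqP; lra.
(* 2^p bounds |1 - x|^p on [-1, 1], and [df c] is the least defect on [-1, 1 - d]. *)
exists (2 `^ p / df c); first by rewrite divr_ge0 ?powR_ge0 ?ltW.
move=> x; rewrite ler_norml => /andP[x1 x2].
have [xd|xd] := lerP x (1 - d).
  apply: (@le_trans _ _ (2 `^ p)).
    by apply: ge0_ler_powR; rewrite ?nnegrE// ?ger0_norm; lra.
  apply: (@le_trans _ _ (2 `^ p / df c * df x)).
    rewrite -mulrA ler_peMr ?powR_ge0// mulrC ler_pdivlMr// mul1r.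
    by apply: hc; rewrite in_itv/= x1.
  by rewrite lerDr mulr_ge0 ?addr_ge0 ?powR_ge0 ?ltW.
apply: (@le_trans _ _ (e * 1)).
  rewrite mulr1; apply: le_trans dp; apply: ge0_ler_powR; rewrite ?nnegrE//; [exact: ltW..|].
  by rewrite ger0_norm ?subr_ge0//; lra.
rewrite -[X in X <= _]addr0; apply: lerD.
  by rewrite ler_pM2l// normr1 powR1 lerDl powR_ge0.
by rewrite mulr_ge0// divr_ge0 ?powR_ge0// ltW.
Qed.

End Powers.

(** * The optimal potential and flow of the generator *)

Section OrientedGraphs.
Context (R : realType) (G : ograph).
Implicit Types (v w : overtex G) (e : oedge G).

Lemma set2_eq (T : finType) (a b c d : T) : ([set a; b] == [set c; d])%SET =
  ((a == c) && (b == d)) || ((a == d) && (b == c)).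
Proof.
apply/eqP/idP; last by case/orP => /andP[/eqP-> /eqP->] //; rewrite finset.setUC.
move=> /setP h.
have := h a; have := h b; have := h c; have := h d.
rewrite !inE !eqxx !orbT /= (eq_sym c a) (eq_sym c b) (eq_sym d a) (eq_sym d b).
by do 4!case: eqP => //=.
Qed.

Lemma mem_ends v e : (v \in @ends G e) = (v == oend true e) || (v == oend false e).
Proof. by rewrite /= !inE. Qed.

Lemma mem_endsP v e : reflect (exists s, v = oend s e) (v \in @ends G e).
Proof.
rewrite mem_ends; apply: (iffP orP).
  by case=> /eqP ->; [exists true | exists false].
by move=> [[] ->]; [left | right].
Qed.

Lemma oend_ends s e : oend s e \in @ends G e.
Proof. by apply/mem_endsP; exists s. Qed.

Lemma adjP v w : reflect (exists s e, v = oend s e /\ w = oend (~~ s) e) (@adj G v w).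
Proof.
apply: (iffP existsP) => [[e /=]|[s [e [-> ->]]]].
  rewrite set2_eq => /orP[] /andP[/eqP <- /eqP <-]; first by exists true, e.
  by exists false, e.
by exists e => /=; rewrite set2_eq; case: s; rewrite /= !eqxx ?orbT.
Qed.

Lemma adj_sym v w : @adj G v w = @adj G w v.
Proof. by apply: eq_existsb => e; rewrite finset.setUC. Qed.

Lemma adj_oend s e : @adj G (oend s e) (oend (~~ s) e).
Proof. by apply/adjP; exists s, e. Qed.

Hypothesis noloop : forall e, oend true e != oend false e.

(** Without loops an edge at v has exactly one other end, so this inner sum of [div] has at most one
    term. *)
Lemma sum_adjacent (J : overtex G -> overtex G -> R) v e :
  \sum_(w | @ends G e == [set v; w]%SET) J v w =
  \sum_(s : bool | oend s e == v) J v (oend (~~ s) e).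
Proof.
have hs (s : bool) : oend s e = v -> \sum_(w | @ends G e == [set v; w]%SET) J v w =
    J v (oend (~~ s) e).
  move=> <-; rewrite (bigD1 (oend (~~ s) e)) /=; last first.
    by rewrite set2_eq; case: s; rewrite /= !eqxx ?orbT.
  rewrite big1 ?addr0// => w; rewrite set2_eq => /andP[].
  have := noloop e => nl; have nl' := nl; rewrite eq_sym in nl'.
  by case: s => /=; rewrite ?eqxx ?(negbTE nl) ?(negbTE nl') ?andbF ?andbT ?orbF /= => /eqP <-; rewrite eqxx.
rewrite [RHS]big_mkcond big_bool /=.
have nl := noloop e; have [/[dup] h1 /hs->|h1] := eqVneq (oend true e) v.
  by rewrite -h1 [in RHS]eq_sym (negbTE nl) addr0.
have [/[dup] h2 /hs->|h2] := eqVneq (oend false e) v; first by rewrite add0r.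
rewrite addr0 big1// => w; rewrite set2_eq (negbTE h1) (negbTE h2).
by rewrite /= andbF.
Qed.

Lemma divE (J : overtex G -> overtex G -> R) v :
  @div R G J v = \sum_(e : oedge G) \sum_(s : bool | oend s e == v) J v (oend (~~ s) e).
Proof.
rewrite /div (exchange_big_dep predT)//=; apply: eq_bigr => e _.
by rewrite -sum_adjacent; apply: eq_bigl => w.
Qed.

(** Summation by parts: each edge is counted at both of its ends, with opposite signs of J. *)
Lemma sum_div (J : overtex G -> overtex G -> R) (U : overtex G -> R) :
  (forall v w, J v w = - J w v) ->
  \sum_v U v * @div R G J v =
  \sum_(e : oedge G) J (oend true e) (oend false e) * (U (oend true e) - U (oend false e)).
Proof.
move=> JN; under eq_bigr do rewrite divE mulr_sumr.
rewrite exchange_big /=; apply: eq_bigr => e _.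
transitivity (\sum_(s : bool) U (oend s e) * J (oend s e) (oend (~~ s) e)).
  under eq_bigr do rewrite mulr_sumr big_mkcond.
  rewrite exchange_big /=; apply: eq_bigr => s _.
  by rewrite -big_mkcond /= (big_pred1 (oend s e)).
by rewrite big_bool /= (JN (oend false e)); ring.
Qed.

End OrientedGraphs.

Section Generator.
Context (R : realType) (S : simple_igs).
Implicit Types (v w : vertex S) (e f : edge S) (a b : symbol S).

Lemma pole_neq e : pole true e != pole false e.
Proof.
have [_ /(_ e)] := generator_graph S; rewrite poleE cards2.
by case: eqP.
Qed.

Lemma adjG1 v w : @adj S v w = @adj (G1 S) v w.
Proof. by apply: eq_existsb => e; rewrite poleE. Qed.

(** [phi] inherits its properties from the gates along an edge, hence the premise that there is one;
    doubling provides it. *)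
Lemma phi_inj s : (exists e : edge S, True) -> injective (@phi S s).
Proof.
move=> [e _] a b; rewrite -!(gate_pole s e); apply: gate_inj.
by rewrite poleE !inE; case: s; rewrite eqxx ?orbT.
Qed.

Lemma phi_disjoint a b : (exists e : edge S, True) -> phi true a != phi false b.
Proof.
move=> [e _]; apply/negP => /eqP ab.
have /setP /(_ (phi true a)) := gate_disjoint (poleE e).
by rewrite !inE -{1}(gate_pole true e a) ab -(gate_pole false e b) !imset_f.
Qed.

Lemma phi_eq s t a b : (exists e : edge S, True) ->
  phi s a = phi t b -> s = t /\ a = b.
Proof.
move=> E; case: s; case: t => h.
- by have := phi_inj E h.
- by have := phi_disjoint a b E; rewrite h eqxx.
- by have := phi_disjoint b a E; rewrite h eqxx.
- by have := phi_inj E h.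
Qed.

Lemma mem_Iset s a : (phi s a : vertex (G1 S)) \in Iset S s.
Proof. exact: imset_f. Qed.

(** Connectedness as an induction principle, used for constancy of potentials, oscillation bounds
    and connectivity of cells. *)
Lemma connected_G1 (P : vertex S -> Prop) :
  (forall s e, P (pole s e) -> P (pole (~~ s) e)) ->
  forall v w, P v -> P w.
Proof.
move=> hP v w Pv.
have /forall_inP/(_ v) := generator_connected S; rewrite inE => /(_ isT).
move=> /forall_inP/(_ w); rewrite inE => /(_ isT) /connectP[s].
elim: s v Pv => [|x s IH] v Pv /= ; first by move=> _ ->.
rewrite !inE /= adjG1 => /andP[/adjP[t [e [hv hx]]] hp] hw.
by apply: IH hp hw; rewrite hx; apply: hP; rewrite hv in Pv.
Qed.

End Generator.

Section Doubling.
Context (S : simple_igs) (D : doubling S).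
Let E : exists e : edge S, True := doubling_edge D.

(** Degree one leaves a single incident edge, and the absence of loops fixes the sign. *)
Lemma gate_edgeP s a : exists2 te : bool * edge S, pole te.1 te.2 = phi s a &
  forall t e, pole t e = phi s a -> (t, e) = te.
Proof.
have /eqP := D (mem_Iset s a); rewrite /deg => /cards1P[e he].
have /mem_endsP[t ht] : (phi s a : vertex (G1 S)) \in @ends (G1 S) e.
  have : e \in [set e]%SET by rewrite inE eqxx.
  by rewrite -he inE.
exists (t, e) => //= t' e' h'.
have : e' \in [set e]%SET by rewrite -he inE -h'; exact: (@oend_ends (G1 S) t' e').
rewrite inE => /eqP e'e; subst e'; congr (_, _).
have := pole_neq e; move: ht h' => /= -> .
by case: t; case: t' => //= ->; rewrite eqxx.
Qed.

Lemma nbrE s a t e : pole t e = phi s a -> @nbr (G1 S) (phi s a) = pole (~~ t) e.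
Proof.
move=> h; rewrite /nbr; case: pickP => [w /adjP[t' [e' [h1 ->]]]|] /=.
  have [te _ hte] := gate_edgeP s a.
  by have := hte t' e' (esym h1); rewrite -(hte _ _ h) => -[-> ->].
by move=> /(_ (pole (~~ t) e)); rewrite -h (@adj_oend (G1 S)).
Qed.

Lemma div_gate (R : realType) (J : vertex (G1 S) -> vertex (G1 S) -> R) s a :
  @div R (G1 S) J (phi s a) = J (phi s a) (@nbr (G1 S) (phi s a)).
Proof.
rewrite divE; last exact: pole_neq.
have [[t e] /= h ht] := gate_edgeP s a.
rewrite (nbrE h) (bigD1 e) //= [X in _ + X]big1 ?addr0.
  rewrite (big_pred1 t) // => t' /=; apply/eqP/eqP => [|-> //].
  by move=> /ht[].
move=> e' e'e; rewrite big1// => t' /eqP /ht[_ ee]; by rewrite ee eqxx in e'e.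
Qed.

Lemma sum_Iset (R : realType) s (F : vertex (G1 S) -> R) :
  \sum_(v in Iset S s) F v = \sum_a F (phi s a).
Proof. by rewrite big_imset//= => a b _ _; exact: phi_inj. Qed.

Lemma IsetC v : v \in Iset S true -> v \notin Iset S false.
Proof.
move=> /imsetP[a _ ->]; apply/negP => /imsetP[b _] /eqP.
by rewrite (negbTE (phi_disjoint a b E)).
Qed.

End Doubling.

Section Potential.
Context (R : realType) (S : simple_igs) (D : doubling S) (p : R) (p1 : 1 < p).
Local Notation V := (vertex S).
Local Notation I s := (Iset S s).
Local Notation grad U e := (U (pole true e) - U (pole false e)).
Implicit Types (U : V -> R).
Let E : exists e : edge S, True := doubling_edge D.
Let p0 : 0 < p. Proof. by rewrite (lt_trans ltr01). Qed.

Lemma energy_ge0 (G : ograph) (r : R) (u : vertex G -> R) : 0 <= energy r u.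
Proof. by apply: sumr_ge0 => e _; exact: powR_ge0. Qed.

Definition clamp (x : R) := Num.min 1 (Num.max 0 x).

Lemma clamp_itv x : 0 <= clamp x <= 1.
Proof. by rewrite /clamp; rewrite le_min ge_min lexx le_max lexx ler01. Qed.

Lemma clamp_id x : 0 <= x <= 1 -> clamp x = x.
Proof. by move=> /andP[x0 x1]; rewrite /clamp (max_idPr x0) (min_idPr x1). Qed.

Lemma clamp_lip x y : `|clamp x - clamp y| <= `|x - y|.
Proof.
have h a b : a <= b -> `|clamp a - clamp b| <= `|a - b|.
  move=> ab; rewrite [X in _ <= X]distrC [X in _ <= X]ger0_norm ?subr_ge0//.
  rewrite /clamp; have [|] := lerP 0 a; have [|] := lerP 0 b => b0 a0; try lra.
  - by have [|] := lerP 1 a; have [|] := lerP 1 b => b1 a1;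
      rewrite ?subrr ?normr0 ?ler0_norm; lra.
  - by have [|] := lerP 1 0; have [|] := lerP 1 b => b1 a1;
      rewrite ?subrr ?normr0 ?ler0_norm; lra.
  - by rewrite subrr normr0; lra.
have [xy|/ltW xy] := leP x y; first exact: h.
rewrite distrC (distrC x); exact: h.
Qed.

(** Truncation to [0, 1] does not raise the energy, so it suffices to minimize over a product of
    points and unit intervals, compact by Tychonoff. *)
Lemma admissible_min_exists : exists U, [/\ admissible U, forall v, 0 <= U v <= 1 &
  forall U', admissible U' -> @energy R (G1 S) p U <= @energy R (G1 S) p U'].
Proof.
pose T := prod_topology (fun _ : V => (R : topologicalType)).
pose A (v : V) : set R := if v \in I true then [set 1]
  else if v \in I false then [set 0] else `[0, 1]%classic.
have cA : compact ([set f | forall v, A v (f v)] : set T).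
  apply: (@tychonoff _ (fun _ => R : topologicalType)) => v; rewrite /A.
  case: ifP => _; first exact: compact_set1.
  by case: ifP => _; [exact: compact_set1 | exact: segment_compact].
have cE : continuous (fun f : T => @energy R (G1 S) p f).
  apply: continuous_big => [|e _ f]; first exact: add_continuous.
  apply: (@continuous_comp _ _ _ (fun f : T => grad f e : R) (fun x : R => `|x| `^ p)).
    have h v : ((f' : prod_topology (fun _ : V => (R : topologicalType))) v : R)
        @[f' --> f] --> (f v : R).
      exact: (@proj_continuous _ (fun _ : V => (R : topologicalType)) v).
    exact: cvgB (h _) (h _).
  exact: continuous_norm_powR.
have clampA U : admissible U -> [set f | forall v, A v (f v)] (clamp \o U : T).
  move=> [U1 U0] v /=; rewrite /A; case: ifP => [/U1 ->|_].
    by rewrite clamp_id// ler01 lexx.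
  case: ifP => [/U0 ->|_]; first by rewrite clamp_id// ler01 lexx.
  by rewrite /= in_itv /= clamp_itv.
have adm0 : admissible (fun v : V => (v \in I true)%:R : R).
  split=> v; first by move=> ->.
  by move=> h; case: (boolP (v \in I true)) => // /(IsetC D); rewrite h.
have [|U /[!inE] AU minU] := compact_EVT_min _ cA (continuous_subspaceT cE).
  by exists (clamp \o (fun v : V => (v \in I true)%:R : R)); exact: clampA.
exists U; split.
- split=> v vI; move: (AU v); rewrite /A ?vI//.
  by case: ifP => [/(IsetC D)|_ ->//]; rewrite vI.
- move=> v; move: (AU v); rewrite /A; case: ifP => [_ ->|_]; first by rewrite ler01 lexx.
  by case: ifP => [_ ->|_]; [rewrite ler01 lexx | rewrite /= in_itv].
- move=> U' /clampA AU'; have := minU (clamp \o U'); rewrite inE => /(_ AU').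
  move=> /le_trans; apply; apply: ler_sum => e _.
  by apply: norm_powR_le; [exact: ltW | exact: clamp_lip].
Qed.

Lemma Up_min : admissible (@Up R S p) /\
  forall U', admissible U' -> Mp S p <= @energy R (G1 S) p U'.
Proof.
rewrite /Mp /Up; case: xgetP => [U _ //|].
have [U [aU _ mU]] := admissible_min_exists.
by move=> /(_ U); case.
Qed.

(** If the gradients differed on an edge, the midpoint of U and U' would have less energy. Equal
    gradients and a common value at a gate determine the potential on a connected graph. *)
Lemma admissible_min_unique U U' : admissible U -> admissible U' ->
  (forall U'', admissible U'' -> @energy R (G1 S) p U <= @energy R (G1 S) p U'') ->
  @energy R (G1 S) p U' <= @energy R (G1 S) p U -> U = U'.
Proof.
move=> aU aU' mU U'U.
have eqg e : grad U e = grad U' e.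
  apply/eqP; apply: contraT => ne.
  pose W v := (U v + U' v) / 2.
  have aW : admissible W.
    by split=> v vI; rewrite /W ?(aU.1 v vI) ?(aU'.1 v vI) ?(aU.2 v vI) ?(aU'.2 v vI); lra.
  have := mU _ aW; rewrite leNgt => /negP; case.
  apply: (@lt_le_trans _ _ ((@energy R (G1 S) p U + @energy R (G1 S) p U') / 2)); last lra.
  have gW f : grad W f = (grad U f + grad U' f) / 2 by rewrite /W; lra.
  rewrite /energy -big_split /= mulr_suml (bigD1 e)//= [X in _ < X](bigD1 e)//=.
  apply: ltr_leD; first by rewrite gW; exact: powR_midpoint_lt.
  by apply: ler_sum => f _; rewrite gW; exact: powR_midpoint.
have [a _] := symbol_inhabited S.
apply/funext => w.
apply: (@connected_G1 S (fun w => U w = U' w) _ (phi true a)).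
  by move=> s e; have := eqg e; case: s => /=; lra.
by rewrite aU.1 ?aU'.1 ?mem_Iset.
Qed.

Lemma Up_itv v : 0 <= @Up R S p v <= 1.
Proof.
have [U [aU U01 mU]] := admissible_min_exists; have [aUp mUp] := Up_min.
by rewrite -(admissible_min_unique aU aUp mU (mUp _ aU)).
Qed.

(* Convexity bounds the energy increment of Up + t c from above by t times the derivative at the perturbed point, so that no derivative of the energy is needed. *)
Lemma Up_variation (c : V -> R) : (forall s v, v \in I s -> c v = 0) ->
  \sum_e sgpow p (grad (@Up R S p) e) * grad c e = 0.
Proof.
move: c; set U := @Up R S p.
suff h c : (forall s v, v \in I s -> c v = 0) ->
    0 <= \sum_e sgpow p (grad U e) * grad c e.
  move=> c hc; apply/eqP; rewrite eq_le h// andbT -oppr_ge0 -sumrN.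
  have := h (fun v => - c v) (fun s v vI => etrans (congr1 -%R (hc s v vI)) (oppr0 _)).
  by congr (0 <= _); apply: eq_bigr => e _; rewrite -opprD mulrN.
move=> hc; have [aU mU] := Up_min.
pose F t : R := \sum_e sgpow p (grad U e + t * grad c e) * grad c e.
have cF : continuous F.
  apply: continuous_big => [|e _ t]; first exact: add_continuous.
  apply: cvgM; last exact: cvg_cst.
  apply: (@continuous_comp _ _ _ (fun t : R => grad U e + t * grad c e) (sgpow p)).
    by apply: cvgD; [exact: cvg_cst | apply: cvgM; [exact: cvg_id | exact: cvg_cst]].
  exact: continuous_sgpow.
have F0 t : 0 < t -> 0 <= F t.
  move=> t0; pose W v := U v + t * c v.
  have aW : admissible W.
    by split=> v vI; rewrite /W (hc _ _ vI) mulr0 addr0; [exact: aU.1 | exact: aU.2].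
  have : 0 <= @energy R (G1 S) p W - @energy R (G1 S) p U by rewrite subr_ge0; exact: mU.
  rewrite /energy -sumrB => h.
  have : 0 <= \sum_e p * t * (sgpow p (grad U e + t * grad c e) * grad c e).
    apply: (le_trans h); apply: ler_sum => e _.
    have gW : grad W e = grad U e + t * grad c e by rewrite /W; ring.
    have := @powR_tangent _ p (grad W e) (grad U e) p1; rewrite gW.
    by set x := sgpow _ _; rewrite /=; nra.
  by rewrite -mulr_sumr pmulr_rge0 // mulr_gt0.
have -> : \sum_e sgpow p (grad U e) * grad c e = F 0.
  by apply: eq_bigr => e _; rewrite mul0r addr0.
rewrite leNgt; apply/negP => F00.
have /cvgrPdist_lt /(_ (- F 0)) := cF 0; rewrite oppr_gt0 => /(_ F00) [d /= d0 hd].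
have d2 : 0 < d / 2 by rewrite divr_gt0.
have := hd (d / 2); rewrite /= sub0r normrN gtr0_norm// => /(_ ltac:(lra)).
have := F0 _ d2; rewrite distrC => Fd.
rewrite ger0_norm ?subr_ge0; lra.
Qed.

Local Notation U := (@Up R S p).
Local Notation M := (@Mp R S p).
Let J0 (v w : vertex (G1 S)) : R := sgpow p (U v - U w).

Lemma J0N v w : J0 v w = - J0 w v.
Proof. by rewrite /J0 -sgpowN opprB. Qed.

(** The first variation in the direction of the indicator of v. *)
Lemma Up_harmonic v : v \notin I true -> v \notin I false -> @div R (G1 S) J0 v = 0.
Proof.
move=> v1 v0; have := @sum_div R (G1 S) (@pole_neq S) J0 (fun w => (w == v)%:R) J0N.
rewrite (bigD1 v) //= eqxx mul1r big1 ?addr0; last first.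
  by move=> w /negPf ->; rewrite mul0r.
move=> ->; apply: (@Up_variation (fun w => (w == v)%:R)) => s w wI; case: eqP => // wv.
by move: wI v1 v0; rewrite wv; case: s => ->.
Qed.

Lemma sum_sgpow_grad : \sum_e sgpow p (grad U e) * grad U e = M.
Proof. by apply: eq_bigr => e _; rewrite sgpow_mul. Qed.

Lemma Mp_gt0 : 0 < M.
Proof.
rewrite lt_def energy_ge0 andbT; apply/eqP => M0.
have g0 e : grad U e = 0.
  have /psumr_eq0P : forall e : edge S, true -> 0 <= `|grad U e| `^ p.
    by move=> *; exact: powR_ge0.
  move=> /(_ M0 e isT) /powR_eq0_eq0 /eqP; by rewrite normr_eq0 => /eqP.
have [[U1 U0] _] := Up_min.
have [a _] := symbol_inhabited S.
have := @connected_G1 S (fun w => U w = 1) _ (phi true a) (phi false a).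
rewrite U1 ?mem_Iset// U0 ?mem_Iset// => h.
suff : (0 : R) = 1 by lra.
apply: h => // s e; have := g0 e; case: s => /=; lra.
Qed.

(** The flow dual to [Up]: the current sgpow p (grad U) has strength M, whence the normalization.
    The test [adj] is there because a flow vanishes off the edges. *)
Definition Jopt (v w : vertex (G1 S)) : R :=
  if @adj (G1 S) v w then M^-1 * sgpow p (U v - U w) else 0.

Lemma JoptN v w : Jopt v w = - Jopt w v.
Proof.
by rewrite /Jopt adj_sym; case: ifP; rewrite ?oppr0// -mulrN -sgpowN opprB.
Qed.

Lemma Jopt_edge e : Jopt (pole true e) (pole false e) = M^-1 * sgpow p (grad U e).
Proof. by rewrite /Jopt (@adj_oend (G1 S) true e). Qed.

Lemma div_Jopt v : @div R (G1 S) Jopt v = M^-1 * @div R (G1 S) J0 v.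
Proof.
rewrite !divE; try exact: pole_neq.
rewrite mulr_sumr; apply: eq_bigr => e _; rewrite mulr_sumr.
by apply: eq_bigr => s /eqP <-; rewrite /Jopt (@adj_oend (G1 S)).
Qed.

Lemma sum_flow (J : vertex (G1 S) -> vertex (G1 S) -> R) (W : V -> R) :
  unit_flow (I true) (I false) J -> admissible W ->
  \sum_e J (pole true e) (pole false e) * grad W e = 1.
Proof.
move=> [JN _ J0' J1] [W1 W0].
have <- := @sum_div R (G1 S) (@pole_neq S) J W JN.
rewrite -J1 (bigID (mem (I true))) /= [X in _ + X]big1 ?addr0.
  by apply: eq_bigr => v vI; rewrite W1// mul1r.
move=> v vI; have [vI0|vI0] := boolP (v \in I false); first by rewrite W0// mul0r.
by rewrite J0'// mulr0.
Qed.

Lemma Jopt_flow : unit_flow (I true) (I false) Jopt.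
Proof.
have [[U1 U0] _] := Up_min.
split; first exact: JoptN.
- by move=> v w /negbTE h; rewrite /Jopt h.
- by move=> v v1 v0; rewrite div_Jopt Up_harmonic// mulr0.
have <- : M^-1 * M = 1 by rewrite mulVf// gt_eqF// Mp_gt0.
rewrite -[X in _ * X]sum_sgpow_grad mulr_sumr.
under [RHS]eq_bigr do rewrite mulrA -Jopt_edge.
have <- := @sum_div R (G1 S) (@pole_neq S) Jopt U JoptN.
rewrite [RHS](bigID (mem (I true))) /= [X in _ + X]big1 ?addr0.
  by apply: eq_bigr => v vI; rewrite U1// mul1r.
move=> v vI; have [vI0|vI0] := boolP (v \in I false); first by rewrite U0// mul0r.
by rewrite div_Jopt Up_harmonic// !mulr0.
Qed.

Let q := p / (p - 1).
Let q1 : 1 < q. Proof.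
have h : 0 < p - 1 by rewrite subr_gt0.
by rewrite /q ltr_pdivlMr// mul1r ltrBlDr ltrDl.
Qed.

Lemma sgpow_Jopt e : sgpow q (Jopt (pole true e) (pole false e)) =
  sgpow q M^-1 * grad U e.
Proof. by rewrite Jopt_edge sgpowM sgpowK. Qed.

(** [sgpow q] of [Jopt] is a multiple of grad U, and every unit flow pairs to 1 with grad U
    ([sum_flow]). So the linear terms of the tangent inequalities at [Jopt] sum to 0 for every
    competitor; strictness gives uniqueness. *)
Lemma Jopt_min J : unit_flow (I true) (I false) J ->
  @flow_energy R (G1 S) q Jopt <= @flow_energy R (G1 S) q J /\
  (@flow_energy R (G1 S) q J <= @flow_energy R (G1 S) q Jopt ->
   forall e, J (pole true e) (pole false e) = Jopt (pole true e) (pole false e)).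
Proof.
move=> fJ; have [aU _] := Up_min.
pose x e := Jopt (pole true e) (pole false e).
pose y e := J (pole true e) (pole false e).
have z : \sum_e q * sgpow q (x e) * (y e - x e) = 0.
  under eq_bigr do rewrite sgpow_Jopt -mulrA -mulrA (mulrC (grad U _)) mulrBl.
  rewrite -!mulr_sumr sumrB (sum_flow fJ aU) (sum_flow Jopt_flow aU).
  by rewrite subrr !mulr0.
have le e : `|x e| `^ q + q * sgpow q (x e) * (y e - x e) <= `|y e| `^ q.
  exact: powR_tangent.
have le1 : @flow_energy R (G1 S) q Jopt <= @flow_energy R (G1 S) q J.
  by rewrite -[X in X <= _]addr0 -z -big_split /=; apply: ler_sum => e _; exact: le.
split=> // le2 e; apply/eqP; apply: contraT => ne.
move: le2; rewrite leNgt => /negP; case.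
rewrite -[X in X < _]addr0 -z -big_split /=.
rewrite (bigD1 e)//= [X in _ < X](bigD1 e)//=; apply: ltr_leD.
  exact: powR_tangent_lt.
by apply: ler_sum => f _; exact: le.
Qed.

Lemma Jp_opt : unit_flow (I true) (I false) (@Jp R S p) /\
  forall s e, @Jp R S p (pole s e) (pole (~~ s) e) = Jopt (pole s e) (pole (~~ s) e).
Proof.
have [fJ mJ] : [set J | unit_flow (I true) (I false) J /\ forall J',
    unit_flow (I true) (I false) J' ->
      @flow_energy R (G1 S) q J <= @flow_energy R (G1 S) q J'] (@Jp R S p).
  rewrite /Jp -/q; case: xgetP => [J _ //|/(_ Jopt) []].
  by split; [exact: Jopt_flow | move=> J' /Jopt_min[]].
split=> // s e; have [_ h] := Jopt_min fJ.
have := h (mJ _ Jopt_flow) e; case: s => //= h'.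
by have [JN _ _ _] := fJ; rewrite JN h' -JoptN.
Qed.

Lemma gate_flowE s a : @gate_flow R S p s a = @div R (G1 S) (@Jp R S p) (phi s a).
Proof. by rewrite /gate_flow div_gate. Qed.

(** At a plus gate [Up] has its maximal value 1, so the current flows out of it. *)
Lemma Jdens_ge0 a : 0 <= @Jdens R S p a.
Proof.
rewrite /Jdens /gate_flow /=; have [[t e] /= h _] := gate_edgeP D true a.
rewrite (nbrE D h) -h Jp_opt.2 /Jopt (@adj_oend (G1 S) t e) mulr_ge0 ?invr_ge0 ?(ltW Mp_gt0)//.
apply: sgpow_ge0; rewrite h; have [[U1 _] _] := Up_min; rewrite U1 ?mem_Iset//.
by have /andP[_] := Up_itv (pole (~~ t) e); rewrite subr_ge0.
Qed.

Lemma sum_Jdens : \sum_a @Jdens R S p a = 1.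
Proof.
have [[_ _ _ <-] _] := Jp_opt.
by rewrite (sum_Iset D); apply: eq_bigr => a _; exact: gate_flowE.
Qed.

(** Summation by parts for the optimal flow. Conductive uniformity makes its divergences at phi_+(a)
    and phi_-(a) opposite, which turns the boundary terms into differences of W. *)
Lemma sum_Jdens_grad (hcu : conductively_uniform R S) (W : V -> R) :
  \sum_a @Jdens R S p a * (W (phi true a) - W (phi false a)) =
  M^-1 * \sum_e sgpow p (grad U e) * grad W e.
Proof.
have [[JN _ J0' J1] hJ] := Jp_opt.
rewrite mulr_sumr; under [RHS]eq_bigr do rewrite mulrA -Jopt_edge -(hJ true).
have <- := @sum_div R (G1 S) (@pole_neq S) (@Jp R S p) W JN.
rewrite (bigID (mem (I true))) /= [X in _ = _ + X](bigID (mem (I false))) /=.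
rewrite [X in _ = _ + (_ + X)]big1 ?addr0; last first.
  by move=> v /andP[v1 v0]; rewrite J0'// mulr0.
rewrite (sum_Iset D).
have -> : \sum_(v | (v \notin I true) && (v \in I false)) W v * @div R (G1 S) (@Jp R S p) v =
    \sum_a W (phi false a) * @div R (G1 S) (@Jp R S p) (phi false a).
  rewrite -(sum_Iset D false (fun v => W v * @div R (G1 S) (@Jp R S p) v)).
  apply: eq_bigl => v; case: (boolP (v \in I true)) => //= /(IsetC D) /negPf ->//.
rewrite -big_split /=; apply: eq_bigr => a _.
have := hcu p p1 a; rewrite !gate_flowE -[in LHS]gate_flowE /Jdens gate_flowE => ->.
ring.
Qed.

(* The tangent inequality at lam grad Up, where lam is the J-average of the increments of W. *)
Lemma flow_average_le (hcu : conductively_uniform R S) (W : V -> R) :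
  M * `|\sum_a @Jdens R S p a * (W (phi true a) - W (phi false a))| `^ p <=
  \sum_e `|grad W e| `^ p.
Proof.
set lam := \sum_a Jdens p a * _; have M0 := Mp_gt0.
have hl : \sum_e sgpow p (grad U e) * grad W e = M * lam.
  by rewrite /lam sum_Jdens_grad// mulrA mulfV ?gt_eqF// mul1r.
have : \sum_e (`|lam * grad U e| `^ p + p * sgpow p (lam * grad U e) *
    (grad W e - lam * grad U e)) <= \sum_e `|grad W e| `^ p.
  by apply: ler_sum => e _; exact: powR_tangent.
apply: le_trans; rewrite big_split /=.
have -> : \sum_e `|lam * grad U e| `^ p = M * `|lam| `^ p.
  by rewrite /Mp /energy mulr_suml; apply: eq_bigr => e _; rewrite normrM powRM// mulrC.
rewrite -[X in X <= _]addr0 lerD2l.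
have -> : \sum_e p * sgpow p (lam * grad U e) * (grad W e - lam * grad U e) =
    p * sgpow p lam * (\sum_e sgpow p (grad U e) * grad W e -
      lam * \sum_e sgpow p (grad U e) * grad U e).
  rewrite [lam * _]mulr_sumr -sumrB mulr_sumr.
  by apply: eq_bigr => e _; rewrite sgpowM; ring.
by rewrite hl sum_sgpow_grad (mulrC M) subrr mulr0.
Qed.

(** Strict maximum principle. A gradient of modulus 1 joins a vertex of value 1 to one of value 0;
    by non-degeneracy one of the two is not a gate, and there harmonicity at an extreme value
    excludes any current. The strict bound makes iterated extensions converge uniformly. *)
Lemma Up_eq1 (hnd : non_degenerate S) e : `|grad U e| < 1.
Proof.
have [[U1 U0] _] := Up_min.
suff h s : U (pole s e) = 1 -> U (pole (~~ s) e) = 0 -> False.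
  have /andP[a0 a1] := Up_itv (pole true e); have /andP[b0 b1] := Up_itv (pole false e).
  rewrite ltr_norml; apply/andP; split; rewrite ltNge; apply/negP => ab.
    by apply: (h false) => /=; lra.
  by apply: (h true) => /=; lra.
move=> h1 h0.
have sg1 w : 0 <= sgpow p (1 - U w).
  by apply: sgpow_ge0; rewrite subr_ge0; have /andP[] := Up_itv w.
have sg0 w : sgpow p (0 - U w) <= 0.
  rewrite sub0r sgpowN oppr_le0; apply: sgpow_ge0; by have /andP[] := Up_itv w.
have v0 : pole s e \notin I false.
  by apply/negP => /U0; rewrite h1 => /eqP; rewrite oner_eq0.
have w1 : pole (~~ s) e \notin I true.
  by apply/negP => /U1; rewrite h0 => /eqP; rewrite eq_sym oner_eq0.
have [v1|v1] := boolP (pole s e \in I true); last first.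
  have := Up_harmonic v1 v0; rewrite divE; last exact: pole_neq.
  move=> /eqP; rewrite gt_eqF// (bigD1 e)//= ltr_pwDl//.
    rewrite (bigD1 s)//= ltr_pwDl// ?sumr_ge0//.
      by rewrite /J0 h1 h0 subr0 sgpow_gt0.
    by move=> t _; rewrite /J0 h1.
  by apply: sumr_ge0 => f _; apply: sumr_ge0 => t _; rewrite /J0 h1.
have [w0|w0] := boolP (pole (~~ s) e \in I false).
  by have := hnd _ _ v1 w0; rewrite (@adj_oend (G1 S) s e).
have := Up_harmonic w1 w0; rewrite divE; last exact: pole_neq.
move=> /eqP; rewrite lt_eqF// -oppr_gt0 -sumrN (bigD1 e)//= ltr_pwDl//.
  rewrite -sumrN (bigD1 (~~ s))//= ltr_pwDl// ?sumr_ge0//.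
    by rewrite /J0 negbK h1 h0 sub0r sgpowN opprK sgpow_gt0.
  by move=> t _; rewrite /J0 h0 oppr_ge0.
apply: sumr_ge0 => f _; rewrite -sumrN; apply: sumr_ge0 => t _.
by rewrite /J0 h0 oppr_ge0.
Qed.

End Potential.

(** * Graph distance and the Lipschitz potential of the generator *)

Section Distance.
Context (G : mgraph).
Implicit Types (v w : vertex G).

Lemma walk_gdist v w : (gdist v w < #|vertex G|)%N -> walk (gdist v w) v w.
Proof.
move=> h; have := @nth_find _ 0%N (fun n => walk n v w) (iota 0 #|vertex G|).
by rewrite has_find size_iota => /(_ h); rewrite nth_iota.
Qed.

Lemma gdist_le_card v w : (gdist v w <= #|vertex G|)%N.
Proof. by rewrite -[X in (_ <= X)%N](size_iota 0) find_size. Qed.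

Lemma gdist_le n v w : walk n v w -> (gdist v w <= n)%N.
Proof.
move=> h; rewrite leqNgt; apply/negP => lt.
have ltc := leq_trans lt (gdist_le_card v w).
by have := before_find 0%N lt; rewrite nth_iota// add0n h.
Qed.

Lemma walk0 v w : walk 0 v w = (v == w).
Proof.
apply/existsP/idP => [[s]|vw]; first by rewrite tuple0.
by exists [tuple]; rewrite /= vw.
Qed.

Lemma walkS n v v' w : adj v v' -> walk n v' w -> walk n.+1 v w.
Proof.
move=> a /existsP[s h]; apply/existsP; exists [tuple of v' :: s] => /=.
by rewrite a.
Qed.

Lemma walk1 v w : walk 1 v w -> adj v w.
Proof.
by move=> /existsP[[[|x [|//]] //= _]]; rewrite andbT => /andP[+ /eqP <-].
Qed.

Lemma gdist_adj v v' w : adj v v' -> (gdist v w <= (gdist v' w).+1)%N.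
Proof.
move=> a; have [h|h] := ltnP (gdist v' w) #|vertex G|.
  by apply/gdist_le/(walkS a)/walk_gdist.
by apply: leq_trans (gdist_le_card _ _) (leq_trans h _).
Qed.

Lemma bigmin_le (T : finType) (A : {set T}) (F : T -> nat) N (x : T) :
  x \in A -> (\big[minn/N]_(y in A) F y <= F x)%N.
Proof.
move=> xA; have := mem_index_enum x; elim: (index_enum T) => // y s IH.
rewrite inE big_cons => /orP[/eqP <-|/IH h]; first by rewrite xA geq_minl.
by case: ifP => // _; rewrite geq_min h orbT.
Qed.

Lemma le_bigmin (T : finType) (A : {set T}) (F : T -> nat) N m : (m <= N)%N ->
  (forall x, x \in A -> m <= F x)%N -> (m <= \big[minn/N]_(y in A) F y)%N.
Proof.
move=> mN mF; elim/big_rec: _ => // x y xA my.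
by rewrite leq_min mF.
Qed.

End Distance.

Section LipschitzPotential.
Context (R : realType) (S : simple_igs) (D : doubling S) (hnd : non_degenerate S).
Local Notation V := (vertex S).
Local Notation I s := (Iset S s).
Local Notation grad U e := (U (pole true e) - U (pole false e)).
Local Notation L := (Lstar S).
Let E : exists e : edge S, True := doubling_edge D.

Definition distI (v : vertex (G1 S)) : nat :=
  \big[minn/#|V|]_(w in I false) @gdist (G1 S) v w.

(** [sdist] starts its minima at the number of vertices, so the bound 2 <= L has to hold for that
    default as well. *)
Lemma card_vertex_ge2 : (2 <= #|V|)%N.
Proof.
have [e _] := E; have : (#|[set pole true e; pole false e]%SET| <= #|V|)%N.
  exact: max_card.
by rewrite cards2 pole_neq.
Qed.

Lemma Lstar_ge2 : (2 <= L)%N.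
Proof.
apply: le_bigmin => [|v vI]; first exact: card_vertex_ge2.
apply: le_bigmin => [|w wI]; first exact: card_vertex_ge2.
rewrite ltnNge; apply/negP => h.
have hV := leq_ltn_trans h card_vertex_ge2.
have := @walk_gdist (G1 S) _ _ hV; move: h; case: (gdist v w) => [_|[_|//]].
  by rewrite walk0 => /eqP vw; have := IsetC D vI; rewrite vw wI.
by move=> /walk1; apply/negP; exact: hnd.
Qed.

Lemma distI_lip (s : bool) e : (distI (pole s e) <= (distI (pole (~~ s) e)).+1)%N.
Proof.
rewrite {2}/distI; set v := pole s e; set v' := pole _ e.
have : (distI v <= #|V|.+1)%N.
  by rewrite /distI; elim/big_rec: _ => [//|x y _ h]; rewrite (leq_trans _ h) ?geq_minr.
elim/big_rec: _ => [//|w y wI IH h].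
rewrite /minn; case: ifP => _; last exact: IH.
rewrite /distI; apply: leq_trans (bigmin_le (@gdist (G1 S) v) _ wI) _; apply: gdist_adj.
exact: (@adj_oend (G1 S) s e).
Qed.

(** The distance to I_-, cut off at L and normalized: admissible like [Up], with gradients at most 1
    / L. It takes the place of [Up] where the metric rather than the energy matters. *)
Definition lipI (v : V) : R := (minn (distI v) L)%:R / L%:R.

Lemma Lstar_gt0 : 0 < L%:R :> R.
Proof. by rewrite ltr0n; apply: leq_trans Lstar_ge2. Qed.

Lemma lipI_admissible : @admissible R S lipI.
Proof.
split=> v vI; rewrite /lipI.
  rewrite (minn_idPr _) ?divff ?gt_eqF ?Lstar_gt0//.
  exact: (bigmin_le (fun v => \big[minn/#|V|]_(w in I false) @gdist (G1 S) v w) _ vI).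
suff -> : distI v = 0%N by rewrite min0n mul0r.
apply/eqP; rewrite -leqn0; rewrite /distI; apply: leq_trans (bigmin_le (gdist v) _ vI) _.
by apply: gdist_le; rewrite walk0.
Qed.

Lemma lipI_itv v : 0 <= lipI v <= 1.
Proof.
rewrite /lipI divr_ge0//= ler_pdivrMr ?Lstar_gt0// mul1r ler_nat; exact: geq_minr.
Qed.

Lemma lipI_grad e : `|grad lipI e| <= L%:R^-1.
Proof.
rewrite /lipI -mulrBl normrM (ger0_norm (_ : 0 <= L%:R^-1)) ?invr_ge0//.
rewrite -[X in _ <= X]mul1r ler_wpM2r ?invr_ge0//.
have := distI_lip true e; have := distI_lip false e => /=.
set a := distI _; set b := distI _ => h1 h2.
have h3 : (minn a L <= (minn b L).+1)%N by lia.
have h4 : (minn b L <= (minn a L).+1)%N by lia.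
move: h3 h4; rewrite -!(ler_nat R) -!natr1 ler_norml; lra.
Qed.

(** [lipI] competes with [Up], and each edge contributes at most L^-p < 1 to its energy. *)
Lemma Mp_lt p : 1 < p -> Mp S p < #|edge S|%:R :> R.
Proof.
move=> p1; have [_ h] := Up_min D p1.
have p0 : 0 < p by lra.
apply: (le_lt_trans (h _ lipI_admissible)).
have -> : #|edge S|%:R = \sum_(e : oedge (G1 S)) (1 : R) by rewrite sumr_const.
have [e0 _] := E.
have lt1 (e : edge S) : `|grad lipI e| `^ p < 1.
  apply: (@le_lt_trans _ _ (L%:R^-1 `^ p)).
    apply: ge0_ler_powR; rewrite ?nnegrE ?invr_ge0//; [exact: ltW|exact: lipI_grad].
  have {2}<- : 1 `^ p = 1 :> R by rewrite powR1.
  apply: gt0_ltr_powR; rewrite ?nnegrE ?invr_ge0//.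
  by rewrite invf_lt1 ?Lstar_gt0// ltr1n; exact: Lstar_ge2.
rewrite /energy (bigD1 e0)//= [X in _ < X](bigD1 e0)//=.
by apply: ltr_leD; [exact: lt1 | apply: ler_sum => e _; exact/ltW/lt1].
Qed.

Lemma dwalk_ge0 p : 1 < p -> 0 <= @dwalk R S p.
Proof.
move=> p1; have M0 := Mp_gt0 D p1; have MN := Mp_lt p1.
rewrite /dwalk divr_ge0// ln_ge0//.
  by rewrite ler_pdivlMr// mul1r ltW.
by rewrite ler1n; apply: leq_trans Lstar_ge2.
Qed.

Lemma powR_dwalk p n : 1 < p ->
  (L%:R ^+ n : R) `^ dwalk S p = (#|edge S|%:R / Mp S p) ^+ n.
Proof.
move=> p1; have M0 := Mp_gt0 D p1; have MN := Mp_lt p1.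
have L0 := Lstar_gt0.
have lnL : 0 < ln (L%:R : R) by rewrite ln_gt0// ltr1n; exact: Lstar_ge2.
have r0 : 0 < #|edge S|%:R / Mp S p by rewrite divr_gt0// (lt_trans M0).
have -> : (L%:R : R) ^+ n = L%:R `^ n%:R by rewrite powR_mulrn ?ltW.
rewrite -powRrM mulrC powRrM -powR_mulrn ?ltW//; congr (_ `^ _).
rewrite /powR gt_eqF// /dwalk mulfVK ?gt_eqF// lnK// posrE//.
Qed.

End LipschitzPotential.

(** * Replacement graphs and their cells *)

Section StepGraph.
Context (S : simple_igs) (D : doubling S) (G : ograph).
Hypothesis noloop : forall e : oedge G, oend true e != oend false e.
Implicit Types (x y : vertex S * oedge G).
Let E : exists e : edge S, True := doubling_edge D.

Lemma oend_inj s t (e : oedge G) : oend s e = oend t e -> s = t.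
Proof.
by case: s; case: t => // h; have := noloop e; rewrite h eqxx.
Qed.

Lemma glueP x y : reflect (exists a s t, [/\ oend s x.2 = oend t y.2,
  x.1 = phi s a & y.1 = phi t a]) (Defs.glue x y).
Proof.
apply: (iffP existsP) => [[a /existsP[s /existsP[t /and3P[/eqP h1 /eqP h2 /eqP h3]]]]|].
  by exists a, s, t.
move=> [a [s [t [h1 h2 h3]]]]; exists a; apply/existsP; exists s; apply/existsP; exists t.
by rewrite h1 h2 h3 !eqxx.
Qed.

Lemma glue_sym : symmetric (@Defs.glue S G).
Proof.
by move=> x y; apply/glueP/glueP => -[a [s [t [h1 h2 h3]]]]; exists a, t, s.
Qed.

(** [phi s a] determines both s and a, so two consecutive gluings go through the same vertex of G.
    Hence the equivalence closure is reached in one step. *)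
Lemma glue_trans x y z : Defs.glue x y -> Defs.glue y z -> Defs.glue x z.
Proof.
move=> /glueP[a [s [t [h1 h2 h3]]]] /glueP[a' [s' [t' [h1' h2' h3']]]].
apply/glueP; have [ts aa] := phi_eq E (etrans (esym h3) h2').
by exists a, s, t'; rewrite h1 h2 h3' ts aa h1'.
Qed.

Lemma connect_glue x y : connect (@Defs.glue S G) x y = (x == y) || Defs.glue x y.
Proof.
apply/idP/orP => [/connectP[p]|[/eqP -> //|/connect1//]].
elim: p x => [|z p IH] x /=; first by move=> _ ->; left.
move=> /andP[xz zp] /(IH _ zp)[/eqP <-|zy]; right => //.
exact: glue_trans zy.
Qed.

Lemma class_eqP z e z' e' : reflect ((z, e) = (z', e') \/ Defs.glue (z, e) (z', e'))
  (@class S G z e == class z' e').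
Proof.
have cs : connect_sym (@Defs.glue S G) by apply: sym_connect_sym; exact: glue_sym.
apply: (iffP eqP) => [/(congr1 val)/= /setP/(_ (z', e'))|h].
  by rewrite !inE connect0 connect_glue => /orP[/eqP|]; [left|right].
apply: val_inj => /=; apply/setP => y; rewrite !inE.
apply: same_connect => //; rewrite connect_glue.
by case: h => [->|->]; rewrite ?eqxx ?orbT.
Qed.

Lemma class_phi s t e e' a : oend s e = oend t e' ->
  @class S G (phi s a) e = class (phi t a) e'.
Proof.
by move=> h; apply/eqP/class_eqP; right; apply/glueP; exists a, s, t.
Qed.

Lemma class_inj e : injective (fun z => @class S G z e).
Proof.
move=> z z' /eqP/class_eqP[[]//|/glueP[a [s [t [/= /oend_inj -> -> ->]]]]] //.
Qed.

Lemma classP (C : step_vertex S G) : exists x, C = class x.1 x.2.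
Proof.
case: C => C CP; have /imsetP[[z e] _ h] := CP; exists (z, e).
exact: val_inj.
Qed.

Lemma step_noloop (f : oedge (step S G)) : oend true f != oend false f.
Proof.
by case: f => e f; apply/eqP => /class_inj /eqP; apply/negP; exact: pole_neq.
Qed.

Section Extension.
Context (R : realType) (U : vertex S -> R) (aU : @admissible R S U).

(** Interpolation between the values at the two ends of an edge, with weight U. A representative of
    the class is chosen; [extE] shows that the choice does not matter, since only gate vertices are
    identified and there U is 0 or 1. *)
Definition ext (u : overtex G -> R) (C : step_vertex S G) : R :=
  let x := projT1 (cid (classP C)) in
  u (oend false x.2) + U x.1 * (u (oend true x.2) - u (oend false x.2)).

Lemma extE u z e : ext u (class z e) =
  u (oend false e) + U z * (u (oend true e) - u (oend false e)).
Proof.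
rewrite /ext; case: cid => -[z' e'] /= /eqP /class_eqP[[-> ->]//|].
move=> /glueP[a [s [t [/= h -> ->]]]].
have hU s' e'' : u (oend false e'') + U (phi s' a) * (u (oend true e'') - u (oend false e''))
    = u (oend s' e'').
  have [U1 U0] := aU.
  by case: s'; rewrite ?(U1 _ (mem_Iset true a)) ?(U0 _ (mem_Iset false a)); ring.
by rewrite !hU h.
Qed.

Lemma ext_phi u s a e : ext u (class (phi s a) e) = u (oend s e).
Proof.
have [U1 U0] := aU; rewrite extE.
by case: s; rewrite ?(U1 _ (mem_Iset true a)) ?(U0 _ (mem_Iset false a)); ring.
Qed.

Lemma ext_grad u (e : oedge G) (f : edge S) :
  ext u (@oend (step S G) true (e, f)) - ext u (@oend (step S G) false (e, f)) =
  (U (pole true f) - U (pole false f)) * (u (oend true e) - u (oend false e)).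
Proof. by rewrite /= !extE; ring. Qed.

Lemma ext_itv u z e lo hi : (forall z, 0 <= U z <= 1) ->
  (forall s, lo <= u (oend s e) <= hi) -> lo <= ext u (class z e) <= hi.
Proof.
move=> U01 h; rewrite extE; have /andP[u0 u1] := U01 z.
have /andP[a0 a1] := h true; have /andP[b0 b1] := h false.
by apply/andP; split; nra.
Qed.

Lemma energy_ext p u : @energy R (step S G) p (ext u) =
  @energy R (G1 S) p U * @energy R G p u.
Proof.
rewrite /energy big_distrlr /= exchange_big /= pair_bigA /=.
by apply: eq_bigr => -[e f] _; rewrite ext_grad normrM powRM//.
Qed.

End Extension.
End StepGraph.

Section Levels.
Context (S : simple_igs) (D : doubling S).
Implicit Types (a : symbol S) (f : edge S).
Let E : exists e : edge S, True := doubling_edge D.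

Lemma Gr_noloop n (e : oedge (Gr S n)) : oend true e != oend false e.
Proof. by case: n e => [|n] e //; apply: step_noloop => // {}e; elim: n e => [|n IH] e //; apply: step_noloop. Qed.

Lemma pole_surj (z : vertex S) : exists s f, z = pole s f.
Proof.
have [e _] := E; apply: (@connected_G1 S (fun z => exists s f, z = pole s f) _ (pole true e)).
  by move=> s f _; exists (~~ s), f.
by exists true, e.
Qed.

Lemma oend_surj n (v : vertex (Gr S n)) : exists s (e : edge (Gr S n)), v = oend s e.
Proof.
case: n v => [|n] v; first by exists v, tt.
have [[z e] ->] := classP v; have [s [f ->]] := pole_surj z.
by exists s, (e, f).
Qed.

Lemma vmulE n s (e : edge (Gr S n)) a : vmul D (oend s e) a = cls (phi s a) e.
Proof.
rewrite /vmul; case: pickP => [[t g] /= /eqP h|/(_ (s, e))]; last by rewrite eqxx.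
by apply: class_phi.
Qed.

Lemma cls_in n (e : edge (Gr S n)) z : exists s f, cls z e = @oend (Gr S n.+1) s (e, f).
Proof. by have [s [f ->]] := pole_surj z; exists s, f. Qed.

Lemma cls_eq n (e e' : edge (Gr S n)) z z' : cls z e = cls z' e' ->
  (z = z' /\ e = e') \/ exists s t a, [/\ oend s e = oend t e', z = phi s a & z' = phi t a].
Proof.
move=> /eqP /(class_eqP D)[[-> ->]|/glueP[a [s [t [h1 h2 h3]]]]]; first by left.
by right; exists s, t, a.
Qed.

Definition meet n (e e' : edge (Gr S n)) : bool := (ends e :&: ends e')%SET != finset.set0.

Lemma meetP n (e e' : edge (Gr S n)) : reflect (exists s t, oend s e = oend t e') (meet e e').
Proof.
apply: (iffP (finset.set0Pn _)) => [[v]|[s [t h]]].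
  by rewrite finset.in_setI => /andP[/mem_endsP[s ->] /mem_endsP[t h]]; exists s, t.
by exists (oend s e); rewrite finset.in_setI oend_ends h oend_ends.
Qed.

Lemma meet_refl n (e : edge (Gr S n)) : meet e e.
Proof. by apply/meetP; exists true, true. Qed.

Lemma meet_sym n (e e' : edge (Gr S n)) : meet e e' = meet e' e.
Proof. by rewrite /meet finset.setIC. Qed.

(** A vertex of level n + 1 shared by two different parent edges is a gate vertex over a common end
    of them. *)
Lemma meet_pred n (e e' : edge (Gr S n.+1)) : meet e e' -> meet e.1 e'.1.
Proof.
move=> /meetP[s [t h]]; case: e e' h => [e f] [e' f'] /= /cls_eq[[_ ->]|].
  exact: meet_refl.
by move=> [s' [t' [a [h _ _]]]]; apply/meetP; exists s', t'.
Qed.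

(** The bound does not grow with n: a gate vertex over v has at most one edge inside each parent
    edge at v, because gates have degree one, so its degree is at most that of v; any other vertex
    lies in a single copy of the generator. *)
Lemma deg_Gr n (v : vertex (Gr S n)) : (deg v <= #|edge S|)%N.
Proof.
have N0 : (0 < #|edge S|)%N by have [e _] := E; apply/card_gt0P; exists e.
elim: n v => [|n IH] v.
  by apply: leq_trans (max_card _) _; rewrite card_unit.
have [s [[e f] hv]] := oend_surj v.
have [/'exists_existsP[t [a h]]|h] := boolP [exists t, exists a, pole s f == phi t a].
  move/eqP: h => h.
  apply: leq_trans (IH (oend t e)); rewrite /deg.
  rewrite -(card_in_imset (f := fst)); last first.
    move=> [e1 f1] [e2 f2]; rewrite !inE => /orP h1 /orP h2 /= e12.
    have H e0 f0 : v = cls (pole true f0) e0 \/ v = cls (pole false f0) e0 ->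
        exists t0 s0, pole s0 f0 = phi t0 a /\ oend t0 e0 = oend t e.
      rewrite hv /= => -[] /cls_eq[[h0 <-]|[t1 [t2 [b [h3 h4 h5]]]]].
      - by exists t, true; rewrite -h0.
      - by exists t2, true; have [-> ->] := phi_eq E (etrans (esym h) h4).
      - by exists t, false; rewrite -h0.
      - by exists t2, false; have [-> ->] := phi_eq E (etrans (esym h) h4).
    have [t1 [s1 [p1 o1]]] : exists t0 s0, pole s0 f1 = phi t0 a /\ oend t0 e1 = oend t e.
      by apply: H; case: h1 => /eqP ->; [left|right].
    have [t2 [s2 [p2 o2]]] : exists t0 s0, pole s0 f2 = phi t0 a /\ oend t0 e2 = oend t e.
      by apply: H; case: h2 => /eqP ->; [left|right].
    have t12 : t1 = t2.
      by apply: (oend_inj (@Gr_noloop n) (e := e1)); rewrite o1 e12 o2.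
    have [te _ hte] := gate_edgeP D t1 a.
    have := hte _ _ p1; rewrite t12 in p1 hte; rewrite -(hte _ _ p2) => -[_ ->].
    by rewrite e12.
  apply: subset_leq_card; apply/fintype.subsetP => e' /imsetP[[e1 f1]]; rewrite inE => /mem_endsP[s1].
  rewrite hv /= => /cls_eq[[_ ->]|[t1 [t2 [b [h3 h4 h5]]]]] -> /=.
    by rewrite inE; apply: oend_ends.
  have [-> _] := phi_eq E (etrans (esym h) h4).
  by rewrite inE h3; apply: oend_ends.
have N t a : pole s f != phi t a.
  by apply: contra h => h; apply/existsP; exists t; apply/existsP; exists a.
rewrite /deg -(card_in_imset (f := snd)) ?max_card//.
move=> [e1 f1] [e2 f2]; rewrite !inE => /orP h1 /orP h2 /= ->; congr (_, _).
have H e0 f0 : v = cls (pole true f0) e0 \/ v = cls (pole false f0) e0 -> e = e0.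
  rewrite hv /= => -[] /cls_eq[[h0 <-//]|[t1 [t2 [b [h3 h4 h5]]]]];
  by move: (N t1 b); rewrite h4 eqxx.
have e1E : e = e1 by apply: (H e1 f1); case: h1 => /eqP ->; [left|right].
have e2E : e = e2 by apply: (H e2 f2); case: h2 => /eqP ->; [left|right].
by rewrite -e1E -e2E.
Qed.

Lemma card_meet n (e : edge (Gr S n)) :
  (#|[set e' : edge (Gr S n) | meet e e']%SET| <= 2 * #|edge S|)%N.
Proof.
have h : (@deg (Gr S n) (oend true e) + @deg (Gr S n) (oend false e) <= 2 * #|edge S|)%N.
  by rewrite mul2n -addnn leq_add ?deg_Gr.
apply: leq_trans h.
rewrite /deg -cardsUI; apply: leq_trans (leq_addr _ _).
apply: subset_leq_card; apply/fintype.subsetP => e'; rewrite !inE => /meetP[s [t h]].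
by case: s h => ->; case: t; rewrite !eqxx ?orbT.
Qed.

Lemma size_word n (e : edge (Gr S n)) : size (word e) = n.
Proof. by elim: n e => [|n IH] e //=; rewrite size_rcons IH. Qed.

Lemma word_inj n : injective (@word S n).
Proof.
elim: n => [[] [] //|n IH] [e f] [e' f'] /= /eqP.
by rewrite eqseq_rcons => /andP[/eqP /IH -> /eqP ->].
Qed.

Lemma prefix_size_le (T : eqType) (w s : seq T) : prefix w s -> (size w <= size s)%N.
Proof. by move=> /prefixP[x ->]; rewrite size_cat leq_addr. Qed.

Lemma prefix_rcons_le (T : eqType) (w s : seq T) x : (size w <= size s)%N ->
  prefix w (rcons s x) = prefix w s.
Proof. by move=> h; rewrite !prefixE -cats1 take_cat; case: ltngtP h => // -> _; rewrite subnn cats0 take_size. Qed.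

(** Unites the two branches of the definition of [cell], for |e| = n and for |e| < n. *)
Lemma cellP n w (v : vertex (Gr S n)) :
  reflect (exists s g, prefix w (word g) /\ v = oend s g) (v \in cell n w).
Proof.
case: n v => [|n] v.
  rewrite /= inE; apply: (iffP eqP) => [->|[s [[] [/= h _]]]]; first by exists v, tt.
  by move: h; case: w.
rewrite /= inE; apply: (iffP orP) => [[/imset2P[s g _ ]|/imset2P[z g _]]|].
- by rewrite inE => /eqP h ->; exists s, g; rewrite -h prefix_refl.
- rewrite inE => h ->; have [s [f ->]] := cls_in g z; exists s, (g, f); split=> //=.
  by rewrite prefix_rcons_le// prefix_size_le.
move=> [s [[g f] [h ->]]]; have := prefix_size_le h; rewrite leq_eqVlt => /orP[/eqP sz|].
  left; apply/imset2P; exists s (g, f) => //; rewrite inE.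
  by move: h; rewrite prefixE sz take_size.
rewrite /= size_rcons ltnS => lt; right; apply/imset2P; exists (pole s f) g => //.
by rewrite inE -(prefix_rcons_le f).
Qed.

Lemma cell_oend n w s (g : edge (Gr S n)) : prefix w (word g) -> oend s g \in cell n w.
Proof. by move=> h; apply/cellP; exists s, g. Qed.

Lemma cell_cls n w z (g : edge (Gr S n)) : prefix w (word g) -> cls z g \in cell n.+1 w.
Proof.
move=> h; have [s [f ->]] := cls_in g z; apply: cell_oend => /=.
by rewrite prefix_rcons_le// prefix_size_le.
Qed.

Lemma cell_clsP n w (v : vertex (Gr S n.+1)) : (size w <= n)%N -> v \in cell n.+1 w ->
  exists z g, prefix w (word g) /\ v = cls z g.
Proof.
move=> sw /cellP[s [[g f] [/= h ->]]]; exists (pole s f), g; split=> //.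
by rewrite -(prefix_rcons_le f)// size_word.
Qed.

Lemma cell_vmul n w (v : vertex (Gr S n)) a : v \in cell n w -> vmul D v a \in cell n.+1 w.
Proof. by move=> /cellP[s [g [h ->]]]; rewrite vmulE cell_cls. Qed.

Section ExtFamily.
Context (R : realType) (U : vertex S -> R) (aU : @admissible R S U).

Definition extends (n : nat) (H : forall m, vertex (Gr S m) -> R) :=
  forall m, (n <= m)%N -> H m.+1 = ext U (H m).

(** Levels index types, so the starting value at level n enters through a cast. The value 0 below
    level n is a mere default. *)
Fixpoint extfam n (u : vertex (Gr S n) -> R) m : vertex (Gr S m) -> R :=
  match n =P m with
  | ReflectT e => ecast k (vertex (Gr S k) -> R) e u
  | ReflectF _ => if m is k.+1 return vertex (Gr S m) -> R
      then ext U (@extfam n u k) else fun=> 0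
  end.

Lemma extfam_start n (u : vertex (Gr S n) -> R) : @extfam n u n = u.
Proof.
by case: n u => [|n] u /=; case: eqP => // e; rewrite (eq_irrelevance e (erefl _)).
Qed.

Lemma extfam_extends n (u : vertex (Gr S n) -> R) : extends n (@extfam n u).
Proof.
move=> m nm /=; case: eqP => // e; exfalso; move: nm; by rewrite e ltnn.
Qed.

Hypothesis U01 : forall z, 0 <= U z <= 1.

(** Maximum principle: [ext] interpolates between the ends of an edge, and an edge of the cell has
    its ends in the cell. *)
Lemma ext_cell j w H lo hi : extends j H -> (size w <= j)%N ->
  (forall v, v \in cell j w -> lo <= H j v <= hi) ->
  forall m v, (j <= m)%N -> v \in cell m w -> lo <= H m v <= hi.
Proof.
move=> eH sw h0 m v jm; move: v; rewrite -(subnK jm) => v.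
elim: (m - j)%N v => [|k IH] v; first exact: h0.
move=> /(@cell_clsP (k + j) w v)[|z [g [hg ->]]]; first exact: leq_trans sw (leq_addl _ _).
change (lo <= H (k + j).+1 (cls z g) <= hi); rewrite eH ?leq_addl//; apply: ext_itv => // s.
by apply: IH; exact: cell_oend.
Qed.

End ExtFamily.

End Levels.

(** * The metric of the limit space *)

(** The infima in [dn] and [dn_edge] range over finite families and are therefore attained. *)
Lemma inf_finite (R : realType) (T : finType) (P : T -> Prop) (F : T -> R) :
  (exists x, P x) ->
  exists x, [/\ P x, inf [set F x | x in P] = F x & forall y, P y -> F x <= F y].
Proof.
move=> [x0 Px0].
have [x /asboolP Px hx] := @arg_minP _ _ _ x0 (fun x => `[<P x>]) F (asboolT Px0).
have h y : P y -> F x <= F y by move=> Py; apply: hx; exact/asboolP.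
exists x; split=> //; apply/eqP; rewrite eq_le; apply/andP; split.
  apply: ge_inf; last by exists x.
  by exists (F x) => _ [y Py <-]; exact: h.
by apply: lb_le_inf; [exists (F x), x | move=> _ [y Py <-]; exact: h].
Qed.

Section Connectivity.
Context (G : ograph).
Implicit Types (A B : {set vertex G}) (x y : vertex G).

Definition inside A : rel (vertex G) := [rel x y | [&& x \in A, y \in A & @adj G x y]].

Lemma connected_inP A : reflect {in A &, forall x y, connect (inside A) x y} (connected_in A).
Proof.
apply: (iffP forall_inP) => [h x y xA yA|h x xA].
  by have /forall_inP := h x xA; apply.
by apply/forall_inP => y; exact: h.
Qed.

Lemma inside_sym A : connect_sym (inside A).
Proof.
apply: sym_connect_sym => x y; rewrite /inside /=.
by rewrite adj_sym; case: (x \in A); case: (y \in A).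
Qed.

Lemma connect_inside_sub A B x y : {subset A <= B} -> connect (inside A) x y -> connect (inside B) x y.
Proof.
move=> AB; apply: connect_sub => u v /= /and3P[uA vA uv]; apply: connect1.
by rewrite /inside /= !AB.
Qed.

Lemma connected_inU A B x y : connected_in A -> connected_in B ->
  x \in A -> y \in B -> x = y \/ @adj G x y -> connected_in (A :|: B)%SET.
Proof.
move=> /connected_inP cA /connected_inP cB xA yB xy.
have sA : {subset A <= (A :|: B)%SET} by move=> u uA; rewrite inE uA.
have sB : {subset B <= (A :|: B)%SET} by move=> u uB; rewrite inE uB orbT.
have cxy : connect (inside (A :|: B)%SET) x y.
  by case: xy => [->//|xy]; apply: connect1; rewrite /inside /= sA ?sB.
have cx u : u \in (A :|: B)%SET -> connect (inside (A :|: B)%SET) u x.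
  rewrite inE => /orP[uA|uB]; first exact: connect_inside_sub (cA _ _ uA xA).
  rewrite inside_sym; apply: connect_trans cxy _.
  exact: connect_inside_sub (cB _ _ yB uB).
apply/connected_inP => u v /cx uC /cx vC.
by apply: connect_trans uC _; rewrite inside_sym.
Qed.

Lemma connected_in_path A x y : connected_in A -> x \in A -> y \in A ->
  exists p, [/\ path (@adj G) x p, last x p = y & {subset x :: p <= A}].
Proof.
move=> /connected_inP cA xA yA; have /connectP[p pp ->] := cA _ _ xA yA.
exists p; elim: p x xA pp {cA} => [|z p IH] x xA /=.
  by split=> // u; rewrite inE => /eqP ->.
move=> /andP[/and3P[_ zA xz] /(IH _ zA) [h1 h2 h3]]; split=> //; first by rewrite xz.
by move=> u; rewrite inE => /orP[/eqP -> //|/h3].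
Qed.

Section Greedy.
Context (T : finType) (piece : T -> {set vertex G}).

(* Leaving a piece through its last visit makes the rest of the path avoid it. *)
Lemma leave_piece e x p : path (@adj G) x p ->
  [\/ {in x :: p, forall y, y \notin piece e}, last x p \in piece e |
   exists y x' p', [/\ y \in piece e, @adj G y x', path (@adj G) x' p',
     last x' p' = last x p & {subset x' :: p' <= x :: p} /\
     {in x' :: p', forall z, z \notin piece e}]].
Proof.
elim: p x => [|x1 p IH] x /=.
  move=> _; case: (boolP (x \in piece e)) => h; first by constructor 2.
  by constructor 1 => y; rewrite inE => /eqP ->.
move=> /andP[xx1 /[dup] hp /IH[h|h|[y [x' [p' [h1 h2 h3 h4 [h5 h6]]]]]]].
- have [xe|xe] := boolP (x \in piece e).
    constructor 3; exists x, x1, p; split=> //; split=> // z zp.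
    by rewrite inE zp orbT.
  by constructor 1 => y; rewrite inE => /orP[/eqP ->|/h].
- by constructor 2.
- constructor 3; exists y, x', p'; split=> //; split=> // z /h5.
  by move=> zin; rewrite in_cons zin orbT.
Qed.

(** After the last visit to a piece, the rest of the path is covered by the other pieces. Each piece
    is thus charged once, even if the path returns to it. *)
Lemma greedy (Om : {set T}) x p : path (@adj G) x p ->
  {subset x :: p <= (\bigcup_(e in Om) piece e)%SET} ->
  exists2 e, e \in Om /\ x \in piece e &
   last x p \in piece e \/
   exists y x' p', [/\ y \in piece e, @adj G y x', path (@adj G) x' p',
     last x' p' = last x p &
     {subset x' :: p' <= (\bigcup_(e' in Om :\ e) piece e')%SET}].
Proof.
move=> hp hs; have /hs/finset.bigcupP[e eOm xe] := mem_head x p.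
exists e => //; case: (leave_piece e hp) => [/(_ x (mem_head _ _))|h|].
- by rewrite xe.
- by left.
move=> [y [x' [p' [h1 h2 h3 h4 [h5 h6]]]]]; right; exists y, x', p'; split=> // z zp.
have /finset.bigcupP[e' e'Om ze'] := hs _ (h5 _ zp).
apply/finset.bigcupP; exists e' => //; rewrite !inE e'Om andbT.
by apply/eqP => ee; have := h6 _ zp; rewrite -ee ze'.
Qed.

(** Telescoping along [greedy]: a piece costs its oscillation [c e], the edge leaving it costs d. *)
Lemma chain_bound (R : realType) (H : vertex G -> R) (c : T -> R) (d : R) :
  (forall e, 0 <= c e + d) ->
  forall (Om : {set T}) x p, path (@adj G) x p ->
  {subset x :: p <= (\bigcup_(e in Om) piece e)%SET} ->
  (forall e, e \in Om -> {in piece e &, forall y z, H y - H z <= c e}) ->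
  (forall y z, @adj G y z -> H y - H z <= d) -> 0 <= d ->
  H x - H (last x p) <= \sum_(e in Om) (c e + d).
Proof.
move=> cd0 Om; have [n] := ubnP #|Om|; elim: n Om => // n IH Om On x p hp hs hc hd d0.
have [e [eOm xe] h] := greedy hp hs.
rewrite (big_setD1 e)//=; have [le|[y [x' [p' [ye yx' hp' lp hs']]]]] := h.
  apply: (@le_trans _ _ (c e + d)).
    by have := hc e eOm x (last x p) xe le; lra.
  by rewrite lerDl; apply: sumr_ge0.
have Oe : (#|Om :\ e| < n)%N.
  by have := On; rewrite (cardsD1 e) eOm.
have := IH _ Oe x' p' hp' hs' _ hd d0; rewrite lp => /(_ _)/wrap[].
  by move=> e' /finset.setD1P[_ e'Om]; exact: hc.
have := hc e eOm x y xe ye; have := hd y x' yx'; lra.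
Qed.

End Greedy.

End Connectivity.

Section Cells.
Context (S : simple_igs) (D : doubling S).
Let E : exists e : edge S, True := doubling_edge D.

Definition cellrel n (u : seq (edge S)) : rel (edge (Gr S n)) :=
  [rel g g' | [&& prefix u (word g), prefix u (word g') & meet g g']].

(** Induction on the level. Edges with the same parent are linked because the generator is
    connected, edges with meeting parents through a gate vertex over the common end. *)
Lemma cell_edges_connected n u (g g' : edge (Gr S n)) :
  prefix u (word g) -> prefix u (word g') -> connect (@cellrel n u) g g'.
Proof.
elim: n g g' => [|n IH] g g'; first by case: g; case: g'.
move=> hg hg'; have := prefix_size_le hg; rewrite size_word leq_eqVlt => /orP[/eqP sz|].
  have h (g0 : edge (Gr S n.+1)) : prefix u (word g0) -> u = word g0.
    by rewrite prefixE take_oversize ?size_word ?sz// => /eqP ->.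
  by rewrite (word_inj (etrans (esym (h _ hg)) (h _ hg'))).
rewrite ltnS => su; case: g hg => e f; case: g' hg' => e' f' /=.
rewrite !prefix_rcons_le ?size_word// => hu hu'.
have inner (e0 : edge (Gr S n)) s (f1 f2 : edge S) : prefix u (word e0) ->
    pole s f1 = pole s f1 -> connect (@cellrel n.+1 u) (e0, f1) (e0, f2).
  move=> h0 _; have pr f3 : prefix u (@word S n.+1 (e0, f3)).
    by rewrite /= prefix_rcons_le// size_word.
  suff h z : forall s f2, z = pole s f2 -> connect (@cellrel n.+1 u) (e0, f1) (e0, f2).
    exact: h true f2 erefl.
  apply: (@connected_G1 S (fun z => forall s f2, z = pole s f2 ->
    connect (@cellrel n.+1 u) (e0, f1) (e0, f2)) _ (pole true f1)).
    move=> t f3 h3 t' f4 h4; apply: connect_trans (h3 t f3 erefl) _; apply: connect1.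
    rewrite /cellrel /= !prefix_rcons_le ?size_word// h0 /=.
    by apply/meetP; exists (~~ t), t' => /=; rewrite h4.
  move=> t f3 h3; apply: connect1; rewrite /cellrel /= !prefix_rcons_le ?size_word// h0 /=.
  by apply/meetP; exists true, t => /=; rewrite h3.
have /connectP[p] := IH _ _ hu' hu.
elim: p e f hu' => [|e1 p IHp] e f hu' /=; first by move=> _ ->; exact: (inner _ true).
move=> /andP[/and3P[_ hu1 /meetP[s [t st]]] hp] hl.
have [a _] := symbol_inhabited S.
have [[s1 f1] /= h1 _] := gate_edgeP D s a; have [[t1 f2] /= h2 _] := gate_edgeP D t a.
apply: connect_trans (inner e true f f1 hu' erefl) _.
apply: connect_trans (IHp e1 f2 hu1 hp hl); apply: connect1.
rewrite /cellrel /= !prefix_rcons_le ?size_word// hu' hu1 /=; apply/meetP; exists s1, t1 => /=.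
by rewrite h1 h2; apply: class_phi.
Qed.

Lemma cell_connected n u : connected_in (cell n u : {set vertex (Gr S n)}).
Proof.
apply/connected_inP => x y /= xu yu.
have /(cellP D)[s [g [hg ->]]] := xu; have /(cellP D)[t [g' [hg' ->]]] := yu.
have same (e : edge (Gr S n)) s' t' : prefix u (word e) ->
    connect (inside (cell n u)) (oend s' e) (oend t' e).
  move=> he; case: (eqVneq t' s') => [->//|ts]; apply: connect1.
  have -> : t' = ~~ s' by case: t' s' ts => [] [].
  by rewrite /inside /= !cell_oend// adj_oend.
have /connectP[p] := cell_edges_connected hg hg'.
elim: p s g hg => [|e1 p IH] s g hg /=; first by move=> _ ->; exact: same.
move=> /andP[/and3P[_ h1 /meetP[s1 [t1 st]]] hp] hl.
apply: connect_trans (same g s s1 hg) _; rewrite st; exact: IH.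
Qed.

(** A common vertex v survives refinement as v.a, v.a.a and so on, for any symbol a. *)
Lemma cell_meet n (e e' : edge (Gr S n)) m : meet e e' -> (n <= m)%N ->
  exists2 x : vertex (Gr S m), x \in cell m (word e) & x \in cell m (word e').
Proof.
move=> /meetP[s [t h]] nm; rewrite -(subnK nm); have [a _] := symbol_inhabited S.
elim: (m - n)%N => [|k [x h1 h2]].
  exists (oend s e); first exact: (@cell_oend S D n _ s e (prefix_refl _)).
  by rewrite h; exact: (@cell_oend S D n _ t e' (prefix_refl _)).
by exists (vmul D x a : vertex (Gr S (k.+1 + n))); apply: cell_vmul.
Qed.

End Cells.

(** * Chains of cells and the distances at finite levels *)

Section Reach.
Context (R : realType) (S : simple_igs) (D : doubling S) (hnd : non_degenerate S).
Local Notation L := ((Lstar S)%:R : R).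
Let E : exists e : edge S, True := doubling_edge D.

Lemma L_ge2 : 2 <= L. Proof. by rewrite ler_nat; exact: Lstar_ge2. Qed.
Let L0 : 0 < L. Proof. by have := L_ge2; lra. Qed.
Let Ln0 n : 0 < L ^- n. Proof. by rewrite invr_gt0 exprn_gt0. Qed.

Lemma insub_bseqE n (u : seq (edge S)) : (size u <= n)%N -> insub_bseq n u = u :> seq _.
Proof. by move=> su; rewrite /insub_bseq /insubd insubT. Qed.

Definition weight n (Om : {set n.-bseq (edge S)}) : R := \sum_(e in Om) L ^- size e.

Definition reach n c (v w : vertex (Gr S n)) := exists2 Om, links v w Om & weight Om <= c.

Lemma weight_ge0 n (Om : {set n.-bseq (edge S)}) : 0 <= weight Om.
Proof. by apply: sumr_ge0 => e _; exact: ltW. Qed.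

Lemma reach_cell n (u : seq (edge S)) (v w : vertex (Gr S n)) : (size u <= n)%N ->
  v \in cell n u -> w \in cell n u -> reach (L ^- size u) v w.
Proof.
move=> su vu wu; exists [set insub_bseq n u]%SET.
  rewrite /links finset.big_set1 insub_bseqE// /links.
  by split=> //; exact: cell_connected.
by rewrite /weight big_set1 insub_bseqE.
Qed.

Lemma reach_sym n c (v w : vertex (Gr S n)) : reach c v w -> reach c w v.
Proof. by move=> [Om [h1 h2 h3] h]; exists Om. Qed.

Lemma reach_le n c c' (v w : vertex (Gr S n)) : c <= c' -> reach c v w -> reach c' v w.
Proof. by move=> cc [Om l h]; exists Om => //; exact: le_trans cc. Qed.

(** Connectedness of a union of cells refers to adjacency in G_n, so two unions joined by an edge
    outside them count as connected: the junction has no weight. *)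
Lemma reach_trans n c c' (v y x w : vertex (Gr S n)) : reach c v y ->
  y = x \/ @adj (Gr S n) y x -> reach c' x w -> reach (c + c') v w.
Proof.
move=> [Om [cO vO yO] hO] yx [Om' [cO' xO' wO'] hO']; exists (Om :|: Om')%SET.
  rewrite /links finset.bigcup_setU; split; first exact: connected_inU yx.
    by rewrite inE vO.
  by rewrite inE wO' orbT.
apply: le_trans (lerD hO hO'); rewrite /weight.
rewrite (bigID (mem Om)) /= lerD//.
  by rewrite big_mkcond [X in _ <= X]big_mkcond /=; apply: ler_sum => e _;
     rewrite inE; case: (e \in Om); case: (e \in Om'); rewrite //= ltW.
rewrite big_mkcond [X in _ <= X]big_mkcond /=; apply: ler_sum => e _.
by rewrite inE; case: (e \in Om); case: (e \in Om'); rewrite //= ltW.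
Qed.


Lemma reach_edge n (g : edge (Gr S n)) a b : reach (L ^- n) (oend a g) (oend b g).
Proof.
have := @reach_cell n (word g) (oend a g) (oend b g); rewrite size_word leqnn.
by apply => //; apply: cell_oend; rewrite ?prefix_refl.
Qed.

Lemma Ln_le m n : (m <= n)%N -> L ^- n <= L ^- m.
Proof. by move=> mn; rewrite lef_pV2 ?posrE ?exprn_gt0// ler_weXn2l//; have := L_ge2; lra. Qed.

(** The factor 2 in front of c pays for the weightless junctions between cells: each costs at most
    L^-n, and no cell weighs less. *)
Lemma reach_lip n c (v w : vertex (Gr S n)) (H : vertex (Gr S n) -> R) :
  (forall u : seq (edge S), (size u <= n)%N ->
     {in cell n u &, forall y z, H y - H z <= L ^- size u}) ->
  (forall y z, @adj (Gr S n) y z -> H y - H z <= L ^- n) ->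
  reach c v w -> H v - H w <= 2 * c.
Proof.
move=> Hc Ha [Om [cO vO wO] hO].
have [p [hp <- hs]] := connected_in_path cO vO wO.
have := @chain_bound (Gr S n) _ (fun e : n.-bseq (edge S) => cell n e) R H
  (fun e => L ^- size e) (L ^- n) _ Om v p hp hs _ Ha (ltW (Ln0 n)).
move=> /(_ _ _)/wrap[].
- by move=> e; apply: addr_ge0; exact: ltW.
- by move=> e _; apply: Hc; exact: size_bseq.
move=> /le_trans; apply; apply: (@le_trans _ _ (2 * weight Om)); last by rewrite ler_pM2l.
rewrite /weight mulr_sumr; apply: ler_sum => e _.
by have := Ln_le (size_bseq e); lra.
Qed.

Lemma root_cell n (v : vertex (Gr S n)) : v \in cell n [::].
Proof. by apply/(cellP D); have [s [e ->]] := oend_surj D v; exists s, e; rewrite prefix0s. Qed.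

Lemma dnP n (v w : vertex (Gr S n)) : v != w ->
  exists Om, [/\ links v w Om, dn R v w = weight Om &
    forall Om', links v w Om' -> dn R v w <= weight Om'].
Proof.
move=> vw; have [Om0 l0 _] := @reach_cell n [::] v w (leq0n n) (root_cell v) (root_cell w).
have [Om [h1 h2 h3]] := @inf_finite R _ (@links S n v w) (@weight n) (ex_intro _ _ l0).
by exists Om; rewrite /dn (negbTE vw) -h2; split=> // Om' /h3; rewrite h2.
Qed.

Lemma dn_ge0 n (v w : vertex (Gr S n)) : 0 <= dn R v w.
Proof.
have [->|/dnP[Om [_ -> _]]] := eqVneq v w; first by rewrite /dn eqxx.
exact: weight_ge0.
Qed.

Lemma dn_le n c (v w : vertex (Gr S n)) : reach c v w -> dn R v w <= c.
Proof.
move=> [Om l hO]; have [->|/dnP[_ [_ _ h]]] := eqVneq v w.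
  by rewrite /dn eqxx (le_trans _ hO)// weight_ge0.
exact: le_trans (h _ l) hO.
Qed.

Lemma dn_reach n (v w : vertex (Gr S n)) : v != w -> reach (dn R v w) v w.
Proof. by move=> /dnP[Om [l -> _]]; exists Om. Qed.

Lemma dn_sym n (v w : vertex (Gr S n)) : dn R v w = dn R w v.
Proof.
have [->//|vw] := eqVneq v w; apply/eqP; rewrite eq_le.
by rewrite !dn_le//; apply/reach_sym/dn_reach; rewrite // eq_sym.
Qed.

Lemma dn_triangle n (v w x : vertex (Gr S n)) : dn R v x <= dn R v w + dn R w x.
Proof.
have [->|vw] := eqVneq v w; first by rewrite lerDr dn_ge0.
have [->|wx] := eqVneq w x; first by rewrite lerDl dn_ge0.
by apply/dn_le/(reach_trans (dn_reach vw) (or_introl erefl))/dn_reach.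
Qed.

Lemma dn_edgeP n (e f : edge (Gr S n)) : exists s t,
  dn_edge R e f = dn R (oend s e) (oend t f) /\
  forall s' t', dn_edge R e f <= dn R (oend s' e) (oend t' f).
Proof.
have [[s t] [_ h1 h2]] := @inf_finite R (bool * bool)%type (fun=> True)
  (fun st => dn R (oend st.1 e) (oend st.2 f)) (ex_intro _ (true, true) Logic.I).
have hE : dn_edge R e f = dn R (oend s e) (oend t f).
  rewrite -h1 /dn_edge; congr inf; apply/seteqP; split=> x /=.
    by move=> [v [w [/mem_endsP[s' ->] /mem_endsP[t' ->] ->]]]; exists (s', t').
  by move=> [[s' t'] _ <-]; exists (oend s' e), (oend t' f); rewrite !oend_ends.
by exists s, t; split=> // s' t'; rewrite hE; exact: (h2 (s', t') Logic.I).
Qed.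

Lemma dn_edge_le n (e f : edge (Gr S n)) s t : dn_edge R e f <= dn R (oend s e) (oend t f).
Proof. by have [? [? [_]]] := dn_edgeP e f. Qed.

Lemma dn_edge_ge0 n (e f : edge (Gr S n)) : 0 <= dn_edge R e f.
Proof. by have [s [t [-> _]]] := dn_edgeP e f; exact: dn_ge0. Qed.

Lemma dn_edge_sym n (e f : edge (Gr S n)) : dn_edge R e f = dn_edge R f e.
Proof.
have h (e' f' : edge (Gr S n)) : dn_edge R e' f' <= dn_edge R f' e'.
  by have [s [t [-> _]]] := dn_edgeP f' e'; rewrite dn_sym dn_edge_le.
by apply/eqP; rewrite eq_le !h.
Qed.

Lemma dn_edge_meet n (e f : edge (Gr S n)) : meet e f -> dn_edge R e f = 0.
Proof.
move=> /meetP[s [t h]]; apply/eqP; rewrite eq_le dn_edge_ge0 andbT.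
by apply: le_trans (dn_edge_le _ _ s t) _; rewrite h /dn eqxx.
Qed.

Lemma dn_edge_cell n (u : seq (edge S)) (e f : edge (Gr S n)) :
  prefix u (word e) -> prefix u (word f) -> dn_edge R e f <= L ^- size u.
Proof.
move=> ue uf; apply: le_trans (dn_edge_le e f true true) _; apply: dn_le.
by apply: reach_cell; rewrite ?cell_oend// -(size_word e) prefix_size_le.
Qed.

(** The two minimizing pairs may use different ends of f; crossing f costs L^-n. *)
Lemma dn_edge_triangle n (e f g : edge (Gr S n)) :
  dn_edge R e g <= dn_edge R e f + dn_edge R f g + L ^- n.
Proof.
have [s [t [-> _]]] := dn_edgeP e f; have [s' [t' [-> _]]] := dn_edgeP f g.
apply: le_trans (dn_edge_le e g s t') _.
have ff : dn R (oend t f) (oend s' f) <= L ^- n.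
  apply: dn_le; rewrite -{2}(size_word f).
  by apply: reach_cell; rewrite ?cell_oend ?prefix_refl// size_word.
apply: le_trans (dn_triangle _ (oend t f) _) _; rewrite -addrA lerD2l addrC.
by apply: le_trans (dn_triangle _ (oend s' f) _) _; rewrite lerD2r.
Qed.

Lemma dn_edge_le1 n (e f : edge (Gr S n)) : dn_edge R e f <= 1.
Proof.
by have := @dn_edge_cell n [::] e f; rewrite expr0 invr1; apply; rewrite prefix0s.
Qed.

Lemma ancestor m k (g : edge (Gr S m)) : (k <= m)%N ->
  exists w : edge (Gr S k), word w = take k (word g).
Proof.
elim: m g => [|m IH] g; rewrite leq_eqVlt => /orP[/eqP ->|//].
- by exists g; rewrite take_oversize// size_word.
- by exists g; rewrite take_oversize// size_word.
rewrite ltnS => km; have [w hw] := IH g.1 km; exists w; rewrite hw.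
by case: g w hw => g f w /= _; rewrite -cats1 takel_cat ?size_word.
Qed.

Section Lipschitz.
Variables (n : nat) (H : forall m, vertex (Gr S m) -> R).
Hypothesis eH : extends (lipI R (S:=S)) n H.
Local Notation gradH m e := (@H m (oend true e) - @H m (oend false e)).

Lemma ext_lip_grad m d : (n <= m)%N -> (forall e, `|gradH m e| <= d) ->
  forall e, `|gradH m.+1 e| <= L^-1 * d.
Proof.
move=> nm hd [e f]; rewrite eH//; rewrite (ext_grad D (lipI_admissible R D hnd)) normrM.
by apply: ler_pM => //; exact: lipI_grad.
Qed.

Hypothesis H0 : forall e, `|gradH n e| <= L ^- n.

Lemma lip_grad m : (n <= m)%N -> forall e, `|gradH m e| <= L ^- m.
Proof.
move=> nm; rewrite -(subnK nm); elim: (m - n)%N => // k IH.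
have := @ext_lip_grad (k + n)%N (L ^- (k + n)) (leq_addl _ _) IH.
by rewrite -invfM -exprS.
Qed.

(** At level |u| the cell of u is a single edge, with gradient at most L^-|u|; the maximum principle
    carries this to finer levels. *)
Lemma lip_osc m (u : seq (edge S)) : (n <= size u)%N -> (size u <= m)%N ->
  {in cell m u &, forall y z, @H m y - @H m z <= L ^- size u}.
Proof.
move=> nu um y z yu zu.
have [g0 [_ hg0]] : exists g0 : edge (Gr S (size u)), prefix u (word g0) /\
    forall v, v \in cell (size u) u -> exists s, v = oend s g0.
  have /(cellP D)[s [g [hg _]]] := yu.
  have [w] := ancestor g um; move: hg; rewrite prefixE => /eqP -> hw.
  exists w; split; first by rewrite hw prefix_refl.
  move=> v /(cellP D)[s' [g' [hg' ->]]]; exists s'; congr oend; apply: word_inj.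
  by rewrite hw; move: hg'; rewrite prefixE take_oversize ?size_word// => /eqP.
have g0d := lip_grad nu g0.
set lo := Num.min (@H (size u) (oend true g0)) (@H (size u) (oend false g0)).
set hi := Num.max (@H (size u) (oend true g0)) (@H (size u) (oend false g0)).
have hl : hi - lo <= L ^- size u.
  rewrite /hi /lo; move: g0d; rewrite ler_norml.
  by case: (leP (@H _ (oend true g0))) => ? /andP[? ?]; lra.
have eHu : extends (lipI R (S:=S)) (size u) H by move=> k uk; apply: eH; exact: leq_trans uk.
have hv v : v \in cell (size u) u -> lo <= @H (size u) v <= hi.
  move=> /hg0[s ->]; rewrite /lo /hi ge_min le_max.
  by case: s; rewrite lexx ?orbT.
have hm := ext_cell D (lipI_admissible R D hnd) (lipI_itv R D hnd) eHu (leqnn _) hv.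
have /andP[y0 y1] := hm m y um yu; have /andP[z0 z1] := hm m z um zu; lra.
Qed.

End Lipschitz.

(** Test function: L^-n on the ends of e, 0 at the other vertices of level n, extended by [lipI]. It
    stays L^-n on the cell of e and 0 on that of f, as the two do not meet; the factor 2 of
    [reach_lip] produces the half. *)
Lemma dn_edge_lb n (e f : edge (Gr S n)) : ~~ meet e f ->
  forall m (e' f' : edge (Gr S m)), (n <= m)%N -> prefix (word e) (word e') ->
    prefix (word f) (word f') -> L ^- n / 2 <= dn_edge R e' f'.
Proof.
move=> nmeet m e' f' nm he hf.
pose u (v : vertex (Gr S n)) : R := L ^- n * (v \in ends e)%:R.
pose H := @extfam S R (lipI R (S:=S)) n u.
have eH : extends (lipI R (S:=S)) n H by exact: extfam_extends.
have Hn : H n = u by exact: extfam_start.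
have u01 v : 0 <= u v <= L ^- n.
  by rewrite /u; case: (v \in ends e); rewrite ?mulr1 ?mulr0 !lexx ?ltW ?Ln0.
have H0 g : `|H n (oend true g) - H n (oend false g)| <= L ^- n.
  rewrite Hn ler_norml; have /andP[a b] := u01 (oend true g).
  have /andP[c d] := u01 (oend false g); by apply/andP; split; lra.
have hcell := fun w h => @ext_cell S D R _ (lipI_admissible R D hnd) (lipI_itv R D hnd) n w H _ _ eH h.
have [s [t [-> _]]] := dn_edgeP e' f'.
have wordP (g g' : edge (Gr S n)) : prefix (word g) (word g') -> g' = g.
  by move=> hg; apply: word_inj; move: hg; rewrite prefixE take_oversize ?size_word// => /eqP.
have H1 : H m (oend s e') = L ^- n.
  have h0 v : v \in cell n (word e) -> L ^- n <= H n v <= L ^- n.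
    move=> /(cellP D)[s' [g [/wordP -> ->]]]; rewrite Hn /u.
    by rewrite oend_ends mulr1 lexx.
  have := hcell _ _ (word e) (eq_leq (size_word e)) h0 m _ nm (cell_oend D s he).
  by move=> h; apply/eqP; rewrite eq_le andbC.
have H2 : H m (oend t f') = 0.
  have h0 v : v \in cell n (word f) -> 0 <= H n v <= 0.
    move=> /(cellP D)[s' [g [/wordP -> ->]]]; rewrite Hn /u.
    rewrite (_ : _ \in _ = false) ?mulr0 ?lexx//.
    apply/negP => /mem_endsP[s1 h1]; move/negP: nmeet; apply; apply/meetP.
    by exists s1, s'.
  have := hcell _ _ (word f) (eq_leq (size_word f)) h0 m _ nm (cell_oend D t hf).
  by move=> h; apply/eqP; rewrite eq_le andbC.
have ne : oend s e' != oend t f'.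
  by apply/eqP => h; have := Ln0 n; rewrite -H1 h H2 ltxx.
rewrite ler_pdivrMr// mulrC -[X in X <= _]subr0 -{1}H1 -H2.
apply: reach_lip (dn_reach ne).
(* For cells coarser than level n the global bounds 0 <= H <= L^-n are enough. *)
- move=> w wm y z yw zw; have [nw|wn] := leqP n (size w); first exact: (lip_osc eH H0 nw wm).
  have bb v : 0 <= H m v <= L ^- n.
    by apply: (hcell 0 (L ^- n) [::] (leq0n n)) (root_cell v) => // v' _; rewrite Hn.
  have /andP[y0 y1] := bb y; have /andP[z0 z1] := bb z.
  by have := Ln_le (ltnW wn); lra.
- move=> y z /adjP[s' [g [-> ->]]]; have := lip_grad eH H0 nm g.
  by rewrite ler_norml; case: s' => /= /andP[]; lra.
Qed.


Lemma walkP (G : mgraph) k (v w : vertex G) : reflect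
  (exists p, [/\ size p = k, path (@adj G) v p & last v p = w]) (walk k v w).
Proof.
apply: (iffP existsP) => [[s /andP[h /eqP l]]|[p [sp h l]]].
  by exists s; rewrite size_tuple.
by exists (tcast sp (in_tuple p)); rewrite val_tcast /= h l eqxx.
Qed.

Lemma walk_refl (G : mgraph) (v : vertex G) : walk 0 v v.
Proof. by apply/walkP; exists [::]. Qed.

Lemma walk_adj (G : mgraph) (v w : vertex G) : adj v w -> walk 1 v w.
Proof. by move=> vw; apply/walkP; exists [:: w]; rewrite /= vw. Qed.

Lemma walk_cat (G : mgraph) j k (v w x : vertex G) : walk j v w -> walk k w x -> walk (j + k) v x.
Proof.
move=> /walkP[p [<- hp <-]] /walkP[p' [<- hp' <-]]; apply/walkP; exists (p ++ p').
by rewrite size_cat cat_path last_cat hp hp'.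
Qed.

Lemma walk_lip (G : mgraph) (H : vertex G -> R) d k (v w : vertex G) :
  (forall y z, @adj G y z -> H z - H y <= d) -> walk k v w -> H w - H v <= k%:R * d.
Proof.
move=> hd /walkP[p [<- hp <-]]; elim: p v hp => [|x p IH] v /=.
  by rewrite subrr mul0r.
by move=> /andP[/hd vx /IH]; rewrite -natr1 mulrDl mul1r; lra.
Qed.

(** From one level to the next, gaps between cells grow at least by the factor L. With rho the
    distance to the cell w in G_n, the extension of rho by [lipI] is 1/L-Lipschitz on G_(n+1), at
    most 0 on w and at least min rho on w'; so L times that minimum is at most k. *)
Lemma cells_gap n (w w' : seq (edge S)) k (y x : vertex (Gr S n.+1)) :
  (size w <= n)%N -> (size w' <= n)%N ->
  y \in cell n.+1 w -> x \in cell n.+1 w' -> walk k y x ->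
  exists l (y' x' : vertex (Gr S n)),
    [/\ y' \in cell n w, x' \in cell n w', walk l y' x' & (l * Lstar S <= k)%N].
Proof.
move=> sw sw' yw xw' wk.
have /(cell_clsP D sw)[_ [g0 [hg0 _]]] := yw.
have /(cell_clsP D sw')[_ [g1 [hg1 _]]] := xw'.
have ex z : exists l, [exists y' in cell n w, walk l z y'].
  have [p [hp lp _]] := connected_in_path (cell_connected D n [::]) (root_cell z)
    (root_cell (oend true g0)).
  exists (size p); apply/exists_inP; exists (oend true g0); first exact: cell_oend.
  by apply/walkP; exists p.
pose rho z := ex_minn (ex z).
have rhoP z : exists2 y', y' \in cell n w & walk (rho z) z y'.
  by rewrite /rho; case: ex_minnP => l /exists_inP[y' h1 h2] _; exists y'.
have rho_le z l y' : y' \in cell n w -> walk l z y' -> (rho z <= l)%N.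
  move=> h1 h2; rewrite /rho; case: ex_minnP => l' _; apply.
  by apply/exists_inP; exists y'.
have rho0 z : z \in cell n w -> rho z = 0%N.
  move=> zw; apply/eqP; rewrite -leqn0; apply: rho_le zw _.
  exact: walk_refl.
have rho1 z z' : @adj (Gr S n) z z' -> (rho z <= (rho z').+1)%N.
  move=> a; have [y' h1 h2] := rhoP z'; apply: rho_le h1 _.
  exact: walkS a h2.
pose u z : R := (rho z)%:R.
pose H := @extfam S R (lipI R (S:=S)) n u.
have eH : extends (lipI R (S:=S)) n H by exact: extfam_extends.
have Hn : H n = u by exact: extfam_start.
have gH g : `|H n (oend true g) - H n (oend false g)| <= 1.
  rewrite Hn /u ler_norml; have := rho1 _ _ (@adj_oend (Gr S n) true g).
  have := rho1 _ _ (@adj_oend (Gr S n) false g); rewrite /= -!(ler_nat R) -!natr1.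
  by move=> ? ?; apply/andP; split; lra.
have hc := fun lo hi w h => @ext_cell S D R _ (lipI_admissible R D hnd) (lipI_itv R D hnd) n w H lo hi eH h.
have Hy : H n.+1 y <= 0.
  have h0 v : v \in cell n w -> 0 <= H n v <= 0.
    by move=> vw; rewrite Hn /u rho0// lexx.
  by have /andP[] := hc _ _ w sw h0 n.+1 y (leqnSn n) yw.
pose x' := [arg min_(z < oend true g1 in cell n w') rho z].
have [x'w' hx'] : x' \in cell n w' /\ forall z, z \in cell n w' -> (rho x' <= rho z)%N.
  by rewrite /x'; case: arg_minnP => [|z h1 h2]; [exact: cell_oend | split].
have Hx : (rho x')%:R <= H n.+1 x.
  have h0 v : v \in cell n w' -> (rho x')%:R <= H n v <= \sum_z (rho z)%:R.
    move=> vw'; rewrite Hn /u ler_nat hx'//= (bigD1 v)//= lerDl.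
    by apply: sumr_ge0.
  by have /andP[] := hc _ _ w' sw' h0 n.+1 x (leqnSn n) xw'.
have [y' y'w wy'] := rhoP x'.
exists (rho x'), y', x'; split=> //.
  move/walkP: wy' => [p [sp hp lp]]; apply/walkP.
  exists (rev (belast x' p)); split.
  - by rewrite size_rev size_belast.
  - rewrite -lp rev_path; apply: sub_path hp => a b /=; by rewrite adj_sym.
  - by rewrite -lp; case: (p) => //= a l; rewrite rev_cons last_rcons.
have := @walk_lip _ (H n.+1) L^-1 k y x _ wk => /(_ _)/wrap[].
  move=> a b /adjP[s [g [-> ->]]].
  have := @ext_lip_grad n H eH n 1 (leqnn n) gH g; rewrite mulr1 ler_norml => /andP[].
  by case: s => /=; lra.
move=> h; rewrite -(ler_nat R) natrM -ler_pdivlMr//; lra.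
Qed.

(** Two steps of the walk cost one edge: the first is a weightless junction, the second is added as
    a cell of weight L^-n. A last odd step is a junction again. *)
Lemma reach_bridge n l c c' (v y x z : vertex (Gr S n)) : reach c v y -> walk l y x ->
  reach c' x z -> reach (c + (l./2)%:R * L ^- n + c') v z.
Proof.
move=> h /walkP[p [<- hp <-]].
have [k] := ubnP (size p); elim: k p c v y h hp => // k IH [|a [|b p]] c v y h /= hp hk h'.
- by rewrite mul0r addr0; apply: reach_trans h (or_introl erefl) h'.
- by rewrite mul0r addr0; apply: reach_trans h (or_intror _) h'; case/andP: hp.
have /and3P[ya ab bp] := hp.
have hb : reach (c + L ^- n) v b.
  apply: reach_trans h (or_intror ya) _.
  by have /adjP[s [g [-> ->]]] := ab; exact: reach_edge.
have := IH p _ v b hb bp _ h'; rewrite -ltnS => /(_ (ltnW hk)).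
apply: reach_le; rewrite -natr1; lra.
Qed.

Lemma gap_count j k s : (j <= 1)%N -> (k <= (2 * s).+1)%N -> (k + j + 1 <= (2 * s.+1).+1)%N.
Proof. lia. Qed.

(* At level n + 1 a connected union may contain isolated edges of that level, the gaps between consecutive ones being free; the counter s of such edges pays for bridging the gap at level n. *)
Lemma reach_project n N (Om : {set (n.+1).-bseq (edge S)}) : (#|Om| < N)%N ->
  forall x p (w : seq (edge S)) c v s y k z' (g' : edge (Gr S n)) t,
  path (@adj (Gr S n.+1)) x p ->
  {subset x :: p <= (\bigcup_(e in Om) cell n.+1 e)%SET} ->
  (size w <= n)%N -> (forall z, z \in cell n w -> reach c v z) ->
  y \in cell n.+1 w -> walk k y x -> (k <= (2 * s).+1)%N ->
  last x p = cls z' g' ->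
  reach (c + s%:R * L ^- n.+1 + weight Om + L ^- n) v (oend t g').
Proof.
elim: N Om => // N IH Om ON x p w c v s y k z' g' t hp hs sw hw yw wk ks hl.
have LS : L ^- n = L * L ^- n.+1 by rewrite exprS invfM mulrA mulfV ?mul1r// gt_eqF.
(* [cells_gap] shortens a gap of length at most 2 r + 1 by the factor L and bridging pays for half
   of the rest, so rounding down removes the extra 1: r edges of weight L^-(n+1) suffice. *)
have half l r : (l * Lstar S <= (2 * r).+1)%N -> (l./2)%:R * L ^- n <= r%:R * L ^- n.+1.
  move=> h; rewrite LS mulrA; rewrite ler_wpM2r ?(ltW (Ln0 _))// -natrM ler_nat.
  by have := odd_double_half l; rewrite -mul2n; move: h; case: (odd l); nia.
have [e [eOm xe] h] := greedy hp hs.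
have wOm : weight Om = L ^- size e + weight (Om :\ e) by rewrite /weight (big_setD1 e).
have Oe : (#|Om :\ e| < N)%N by move: ON; rewrite (cardsD1 e) eOm.
have w0 := weight_ge0 (Om :\ e).
(* A piece of level n + 1 is a single edge and, unless the path ends there, only lengthens the
   current gap. A coarser piece is also a cell at level n, and the gap before it is bridged. *)
have := size_bseq e; rewrite leq_eqVlt => /orP[/eqP se|se].
  have near (a b : vertex (Gr S n.+1)) : a \in cell n.+1 e -> b \in cell n.+1 e ->
      exists2 j, (j <= 1)%N & walk j a b.
    move=> /(cellP D)[s1 [g1 [+ ->]]] /(cellP D)[s2 [g2 [+ ->]]].
    rewrite !prefixE !take_oversize ?size_word ?se// => /eqP e1 /eqP e2.
    have -> : g2 = g1 by apply: word_inj; rewrite e1 e2.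
    have [->|s12] := eqVneq s2 s1; first by exists 0%N; [by [] | exact: walk_refl].
    have -> : s2 = ~~ s1 by case: s1 s2 s12 => -[].
    by exists 1%N; [by [] | apply: walk_adj; exact: adj_oend].
  rewrite wOm se; case: h => [le|[y' [x' [p' [y'e yx' hp' lp hs']]]]].
    have [j j1 wj] := near _ _ xe le.
    have wl : last x p \in cell n.+1 (word g').
      by rewrite hl; apply: cell_cls; rewrite ?prefix_refl.
    have [l [y1 [x1 [h1 h2 h3 h4]]]] := cells_gap sw (eq_leq (size_word g')) yw wl (walk_cat wk wj).
    have /(cellP D)[s1 [g1 [hg1 x1E]]] := h2.
    have gg : g1 = g'.
      by apply: word_inj; move: hg1; rewrite prefixE take_oversize ?size_word// => /eqP.
    have := reach_bridge (hw _ h1) h3 (_ : reach (L ^- n) x1 (oend t g')).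
    rewrite x1E gg => /(_ (reach_edge _ _ _)); apply: reach_le.
    have := half l s.+1; rewrite -natr1 mulrDl mul1r => /(_ _)/wrap[]; last lra.
    by apply: leq_trans h4 (leq_trans (leq_addr 1 _) (gap_count j1 ks)).
  have [j j1 wj] := near _ _ xe y'e.
  have wk' : walk (k + j + 1) y x'.
    by apply: walk_cat (walk_cat wk wj) _; exact: walk_adj.
  rewrite -lp in hl.
  have := fun q => IH _ Oe x' p' w c v s.+1 y _ z' g' t hp' hs' sw hw yw wk' q hl.
  move=> /(_ (gap_count j1 ks)).
  by apply: reach_le; rewrite -natr1 mulrDl mul1r !addrA.
rewrite ltnS in se.
have [l [y1 [x1 [h1 h2 h3 h4]]]] := cells_gap sw se yw xe wk.
have he z : z \in cell n e -> reach (c + s%:R * L ^- n.+1 + L ^- size e) v z.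
  move=> ze; have := reach_bridge (hw _ h1) h3 (reach_cell se h2 ze).
  apply: reach_le; have := half l s (leq_trans h4 ks); lra.
rewrite wOm; case: h => [le|[y' [x' [p' [y'e yx' hp' lp hs']]]]].
  rewrite hl in le; have /(cell_clsP D se)[z2 [g2 [hg2 hz]]] := le.
  have [b bE] : exists b, oend b g' \in cell n e.
    have [[_ ->]|[s1 [t1 [a [h _ _]]]]] := cls_eq D hz.
      by exists true; apply: cell_oend.
    by exists s1; rewrite h; apply: cell_oend.
  apply: reach_le (reach_trans (he _ bE) (or_introl erefl) (reach_edge g' b t)); lra.
have wk1 : walk 1 y' x' by exact: walk_adj.
rewrite -lp in hl.
have := IH _ Oe x' p' e _ v 0%N y' 1%N z' g' t hp' hs' se he y'e wk1 isT hl.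
by apply: reach_le; rewrite mul0r addr0 !addrA.
Qed.

(** Monotonicity in n up to a summable error; with the bound 1 it makes the limit in [dist] exist.
    The error consists of the weights of e, where the chain starts, and of f, where it ends. *)
Lemma dn_edge_project n (e f : edge (Gr S n)) (e' f' : edge S) :
  dn_edge R e f <= @dn_edge S R n.+1 (e, e') (f, f') + 2 * L ^- n.
Proof.
have [s [t [h _]]] := @dn_edgeP n.+1 (e, e') (f, f').
have [/(cls_eq D) st|ne] := eqVneq (@oend (Gr S n.+1) s (e, e')) (@oend (Gr S n.+1) t (f, f')).
  rewrite dn_edge_meet ?addr_ge0 ?dn_edge_ge0 ?mulr_ge0 ?(ltW (Ln0 _))//.
  by case: st => /= [[_ ->]|[s1 [t1 [a [st _ _]]]]]; [exact: meet_refl|apply/meetP; exists s1, t1].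
have [Om [[cO vO wO] hO _]] := dnP ne.
have [p [hp lp hs]] := connected_in_path cO vO wO.
have := @reach_project n #|Om|.+1 Om (leqnn _) _ p (word e) (L ^- n) (oend true e) 0%N
  (@oend (Gr S n.+1) s (e, e')) 0%N (pole t f') f true hp hs.
rewrite size_word => /(_ (leqnn n)) hr.
rewrite h hO; apply: le_trans (dn_edge_le e f true true) _.
have -> : weight Om + 2 * L ^- n = L ^- n + 0 * L ^- n.+1 + weight Om + L ^- n by lra.
apply/dn_le/hr => //.
- move=> z /(cellP D)[s1 [g [+ ->]]]; rewrite prefixE take_oversize ?size_word// => /eqP/word_inj ->.
  exact: reach_edge.
- by apply: cell_cls; rewrite ?prefix_refl.
- exact: walk_refl.
Qed.

End Reach.

(** Compactness of the symbol space. A word is [good] if for every k it extends to a sequence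
    satisfying [P k]; were no letter to continue it, the largest of the finitely many failing levels
    would give a contradiction. *)
Lemma konig (A : finType) (P : nat -> (nat -> A) -> Prop) :
  (forall k, exists s, P k s) -> (forall k s, P k.+1 s -> P k s) ->
  (forall k s t, mkseq s k = mkseq t k -> P k s -> P k t) ->
  exists s, forall k, P k s.
Proof.
move=> Pex Pdec Ploc.
have [s0 _] := Pex 0%N; pose a0 := s0 0%N.
have Ple j k s : (j <= k)%N -> P k s -> P j s.
  move=> /subnK <-; elim: (k - j)%N => // i IH; rewrite addSn => /Pdec; exact: IH.
pose good u := forall k, exists s, mkseq s (size u) = u /\ P k s.
have goodS u : good u -> exists a, good (rcons u a).
  move=> gu; apply: contrapT => /forallNP h.
  have /choice[k hk] : forall a, exists k, forall s, mkseq s (size (rcons u a)) = rcons u a -> ~ P k s.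
    move=> a; have := h a; rewrite /good => /existsNP[k /forallNP hk]; exists k => s e Ps.
    by apply: (hk s).
  have [s [su Ps]] := gu (\max_a k a).
  apply: (hk (s (size u)) s); first by rewrite size_rcons mkseqS su.
  by apply: Ple Ps; exact: leq_bigmax.
pose next u := xget a0 [set a | good (rcons u a)].
have goodn u : good u -> good (rcons u (next u)).
  by move=> /goodS[a ga]; rewrite /next; case: xgetP => [//|/(_ a)].
pose U n := iter n (fun u => rcons u (next u)) [::].
have sU n : size (U n) = n by elim: n => //= n IH; rewrite size_rcons IH.
have gU n : good (U n).
  elim: n => [k|n IH /=]; last exact: goodn.
  by have [s Ps] := Pex k; exists s.
have mU n : mkseq (fun i => next (U i)) n = U n by elim: n => //= n IH; rewrite mkseqS IH.
exists (fun i => next (U i)) => k; have [s [su Ps]] := gU k k.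
by apply: Ploc Ps; rewrite mU -[RHS]su sU.
Qed.

Lemma bounded_on_seq (T : eqType) (r : seq T) (k : T -> nat) :
  exists K, forall x, x \in r -> (k x <= K)%N.
Proof. by exists (\max_(x <- r) k x)%N => x xr; exact: leq_bigmax_seq. Qed.

Section Sequences.
Context (S : simple_igs) (D : doubling S).
Implicit Types (s t u : Sigma D).

Lemma word_pre s n : word (pre s n) = mkseq s n.
Proof. by elim: n => //= n ->; rewrite mkseqS. Qed.

Lemma pre_eq s t n : mkseq s n = mkseq t n -> pre s n = pre t n.
Proof. by move=> h; apply: word_inj; rewrite !word_pre. Qed.

Lemma prefix_pre s m n : (m <= n)%N -> prefix (word (pre s m)) (word (pre s n)).
Proof.
move=> mn; rewrite !word_pre prefixE size_mkseq -map_take take_iota.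
by rewrite (minn_idPl mn).
Qed.

Lemma pre_surj n (g : edge (Gr S n)) : exists s, pre s n = g.
Proof.
exists (fun i => nth (edge0 D) (word g) i); apply: word_inj; rewrite word_pre.
by rewrite -[in RHS](mkseq_nth (edge0 D) (word g)) size_word.
Qed.

Definition meets n s t := meet (pre s n) (pre t n).

Lemma meets_refl n s : meets n s s. Proof. exact: meet_refl. Qed.

Lemma meets_sym n s t : meets n s t = meets n t s. Proof. exact: meet_sym. Qed.

Lemma meets_mkseq n s t : mkseq s n = mkseq t n -> meets n s t.
Proof. by move=> /pre_eq h; rewrite /meets h meet_refl. Qed.

Lemma meets_le m n s t : (m <= n)%N -> meets n s t -> meets m s t.
Proof.
move=> /subnK <-; elim: (n - m)%N => // k IH; rewrite addSn => /(meet_pred D); exact: IH.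
Qed.

Lemma meets0 s t : meets 0 s t.
Proof. exact: meet_refl. Qed.

End Sequences.

(** * The limit metric in terms of sequences *)

Section Distance.
Context (R : realType) (S : simple_igs) (D : doubling S) (hnd : non_degenerate S).
Implicit Types (s t u : Sigma D).
Local Notation L := ((Lstar S)%:R : R).
Let L2 : 2 <= L := L_ge2 R D hnd.
Let L0 : 0 < L. Proof. by have := L2; lra. Qed.
Let Ln0 n : 0 < L ^- n. Proof. by rewrite invr_gt0 exprn_gt0. Qed.
Let LnS n : 2 * L ^- n.+1 <= L ^- n.
Proof.
by rewrite exprS invfM mulrA ler_piMl ?(ltW (Ln0 _))// ler_pdivrMr// mul1r.
Qed.

Lemma cvg_Ln : (fun n => L ^- n) @ \oo --> (0 : R).
Proof.
have -> : (fun n => L ^- n) = (fun n => (L^-1) ^+ n) by apply/funext => n; rewrite exprVn.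
by apply: cvg_expr; rewrite ger0_norm ?invr_ge0 ?ltW// invf_lt1//; have := L2; lra.
Qed.

Definition de s t n := dn_edge R (pre s n) (pre t n).

Lemma de_meets_le n m s t : (n <= m)%N -> meets n s t -> de s t m <= 2 * L ^- n.
Proof.
move=> nm /(cell_meet D)/(_ nm)[x xs xt].
apply: le_trans (dn_edge_le _ _ _ true true) _; apply: (dn_le D hnd).
have h (s' : Sigma D) y : y \in cell m (word (pre s' n)) ->
    reach (L ^- n) (oend true (pre s' m)) y.
  move=> ys; rewrite -{1}(size_word (pre s' n)).
  by apply: (reach_cell R D) => //; rewrite ?size_word//; apply: (cell_oend D); exact: prefix_pre.
have -> : 2 * L ^- n = L ^- n + L ^- n by lra.
apply: (reach_trans (h s x xs) (or_introl erefl)).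
by apply: reach_sym; exact: h.
Qed.

Lemma de_nmeets_ge n m s t : (n <= m)%N -> ~~ meets n s t -> L ^- n / 2 <= de s t m.
Proof. by move=> nm h; apply: (dn_edge_lb R D hnd h nm); exact: prefix_pre. Qed.

Lemma de_is_cvg s t : cvgn (de s t).
Proof.
(* This makes u nondecreasing: 4 L^-n - 4 L^-(n+1) >= 2 L^-n, the error in [dn_edge_project]. *)
pose u n := de s t n - 4 * L ^- n.
have -> : de s t = (fun n => u n + 4 * L ^- n) by apply/funext => n; rewrite /u; lra.
apply: is_cvgD; last by apply: is_cvgMr; apply/cvg_ex; exists 0; exact: cvg_Ln.
apply: nondecreasing_is_cvgn.
  apply/nondecreasing_seqP => n; rewrite /u.
  have := dn_edge_project R D hnd (pre s n) (pre t n) (s n) (t n).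
  by rewrite -/(de s t n) -/(de s t n.+1); have := LnS n; lra.
exists 1 => _ [n _ <-]; rewrite /u.
have := @dn_edge_le1 R S D hnd n (pre s n) (pre t n); rewrite -/(de s t n).
by have := Ln0 n; lra.
Qed.

Definition dinf s t := limn (de s t).

Lemma dinf_cvg s t : de s t @ \oo --> dinf s t.
Proof. exact: de_is_cvg. Qed.

Lemma dinf_ge0 s t : 0 <= dinf s t.
Proof. by apply: limr_ge; [exact: de_is_cvg | near=> n; exact: dn_edge_ge0].
Unshelve. all: by end_near. Qed.

Lemma dinf_sym s t : dinf s t = dinf t s.
Proof. by rewrite /dinf; congr (limn _); apply/funext => n; exact: dn_edge_sym. Qed.

Lemma dinf_triangle s t u : dinf s u <= dinf s t + dinf t u.
Proof.
have h : (fun n => de s t n + de t u n + L ^- n) @ \oo --> dinf s t + dinf t u + 0.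
  by apply: cvgD cvg_Ln; apply: cvgD; exact: dinf_cvg.
rewrite addr0 in h; rewrite -(cvg_lim _ h)//; apply: ler_lim.
- exact: de_is_cvg.
- by apply/cvg_ex; eexists; exact: h.
- by near=> n; exact: dn_edge_triangle.
Unshelve. all: by end_near. Qed.

Lemma dinf_meets n s t : meets n s t -> dinf s t <= 2 * L ^- n.
Proof.
move=> h; apply: limr_le; first exact: de_is_cvg.
by near=> m; apply: de_meets_le => //; near: m; exact: nbhs_infty_ge.
Unshelve. all: by end_near. Qed.

Lemma dinf_nmeets n s t : ~~ meets n s t -> L ^- n / 2 <= dinf s t.
Proof.
move=> h; apply: limr_ge; first exact: de_is_cvg.
by near=> m; apply: de_nmeets_ge => //; near: m; exact: nbhs_infty_ge.
Unshelve. all: by end_near. Qed.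

Lemma dinf_lt_meets n s t : dinf s t < L ^- n / 2 -> meets n s t.
Proof. by move=> h; apply: contraLR h => /dinf_nmeets; rewrite -leNgt. Qed.

(** Meeting is not transitive at a fixed level. Four levels suffice: two distances of at most 2
    L^-(n+4) add up to at most L^-n / 4, below the threshold L^-n / 2. *)
Lemma meets_trans n s t u : meets (n + 4) s t -> meets (n + 4) t u -> meets n s u.
Proof.
move=> /dinf_meets h1 /dinf_meets h2; apply: dinf_lt_meets.
apply: le_lt_trans (dinf_triangle s t u) _.
have := LnS n; have := LnS n.+1; have := LnS n.+2; have := LnS n.+3; have := Ln0 n.+4.
by move: h1 h2; rewrite addn4; lra.
Qed.

(** The way to transitivity of [sim]: it becomes the triangle inequality for [dinf]. *)
Lemma simP s t : sim s t <-> dinf s t = 0.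
Proof.
split=> [h|h n]; last first.
  by apply: dinf_lt_meets; rewrite h divr_gt0.
apply/eqP; rewrite eq_le dinf_ge0 andbT.
have h2 : (fun n => 2 * L ^- n) @ \oo --> 2 * (0 : R) by apply: cvgM cvg_Ln; exact: cvg_cst.
rewrite mulr0 in h2; rewrite -(cvg_lim _ h2)//; apply: limr_ge.
  by apply/cvg_ex; eexists; exact: h2.
by near=> n; apply: dinf_meets; exact: h.
Unshelve. all: by end_near. Qed.

Lemma sim_trans s t u : sim s t -> sim t u -> sim s u.
Proof.
move=> /simP h1 /simP h2; apply/simP/eqP; rewrite eq_le dinf_ge0 andbT.
by have := dinf_triangle s t u; rewrite h1 h2 addr0.
Qed.

Lemma sim_sym s t : sim s t -> sim t s.
Proof. by move=> h n; have := meets_sym n t s; rewrite /meets /meet => ->; exact: h. Qed.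

Lemma chi_eq s t : chi s = chi t <-> sim s t.
Proof.
split=> [/(congr1 (@proj1_sig _ _)) /= h|h].
  have : [set t' | sim t t'] t by move=> n; exact: meets_refl.
  by rewrite -h.
apply: eq_exist; apply/seteqP; split=> u /= su.
  exact: sim_trans (sim_sym h) su.
exact: sim_trans h su.
Qed.

Lemma chi_surj (x : X D) : exists s, chi s = x.
Proof.
case: x => C [s Cs]; exists s; apply: eq_exist; by rewrite Cs.
Qed.

Lemma rep_chi s : sim (rep (chi s)) s.
Proof.
rewrite /rep; case: cid => t /= h; apply: sim_sym.
have : [set t' | sim t t'] t by move=> n; exact: meets_refl.
by rewrite -h.
Qed.

Lemma dinf_sim s s' t : sim s s' -> dinf s t = dinf s' t.
Proof.
have h u u' : sim u u' -> dinf u t <= dinf u' t.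
  by move=> /simP uu; have := dinf_triangle u u' t; rewrite uu add0r.
by move=> ss; apply/eqP; rewrite eq_le !h//; exact: sim_sym.
Qed.

Lemma dist_chi s t : dist R (chi s) (chi t) = dinf s t.
Proof.
rewrite /dist -[LHS]/(dinf (rep (chi s)) (rep (chi t))) (dinf_sim _ (rep_chi s)).
by rewrite dinf_sym (dinf_sim _ (rep_chi t)) dinf_sym.
Qed.

Local Notation X := (limit_space R D).

Lemma open_dball (x : X) r : open (@dball S D R x r : set X).
Proof.
exists [set @dball S D R x r : set X]; last by rewrite bigcup_set1.
move=> _ ->; exists [fset (x, r)]%fset => //=; first by move=> ? _; rewrite in_setT.
apply/seteqP; split=> y /=; first by move=> /(_ (x, r)); apply; rewrite /= finmap.inE.
by move=> h i /=; rewrite inE => /eqP ->.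
Qed.

(** A basic open set is a finite intersection of balls, and each ball around a point near [chi s]
    contains all sequences meeting s from some level on. *)
Lemma open_chi (O : set X) s : open O -> O (chi s) ->
  exists k, forall t, meets k s t -> O (chi t).
Proof.
move=> [B sB <-] [A BA As].
have [F FD AE] := sB _ BA; move: As; rewrite -AE => As.
have /choice[k hk] : forall xr : X * R, exists k, xr \in F ->
    forall t, meets k s t -> @dball S D R xr.1 xr.2 (chi t).
  move=> [x r]; have [xrF|] := boolP ((x, r) \in F); last by exists 0%N.
  have := As _ xrF : dist R x (chi s) < r.
  rewrite /dball /=; have [c <-] := chi_surj x; rewrite dist_chi => cr.
  have r0 : 0 < (r - dinf c s) / 2 by rewrite divr_gt0// subr_gt0.
  have /cvgrPdist_lt /(_ _ r0) [k _ hk] := cvg_Ln.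
  exists k => _ t /dinf_meets st; rewrite dist_chi.
  apply: le_lt_trans (dinf_triangle c s t) _.
  have := hk k (leqnn k); rewrite /= sub0r normrN ger0_norm ?(ltW (Ln0 _))// => h.
  by apply: (@lt_le_trans _ _ (dinf c s + (r - dinf c s))); [rewrite ltrD2l; lra|lra].
have [K hK] := @bounded_on_seq _ (enum_fset F) k.
exists K => t st; exists A => //; change (A (chi t)); rewrite -AE => xr /= xrF.
by apply: (hk xr xrF); apply: meets_le st; exact: hK.
Qed.

Lemma continuous_chi (f : X -> R) s e : continuous f -> 0 < e ->
  exists k, forall t, meets k s t -> `|f (chi t) - f (chi s)| < e.
Proof.
move=> cf e0; have /cvgrPdist_lt /(_ e e0) := cf (chi s).
rewrite nearE nbhsE /= => -[W [opW Ws] sW].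
have [k hk] := open_chi opW Ws; exists k => t /hk/sW /=.
by rewrite distrC.
Qed.

Lemma continuous_of_chi (f : X -> R) :
  (forall s e, 0 < e -> exists k, forall t, meets k s t -> `|f (chi t) - f (chi s)| < e) ->
  continuous f.
Proof.
move=> h x; have [s <-] := chi_surj x => A /nbhs_ballP[e /= e0 eA].
have [k hk] := h s e e0.
rewrite /= /fmap /= nbhsE /=; exists (@dball S D R (chi s : X) (L ^- k / 2)).
  split; first exact: open_dball.
  rewrite /dball /= dist_chi (_ : dinf s s = 0) ?divr_gt0//.
  by apply/simP => n; exact: meets_refl.
move=> y; have [t <-] := chi_surj y; rewrite /dball /= dist_chi.
move=> /dinf_lt_meets /hk st; apply: (eA (f (chi t))).
by rewrite /ball /= distrC.
Qed.

(** Given violating pairs at every level, Koenig's lemma yields an s whose prefixes are shared by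
    first members of such pairs. By [meets_trans] both members meet s at a level where continuity at
    s applies. *)
Lemma uniform_continuous_chi (f : X -> R) e : continuous f -> 0 < e ->
  exists k, forall s t, meets k s t -> `|f (chi s) - f (chi t)| < e.
Proof.
move=> cf e0; apply: contrapT => /forallNP h.
pose P k (s : nat -> edge S) := exists s' t : Sigma D,
  [/\ mkseq s' k = mkseq s k, meets k s' t & e <= `|f (chi s') - f (chi t)|].
have [] := @konig (edge S) P.
- move=> k; have /existsNP[s /existsNP[t /not_implyP[m /negP ge]]] := h k.
  by exists s, s, t; split=> //; rewrite leNgt.
- move=> k s [s' [t [h1 h2 h3]]]; exists s', t; split=> //.
    by move: h1; rewrite !mkseqS => /eqP; rewrite eqseq_rcons => /andP[/eqP].
  exact: meets_le h2.
- by move=> k s t st [s' [t' [h1 h2 h3]]]; exists s', t'; rewrite -st.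
move=> s hs; have e2 : 0 < e / 2 by rewrite divr_gt0.
have [k hk] := @continuous_chi f (s : Sigma D) _ cf e2.
have [s' [t [h1 h2 h3]]] := hs (k + 4)%N.
have m1 : meets (k + 4) (s : Sigma D) s' by apply: meets_mkseq; rewrite h1.
have a1 := hk _ (meets_le (leq_addr 4 k) m1).
have a2 := hk _ (meets_trans m1 h2).
have := ler_distD (f (chi (s : Sigma D))) (f (chi s')) (f (chi t)).
rewrite (distrC (f (chi (s : Sigma D)))); lra.
Qed.

End Distance.

(** * Bernoulli measures and flow averages *)

Lemma mkseqSl (T : Type) (f : nat -> T) n : mkseq f n.+1 = f 0%N :: mkseq (fun i => f i.+1) n.
Proof. by rewrite /mkseq /= -[1%N]addn0 iotaDl -map_comp. Qed.

Section ProductMeasure.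
Context (R : realType) (A : finType) (a0 : A) (w : A -> R).
Hypotheses (w0 : forall a, 0 <= w a) (w1 : \sum_a w a = 1).
Local Notation T := (mseqspace a0).

Lemma measurable_cylinder u : measurable (cylinder (a0 := a0) u : set T).
Proof. by apply: sub_sigma_algebra; exists u. Qed.

(** Cumulative distribution of w in the order of [enum_rank]; the letter a owns the half-open
    interval of length [w a] starting at F of its rank. *)
Let F k := \sum_(b | (enum_rank b < k)%N) w b.

Let F_S a : F (enum_rank a).+1 = F (enum_rank a) + w a.
Proof.
rewrite /F (bigD1 a) //= addrC; congr (_ + _); apply: eq_bigl => b.
rewrite ltnS leq_eqVlt andb_orl (inj_eq val_inj) (inj_eq enum_rank_inj).
case: (eqVneq b a) => [->|_]; first by rewrite ltnn.
by rewrite /= andbT.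
Qed.

Let F_le j k : (j <= k)%N -> F j <= F k.
Proof.
move=> jk; rewrite /F big_mkcond [X in _ <= X]big_mkcond; apply: ler_sum => b _.
by case: ifP => [/leq_trans/(_ jk) ->//|_]; case: ifP.
Qed.

Let F0 : F 0 = 0. Proof. by rewrite /F big_pred0. Qed.
Let F1 k : F k <= 1.
Proof.
rewrite -w1 /F big_mkcond; apply: ler_sum => b _; by case: ifP.
Qed.

Let hit x a := F (enum_rank a) <= x < F (enum_rank a) + w a.

Let hit_ex x : 0 <= x < 1 -> exists a, hit x a.
Proof.
move=> /andP[x0 x1].
have ex : exists k, x < F k.
  exists #|A|; rewrite /F (eq_bigl xpredT) ?w1// => b; exact: ltn_ord.
case: (ex_minnP ex) => -[|k] xk hk; first by move: xk; rewrite F0 ltNge x0.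
have kA : (k < #|A|)%N.
  rewrite ltnNge; apply/negP => Ak; have := hk k; rewrite ltnn => /(_ _)/negP; apply => //.
  apply: lt_le_trans xk _; rewrite /F big_mkcond [X in _ <= X]big_mkcond; apply: ler_sum => b _.
  by rewrite (leq_trans (ltn_ord (enum_rank b)) Ak) (leq_trans (ltn_ord (enum_rank b)) (leqW Ak)).
exists (enum_val (Ordinal kA)); rewrite /hit -F_S !enum_valK /= xk andbT leNgt.
by apply/negP => /hk; rewrite ltnn.
Qed.

Let hit_inj x a b : hit x a -> hit x b -> a = b.
Proof.
have h c d : (enum_rank c < enum_rank d)%N -> hit x c -> hit x d -> False.
  move=> cd; rewrite /hit -F_S => /andP[_ h1] /andP[h2 _].
  by have := le_lt_trans h2 h1; rewrite ltNge F_le.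
move=> ha hb; apply: enum_rank_inj; apply: val_inj.
by case: (ltngtP (enum_rank a) (enum_rank b)) => // /h; [move=> /(_ ha hb)|move=> /(_ hb ha)].
Qed.

(** Expansion of a number in nested intervals: [letter] reads a digit, [shift] rescales its interval
    to the unit interval. In [code], points outside the unit interval are treated as 0. *)
Let letter x := xget a0 [set a | hit x a].
Let shift x := (x - F (enum_rank (letter x))) / w (letter x).
Let code x : seqspace a0 := fun n => letter (iter n shift (if 0 <= x < 1 then x else 0)).
(** Left end of the interval of points whose code begins with u; [len u] is its length. *)
Fixpoint cyl_lo (u : seq A) : R := if u is a :: u' then F (enum_rank a) + w a * cyl_lo u' else 0.
Let len (u : seq A) : R := \prod_(a <- u) w a.

Let len_ge0 u : 0 <= len u. Proof. exact: prodr_ge0. Qed.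

Let cyl_lo_bounds u : 0 <= cyl_lo u /\ cyl_lo u + len u <= 1.
Proof.
elim: u => [|a u [IH0 IH1]]; first by rewrite /len big_nil /= add0r !lexx.
rewrite /len big_cons /= -/(len u).
have F0a : 0 <= F (enum_rank a) by rewrite -F0 F_le.
have := F1 (enum_rank a).+1; rewrite F_S; have := w0 a; split; nra.
Qed.

Let letterP x : 0 <= x < 1 -> hit x (letter x).
Proof. by move=> /hit_ex[a ha]; rewrite /letter; case: xgetP => [b _//|/(_ a)]. Qed.

Let shift_itv x : 0 <= x < 1 -> 0 <= shift x < 1.
Proof.
move=> /letterP /andP[h1 h2]; rewrite /shift.
have wa : 0 < w (letter x) by lra.
by rewrite divr_ge0//= ?subr_ge0// ltr_pdivrMr//; lra.
Qed.

Let codeP x u : 0 <= x < 1 ->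
  (mkseq (fun n => letter (iter n shift x)) (size u) = u) <-> (cyl_lo u <= x < cyl_lo u + len u).
Proof.
elim: u x => [|a u IH] x x01; first by rewrite /len big_nil /= add0r.
have shiftE k : mkseq (fun i => letter (iter i.+1 shift x)) k =
    mkseq (fun i => letter (iter i shift (shift x))) k.
  by apply: eq_mkseq => i; rewrite iterSr.
rewrite [size _]/= mkseqSl shiftE [iter 0 _ _]/=.
have := letterP x01; have := shift_itv x01; set b := letter x => s01 hb.
rewrite /len big_cons -/(len u).
have wb : 0 < w b by move: hb => /andP[]; lra.
have sE : x = F (enum_rank b) + w b * shift x.
  by rewrite /shift -/b mulrC divfK ?gt_eqF//; lra.
have [cl0 cl1] := cyl_lo_bounds u.
split=> [[<- /(IH _ s01)/andP[h1 h2]]|/andP[h1 h2]].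
  apply/andP; rewrite -/b [cyl_lo (b :: u)]/= -addrA -mulrDr.
  by rewrite [X in _ <= X]sE [X in X < _]sE lerD2l ltrD2l ler_pM2l// ltr_pM2l.
have ba : b = a.
  apply: hit_inj hb _; rewrite /hit; have l0 := len_ge0 u; have wa := w0 a.
  move: h1 h2; rewrite [cyl_lo (a :: u)]/= => h1 h2.
  apply/andP; split; first by nra.
  apply: lt_le_trans h2 _; nra.
congr (_ :: _) => //; apply/(IH _ s01).
move: h1 h2; rewrite -ba [cyl_lo (b :: u)]/= -addrA -mulrDr.
rewrite [X in _ <= X -> _]sE [X in X < _]sE lerD2l ltrD2l ler_pM2l// ltr_pM2l// => h1 h2.
by rewrite h1.
Qed.

Let code_cylinder u : code @^-1` cylinder u =
  (`[cyl_lo u, cyl_lo u + len u[ `&` `[0, 1[) `|`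
  ([set x | ~~ (0 <= x < 1)] `&` [set x | cyl_lo u <= 0 < cyl_lo u + len u]).
Proof.
apply/seteqP; split=> x; rewrite /cylinder /code /= !in_itv /=.
  case: ifPn => x01; first by move=> /(codeP _ x01) ->; left.
  by move=> /codeP h; right; split=> //; apply: h; rewrite lexx ltr01.
move=> [[h x01]|[/negbTE -> h]]; first by rewrite x01; apply/codeP.
by apply/codeP => //; rewrite lexx ltr01.
Qed.

Let measurable_code : measurable_fun [set: R] (code : R -> T).
Proof.
apply: (@measurability _ _ _ T setT (code : R -> T) (range (@cylinder A a0))) => //.
move=> _ [_ [u _ <-] <-]; rewrite setTI code_cylinder.
apply: measurableU; first exact: measurableI.
apply: measurableI.
  rewrite (_ : [set x | _] = ~` `[0, 1[); first exact: measurableC.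
  by apply/seteqP; split=> x /=; rewrite in_itv /= => /negP.
case: (boolP (cyl_lo u <= 0 < cyl_lo u + len u)) => h.
  by rewrite (_ : [set x | _] = setT)//; apply/seteqP; split.
by rewrite (_ : [set x | _] = set0)//; apply/seteqP; split.
Qed.

(** Lebesgue measure on the unit interval is pushed forward under [code], where cylinders pull back
    to intervals of the right length. The mass is already 1; [mnormalize] supplies the type
    [probability]. *)
Lemma product_measure_exists : exists P : probability T R,
  forall u : seq A, P (cylinder u) = (\prod_(a <- u) w a)%:E.
Proof.
have m01 : measurable (`[0, 1[ : set R) by [].
pose m1 : {measure set _ -> \bar R} := mrestr (@lebesgue_measure R) m01.
pose mu : {measure set T -> \bar R} :=
  measure_function_pushforward__canonical__measure_function_Measure m1 measurable_code.
have muE u : mu (cylinder u) = (\prod_(a <- u) w a)%:E.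
  rewrite /mu /= /pushforward /= /mrestr code_cylinder setIUl.
  rewrite [X in _ `|` X](_ : _ = set0) ?setU0; last first.
    by apply/seteqP; split=> // x [[/negP h _]]; rewrite /= in_itv.
  have [lo0 lo1] := cyl_lo_bounds u.
  rewrite -setIA setIid (_ : _ `&` _ = `[cyl_lo u, cyl_lo u + len u[%classic); last first.
    apply/seteqP; split=> x /=; rewrite !in_itv /=; first by case.
    by move=> /andP[h1 h2]; rewrite h1 h2; split=> //; apply/andP; split; lra.
  rewrite lebesgue_measure_itv /= lte_fin ltrDl.
  case: ltrP => [_|]; first by rewrite -EFinB addrC addKr.
  by move=> h; congr (_%:E); apply/eqP; rewrite eq_le len_ge0 h.
have mu1 : mu [set: T] = 1%:E.
  rewrite (_ : setT = cylinder [::] :> set T) ?muE ?big_nil//.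
  by apply/seteqP; split.
exists (mnormalize mu point) => u; rewrite /= /mnormalize /= -/(mu setT) mu1 /= eqe oner_eq0 /= invr1 mule1.
exact: muE.
Qed.

Lemma product_measureP u :
  @product_measure A a0 R w (cylinder u) = (\prod_(a <- u) w a)%:E.
Proof.
have [P hP] := product_measure_exists.
by rewrite /product_measure; case: xgetP => [Q _ -> //|/(_ P)].
Qed.

End ProductMeasure.

Section FinitelyValued.
Context d (T : measurableType d) (R : realType) (P : probability T R).
Context (I : finType) (q : T -> I).
Hypothesis mq : forall i, measurable [set s | q s = i].

Lemma measurable_finite_preimage (B : set I) : measurable (q @^-1` B).
Proof.
have -> : q @^-1` B = \bigcup_(i in B) [set s | q s = i].
  by apply/seteqP; split=> s /=; [exists (q s)|move=> [i Bi /= ->]].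
by apply: fin_bigcup_measurable => //; exact: finite_finset.
Qed.

Lemma measurable_fun_finite d' (Y : measurableType d') (c : I -> Y) :
  measurable_fun [set: T] (fun s => c (q s)).
Proof. by move=> _ B mB; rewrite setTI; exact: (measurable_finite_preimage (c @^-1` B)). Qed.

Lemma integral_finite (c : I -> R) :
  (\int[P]_s (c (q s))%:E = (\sum_i c i * fine (P [set s | q s = i]))%:E)%E.
Proof.
have E s : (c (q s))%:E = (\sum_(i : I) (c i)%:E * (\1_[set s | q s = i] s)%:E)%E.
  rewrite (bigD1 (q s)) //= big1 ?adde0.
    by rewrite indicE mem_set ?mule1.
  move=> i qi; rewrite indicE memNset ?mule0//= => /esym/eqP h.
  by rewrite h in qi.
under eq_integral do rewrite E.
have mI i : P.-integrable setT (EFin \o (\1_[set s | q s = i] : T -> R)).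
  exact: integrable_indic.
rewrite integral_sum//=; last first.
  by move=> i; apply: (integrableZl measurableT (c i) (mI i)).
rewrite -sumEFin; apply: eq_bigr => i _.
rewrite integralZl//; last exact: mI.
by rewrite integral_indic// setIT EFinM fineK// fin_num_measure.
Qed.

End FinitelyValued.

Section BoundedIntegrals.
Context d (T : measurableType d) (R : realType) (P : probability T R).

Lemma bounded_integrable (F : T -> R) (B : R) : measurable_fun setT F ->
  (forall s, `|F s| <= B) -> P.-integrable setT (EFin \o F).
Proof.
move=> mF FB; apply: (@le_integrable _ _ _ P setT measurableT _ (EFin \o cst B)).
- exact/measurable_EFinP.
- move=> s _ /=; rewrite lee_fin; apply: le_trans (FB s) _.
  exact: ler_norm.
- exact: finite_measure_integrable_cst.
Qed.

Lemma integral_dist_le (F G : T -> R) (B e : R) :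
  measurable_fun setT F -> measurable_fun setT G -> (forall s, `|G s| <= B) ->
  (forall s, `|F s - G s| <= e) ->
  `|fine (\int[P]_s (F s)%:E) - fine (\int[P]_s (G s)%:E)| <= e.
Proof.
move=> mF mG GB FG.
have iG := bounded_integrable mG GB.
have iF : P.-integrable setT (EFin \o F).
  apply: (@bounded_integrable _ (e + B)) => // s.
  by rewrite -[F s](subrK (G s)); apply: le_trans (ler_normD _ _) _; exact: lerD.
have iFG : P.-integrable setT (EFin \o (fun s => F s - G s)).
  by apply: (@bounded_integrable _ e) => //; exact: measurable_funB.
change (`|Rintegral P setT F - Rintegral P setT G| <= e).
rewrite -RintegralB//.
apply: le_trans (le_normr_Rintegral measurableT iFG) _.
have -> : e = Rintegral P setT (cst e).
  by rewrite (@Rintegral_cst _ _ _ P)// [X in fine X](@probability_setT _ _ _ P) mulr1.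
apply: le_Rintegral => //.
  by apply: (@bounded_integrable _ e) => // [|s];
    [apply: measurableT_comp => //; exact: measurable_funB|rewrite normr_id].
exact: finite_measure_integrable_cst.
Qed.

End BoundedIntegrals.

Section StepFunctions.
Context (R : realType) (A : finType) (a0 : A) (w : A -> R).
Local Notation T := (mseqspace a0).
Context (P : probability T R).
Hypothesis P_cylinder : forall u : seq A, P (cylinder u) = (\prod_(a <- u) w a)%:E.

Let pfx k (s : T) : k.-tuple A := tcast (size_mkseq s k) (in_tuple (mkseq s k)).

Let pfxE k (s : T) : pfx k s = mkseq s k :> seq A.
Proof. by rewrite val_tcast. Qed.

Let pfx_cylinder k (u : k.-tuple A) : [set s | pfx k s = u] = cylinder (a0 := a0) u.
Proof.
apply/seteqP; split=> s /=; rewrite /cylinder /= size_tuple => h.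
  by rewrite -pfxE h.
by apply: val_inj; rewrite /= pfxE.
Qed.

Let pfxS_cylinder k (ub : k.-tuple A * A) :
  [set s | (pfx k s, s k) = ub] = cylinder (a0 := a0) (rcons ub.1 ub.2).
Proof.
case: ub => u b; apply/seteqP; split=> s /=.
  by case=> <- <-; rewrite /cylinder /= size_rcons size_tuple mkseqS pfxE.
rewrite /cylinder /= size_rcons size_tuple mkseqS => /eqP.
rewrite eqseq_rcons => /andP[/eqP h /eqP ->]; congr (_, _).
by apply: val_inj; rewrite /= pfxE.
Qed.

Lemma measurable_fun_prefix d (Y : measurableType d) k (c : seq A -> Y) :
  measurable_fun [set: T] (fun s : T => c (mkseq s k)).
Proof.
rewrite (_ : (fun s => _) = fun s => c (pfx k s)); last by apply/funext => s; rewrite pfxE.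
apply: (@measurable_fun_finite _ T _ (pfx k) _ _ _ (fun u : k.-tuple A => c u)) => u.
by rewrite pfx_cylinder; exact: measurable_cylinder.
Qed.

Lemma step_bounded k (c : seq A -> R) : exists B, forall s : T, `|c (mkseq s k)| <= B.
Proof.
exists (\sum_(u : k.-tuple A) `|c u|) => s.
by rewrite -pfxE (bigD1 (pfx k s)) //= lerDl sumr_ge0.
Qed.

(** Conditional expectation given the first k letters: the next letter is independent of them with
    law w. *)
Lemma step_meanS k (c : seq A -> R) :
  (\int[P]_s (c (mkseq s k.+1))%:E =
   \int[P]_s (\sum_b w b * c (rcons (mkseq s k) b))%:E)%E.
Proof.
transitivity (\int[P]_s (c (rcons (pfx k s, s k).1 (pfx k s, s k).2))%:E)%E.
  by apply: eq_integral => s _; rewrite mkseqS -pfxE.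
rewrite (@integral_finite _ T R P _ (fun s => (pfx k s, s k))
  _ (fun ub => c (rcons ub.1 ub.2))); last first.
  by move=> ub; rewrite pfxS_cylinder; exact: measurable_cylinder.
transitivity (\int[P]_s (\sum_b w b * c (rcons (pfx k s) b))%:E)%E; last first.
  by apply: eq_integral => s _; rewrite pfxE.
rewrite (@integral_finite _ T R P _ (pfx k) _ (fun u => \sum_b w b * c (rcons u b))); last first.
  by move=> u; rewrite pfx_cylinder; exact: measurable_cylinder.
congr (_%:E); under [RHS]eq_bigr do rewrite mulr_suml.
rewrite pair_bigA /=; apply: eq_bigr => -[u b] _ /=.
rewrite pfxS_cylinder pfx_cylinder /= !P_cylinder /= -cats1 big_cat big_seq1 /=.
ring.
Qed.

End StepFunctions.

(** * Measurability on the limit space *)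

Section LimitMeasurable.
Context (R : realType) (S : simple_igs) (D : doubling S) (hnd : non_degenerate S).
Local Notation X := (borel_space R D).
Local Notation limX := (limit_space R D).
Implicit Types (s t : Sigma D) (f : X -> R).

(** By [open_chi] the preimage of an open set is the union of the cylinders it contains, and there
    are countably many words. *)
Lemma measurable_chi_comp (A : finType) (a0 : A) (q : mseqspace a0 -> Sigma D) :
  (forall k (a b : mseqspace a0), mkseq a k = mkseq b k -> meets k (q a) (q b)) ->
  measurable_fun setT (fun a => chi (q a) : X).
Proof.
move=> hq; apply: (@measurability _ _ _ X setT _ (@open limX)) => //.
move=> _ [U opU <-]; rewrite setTI.
pose F := fun u : seq A => if `[< (cylinder u : set (mseqspace a0)) `<=` (fun a => chi (q a)) @^-1` U >]
  then (cylinder u : set (mseqspace a0)) else set0.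
have -> : (fun a => chi (q a) : X) @^-1` U = \bigcup_u F u.
  apply/seteqP; split=> a /=.
    move=> /(open_chi hnd opU)[k hk]; exists (mkseq a k) => //; rewrite /F.
    case: asboolP => [_|[]]; first by rewrite /cylinder /= size_mkseq.
    by move=> b; rewrite /cylinder /= size_mkseq => ba; apply/hk/hq.
  by move=> [u _]; rewrite /F; case: asboolP => // uU /uU.
apply: countable_bigcupT_measurable => // u.
by rewrite /F; case: ifP => // _; exact: measurable_cylinder.
Qed.

Lemma measurable_chi : measurable_fun setT (fun s : mseqspace (edge0 D) => chi s : X).
Proof. by apply: measurable_chi_comp => k a b /meets_mkseq. Qed.

Lemma measurable_open (O : set X) : open (O : set limX) -> measurable O.
Proof. by move=> opO; apply: sub_sigma_algebra. Qed.

Lemma measurable_continuous f : continuous (f : limX -> R) -> measurable_fun setT f.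
Proof.
move=> cf; apply: (measurability _ (RGenOInfty.measurableE R)) => //.
move=> _ [_ [a ->] <-]; rewrite setTI; apply: measurable_open.
exact: open_comp.
Qed.

Lemma continuous_bounded f : continuous (f : limX -> R) -> exists B, forall x, `|f x| <= B.
Proof.
move=> cf; have [k hk] := uniform_continuous_chi hnd cf ltr01.
have /choice[pt hpt] := @pre_surj S D k.
exists (\sum_(e : edge (Gr S k)) `|f (chi (pt e))| + 1) => x.
have [s <-] := chi_surj x.
have st : meets k s (pt (pre s k)) by rewrite /meets hpt meet_refl.
rewrite -[f (chi s)](subrK (f (chi (pt (pre s k))))) addrC.
apply: le_trans (ler_normD _ _) _; apply: lerD; last exact: ltW (hk _ _ st).
by rewrite (bigD1 (pre s k)) //= lerDl sumr_ge0.
Qed.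

Lemma measurable_dball (x : X) r : measurable (@dball S D R x r : set X).
Proof. by apply: measurable_open; exact: open_dball. Qed.

End LimitMeasurable.

(** * Fibres over vertices *)

Section FibreMap.
Context (S : simple_igs) (D : doubling S).
Context (n : nat) (v : vertex (Gr S n)) (e : edge (Gr S n)) (ve : v \in ends e).
Implicit Types (a b : nat -> symbol S).

Lemma vmul_next m (w : vertex (Gr S m)) (g : edge (Gr S m)) (x : symbol S) :
  w \in ends g -> exists f : edge S, vmul D w x \in ends ((g, f) : edge (Gr S m.+1)).
Proof.
move=> /mem_endsP[s ->]; rewrite vmulE.
have [[t f] /= h _] := gate_edgeP D s x; exists f.
by rewrite -h; exact: (@oend_ends (Gr S m.+1) t (g, f)).
Qed.

Lemma vmuls_mkseq a b m : mkseq a m = mkseq b m -> vmuls D v a m = vmuls D v b m.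
Proof.
elim: m => //= m IH; rewrite !mkseqS => /eqP; rewrite eqseq_rcons => /andP[/eqP/IH -> /eqP ->].
by [].
Qed.

(** [Tmap] is a choice, so a sequence has to be exhibited: at each level take the edge at the gate
    of the next symbol. The case m = 0 comes from v being an end of e. *)
Lemma TmapP a : pre (Tmap D v e a) n = e /\
  forall m, vmuls D v a m \in ends (pre (Tmap D v e a) (m + n)).
Proof.
suff [s [h1 h2]] : exists s : Sigma D, pre s n = e /\
    forall m, (0 < m)%N -> vmuls D v a m \in ends (pre s (m + n)).
  rewrite /Tmap; case: xgetP => [t _ [t1 t2]|/(_ s)/(_ (conj h1 h2))//].
  split=> // -[|m]; last exact: t2.
    by change (v \in ends (pre t n)); rewrite t1.
have /choice[F hF] : forall mg : {m & edge (Gr S (m + n))}, exists f : edge S,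
    vmuls D v a (tag mg) \in ends (tagged mg) ->
    vmuls D v a (tag mg).+1 \in ends ((tagged mg, f) : edge (Gr S ((tag mg).+1 + n))).
  move=> [m g] /=; have [wg|_] := boolP (vmuls D v a m \in ends g); last by exists (edge0 D).
  by have [f hf] := vmul_next (a m) wg; exists f.
pose G := fix G m : edge (Gr S (m + n)) :=
  if m is k.+1 return edge (Gr S (m + n)) then (G k, F (existT _ k (G k))) else e.
have hG m : vmuls D v a m \in ends (G m).
  elim: m => [//|m IH]; exact: (hF (existT _ m (G m)) IH).
pose s : Sigma D := fun i => if (i < n)%N then nth (edge0 D) (word e) i
  else F (existT (fun m => edge (Gr S (m + n))) (i - n)%N (G (i - n)%N)).
have sn : pre s n = e.
  apply: word_inj; rewrite word_pre -[RHS](mkseq_nth (edge0 D)) size_word.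
  by apply/eq_in_map => i; rewrite mem_iota /= => /= ilt; rewrite /s ilt.
exists s; split=> // m _.
suff -> : pre s (m + n) = G m by exact: hG.
elim: m => //= m IH; congr (_, _) => //; rewrite /s.
by rewrite ltnNge leq_addl /= addnK.
Qed.

Lemma Tmap_meets a k s : vmuls D v a k \in ends (pre s (k + n)) ->
  meets (k + n) (Tmap D v e a) s.
Proof.
move=> h; apply/finset.set0Pn; exists (vmuls D v a k).
by rewrite finset.inE h (TmapP a).2.
Qed.

Lemma Tmap_mkseq a b k : mkseq a k = mkseq b k ->
  meets k (Tmap D v e a) (Tmap D v e b).
Proof.
move=> /vmuls_mkseq ab; apply: (meets_le (leq_addr n k)); apply: Tmap_meets.
by rewrite ab; exact: (TmapP b).2.
Qed.

End FibreMap.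

Section Averages.
Context (R : realType) (S : simple_igs) (D : doubling S) (hnd : non_degenerate S).
Context (p : R) (p1 : 1 < p).
Local Notation X := (borel_space R D).
Local Notation limX := (limit_space R D).
Local Notation fam := (forall m, vertex (Gr S m) -> R).
Implicit Types (f : X -> R) (F : fam).

Lemma measurable_Tmap n (v : vertex (Gr S n)) e : v \in ends e ->
  measurable_fun setT (fun a : mseqspace (symbol0 S) => chi (Tmap D v e a) : X).
Proof. by move=> ve; apply: measurable_chi_comp => // k a b /(Tmap_mkseq D ve). Qed.

(** Fibres are closed: if s met points of the fibre at every level, Koenig's lemma would give a
    point of the fibre equivalent to s. *)
Lemma measurable_Fib n (v : vertex (Gr S n)) e : v \in ends e -> measurable (@Fib R S D n v e : set X).
Proof.
move=> ve; rewrite -[X in measurable X]setCK; apply: measurableC; apply: measurable_open.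
rewrite openE => x; have [s <-] := chi_surj x => nF.
have [k hk] : exists k, forall a, ~~ meets k s (Tmap D v e a).
  apply: contrapT => /forallNP h.
  pose P k (a : nat -> symbol S) := exists b, mkseq a k = mkseq b k /\ meets k s (Tmap D v e b).
  have [] := @konig _ P.
  - by move=> k; have /existsNP[a /negP] := h k; rewrite negbK => ha; exists a, a.
  - move=> k a [b [ab sb]]; exists b; split; last exact: meets_le sb.
    by move: ab; rewrite !mkseqS => /eqP; rewrite eqseq_rcons => /andP[/eqP].
  - by move=> k a b ab [c [ac sc]]; exists c; rewrite -ab.
  move=> a ha; apply: nF; exists a => //.
  apply/(chi_eq R hnd) => k; have [b [ab sb]] := ha (k + 4)%N.
  have := Tmap_mkseq D ve (esym ab) => tb.
  have : meets k s (Tmap D v e a) by apply: (meets_trans R hnd sb).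
  by rewrite meets_sym.
rewrite /interior /= nbhsE /=; exists (@dball S D R (chi s) ((Lstar S)%:R ^- k / 2)).
  split; first exact: open_dball.
  rewrite /dball /= (dist_chi R hnd) (_ : dinf R s s = 0).
    by rewrite divr_gt0// invr_gt0 exprn_gt0// ltr0n (ltn_trans _ (Lstar_ge2 D hnd)).
  by apply/(simP R hnd) => m; exact: meets_refl.
move=> y hy [a _ ay]; move: hy; rewrite -ay /dball /= (dist_chi R hnd).
by move=> /(dinf_lt_meets hnd); apply/negP; exact: hk.
Qed.

Local Notation P := (product_measure (symbol0 S) (Jdens p : symbol S -> R)).

Lemma integral_flow n (v : vertex (Gr S n)) e f : v \in ends e -> continuous (f : limX -> R) ->
  (\int[flow_measure p v e]_(x in @Fib R S D n v e) (f x)%:E =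
   \int[P]_a (f (chi (Tmap D v e a)))%:E)%E.
Proof.
move=> ve cf; have mf := measurable_continuous cf; have mT := measurable_Tmap ve.
have [B fB] := continuous_bounded hnd cf.
have -> : [set: mseqspace (symbol0 S)] =
    (fun a : mseqspace (symbol0 S) => chi (Tmap D v e a) : X) @^-1` (Fib v e).
  by apply/seteqP; split=> // a _; exists a.
rewrite /flow_measure integral_pushforward//.
- exact/measurable_EFinP.
- apply: (@integrableS _ _ _ _ setT); rewrite ?preimage_setT//.
    rewrite -[X in measurable X]setTI; apply: mT => //; exact: measurable_Fib.
  apply: (@bounded_integrable _ (mseqspace (symbol0 S)) R P (fun a => f (chi (Tmap D v e a))) B).
    exact: (measurableT_comp mf mT).
  by move=> a; exact: fB.
- exact: measurable_Fib.
Qed.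

Definition avg m (F : vertex (Gr S m.+1) -> R) (v : vertex (Gr S m)) : R :=
  \sum_a Jdens p a * F (vmul D v a).
Definition avgfam F : fam := fun m => avg (F m.+1).

Lemma integral_vmuls n (v : vertex (Gr S n)) k F :
  fine (\int[P]_a (F (k + n)%N (vmuls D v a k))%:E)%E = iter k avgfam F n v.
Proof.
elim: k F => [|k IH] F.
  have := @integral_cst _ _ _ P setT measurableT (F n v)%:E; rewrite /cst => /= ->.
  by rewrite (@probability_setT _ _ _ P) mule1.
rewrite iterSr -IH; congr fine.
pose nths u i : symbol S := nth (symbol0 S) u i.
have nthsE (a : nat -> symbol S) j : vmuls D v a j = vmuls D v (nths (mkseq a j)) j.
  apply: vmuls_mkseq; apply/eq_in_map => i; rewrite mem_iota /= add0n => ij.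
  by rewrite /nths nth_mkseq.
under eq_integral do rewrite nthsE.
rewrite (@step_meanS _ _ _ (Jdens p) P _ k (fun u => F _ (vmuls D v (nths u) k.+1))); last first.
  by apply: product_measureP; [exact: Jdens_ge0|exact: sum_Jdens].
apply: eq_integral => a _; congr (_%:E); apply: eq_bigr => b _; congr (_ * F _ _).
rewrite /=; congr (vmul D _ _); last by rewrite /nths nth_rcons size_mkseq ltnn eqxx.
apply: vmuls_mkseq; apply/eq_in_map => i; rewrite mem_iota /= add0n => ij.
by rewrite /nths nth_rcons size_mkseq ij nth_mkseq.
Qed.

(** [Tmap v e a] passes through v.(a_1 ... a_k), so a discrete function close to f at level k + n
    yields V_n f, up to the same error, by k averaging steps. *)
Lemma Vn_approx f F n k eps (v : vertex (Gr S n)) : continuous (f : limX -> R) ->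
  (forall s w, w \in ends (pre s (k + n)) -> `|f (chi (s : Sigma D)) - F (k + n)%N w| <= eps) ->
  `|Vn p f v - iter k avgfam F n v| <= eps.
Proof.
move=> cf hF; rewrite /Vn; case: pickP => [e ve|/= no]; last first.
  by have [s [e ve]] := oend_surj D v; have := no e; rewrite ve oend_ends.
rewrite integral_flow// -integral_vmuls.
pose nths u i : symbol S := nth (symbol0 S) u i.
have nthsE (a : nat -> symbol S) : vmuls D v a k = vmuls D v (nths (mkseq a k)) k.
  apply: vmuls_mkseq; apply/eq_in_map => i; rewrite mem_iota /= add0n => ij.
  by rewrite /nths nth_mkseq.
have [B hB] := step_bounded (symbol0 S) k (fun u => F (k + n)%N (vmuls D v (nths u) k)).
apply: (@integral_dist_le _ (mseqspace (symbol0 S)) R P (fun a => f (chi (Tmap D v e a)))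
  (fun a => F (k + n)%N (vmuls D v a k)) B).
- exact: (measurableT_comp (measurable_continuous cf) (measurable_Tmap ve)).
- rewrite (_ : (fun a => _) = fun a => F (k + n)%N (vmuls D v (nths (mkseq a k)) k)).
    exact: (@measurable_fun_prefix _ (symbol0 S) _ R k (fun u => F (k + n)%N (vmuls D v (nths u) k))).
  by apply/funext => a; rewrite nthsE.
- by move=> a; rewrite nthsE; exact: hB.
- by move=> a; apply: hF; exact: (TmapP D ve a).2.
Qed.

End Averages.

(** * The discrete energies *)

Section Energies.
Context (R : realType) (S : simple_igs) (D : doubling S) (hnd : non_degenerate S).
Context (hcu : conductively_uniform R S) (p : R) (p1 : 1 < p).
Local Notation X := (borel_space R D).
Local Notation limX := (limit_space R D).
Local Notation fam := (forall m, vertex (Gr S m) -> R).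
Local Notation M := (Mp S p).
Implicit Types (f g : X -> R) (F H : fam) (s t : Sigma D).

Lemma Jdens_norm_le (x : symbol S -> R) e : (forall a, `|x a| <= e) ->
  `|\sum_a Jdens p a * x a| <= e.
Proof.
move=> xe; apply: le_trans (ler_norm_sum _ _ _) _.
rewrite -[leRHS]mul1r -(sum_Jdens D p1) mulr_suml; apply: ler_sum => a _.
by rewrite normrM ger0_norm ?(Jdens_ge0 D p1)// ler_wpM2l ?(Jdens_ge0 D p1).
Qed.

Lemma avg_dist m (u u' : vertex (Gr S m.+1) -> R) v e : (forall w, `|u w - u' w| <= e) ->
  `|avg D p u v - avg D p u' v| <= e.
Proof.
move=> h; rewrite /avg -sumrB (eq_bigr _ (fun a _ => esym (mulrBr _ _ _))).
by apply: Jdens_norm_le => a; exact: h.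
Qed.

Definition traces f H := forall e : R, 0 < e -> exists k, forall m, (k <= m)%N ->
  forall s w, w \in ends (pre s m) -> `|f (chi s) - H m w| <= e.

Definition harmonic n H := forall m, (n <= m)%N -> forall v, H m v = avg D p (H m.+1) v.

Lemma iter_avgfam_harmonic n H k m v : harmonic n H -> (n <= m)%N ->
  iter k (avgfam D p) H m v = H m v.
Proof.
move=> hH; elim: k m v => //= k IH m v nm; rewrite [RHS]hH//.
by apply: eq_bigr => a _; rewrite IH// (leq_trans nm).
Qed.

(** Identifies V_n f without integrals, from consistency under averaging and uniform convergence to
    f. Linearity of V_n and its values on extended functions are obtained this way. *)
Lemma Vn_eq f n H m v : continuous (f : limX -> R) -> harmonic n H -> traces f H -> (n <= m)%N ->
  Vn p f v = H m v.
Proof.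
move=> cf hH tH nm; apply/eqP; rewrite -subr_eq0 -normr_le0; apply/ler_addgt0Pl => e e0.
rewrite addr0; have [k hk] := tH e e0.
rewrite -(iter_avgfam_harmonic k v hH nm); apply: Vn_approx => // s w.
by apply: hk; rewrite leq_addr.
Qed.

Lemma Vn_traces f : continuous (f : limX -> R) -> traces f (fun m => @Vn R S D p m f).
Proof.
move=> cf e e0; have e2 : 0 < e / 2 by rewrite divr_gt0.
have [k hk] := uniform_continuous_chi hnd cf e2; exists k => m km s w ws.
pose pt j (v : vertex (Gr S j)) : Sigma D := xget point [set s | v \in ends (pre s j)].
have ptP j (v : vertex (Gr S j)) : v \in ends (pre (pt j v) j).
  rewrite /pt; case: xgetP => // no.
  have [b [g vE]] := oend_surj D v; have [t tg] := @pre_surj S D _ g.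
  by exfalso; apply: (no t); rewrite /= tg vE; exact: oend_ends.
have st j (v : vertex (Gr S j)) t : (k <= j)%N -> v \in ends (pre t j) ->
    `|f (chi t) - f (chi (pt j v))| <= e / 2.
  move=> kj vt; apply/ltW/hk; apply: (meets_le kj); apply/finset.set0Pn; exists v.
  by rewrite finset.inE vt ptP.
have h1 : `|Vn p f w - f (chi (pt m w))| <= e / 2.
  apply: (@Vn_approx _ _ _ hnd _ p1 _ (fun j v => f (chi (pt j v))) m 0) => // s' w'.
  exact: st.
apply: le_trans (ler_distD (f (chi (pt m w))) _ _) _.
by rewrite [leRHS]splitr; apply: lerD; [exact: st|rewrite distrC].
Qed.

(** Both sides are close to the same iterated average taken from a deep level. *)
Lemma Vn_avg f n v : continuous (f : limX -> R) -> Vn p f v = avg D p (@Vn R S D p n.+1 f) v.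
Proof.
move=> cf; apply/eqP; rewrite -subr_eq0 -normr_le0; apply/ler_addgt0Pl => e e0.
rewrite addr0; have e2 : 0 < e / 2 by rewrite divr_gt0.
have [k hk] := Vn_traces cf e2.
pose V : fam := fun m => @Vn R S D p m f.
have h j m w : (k <= j + m)%N -> `|V m w - iter j (avgfam D p) V m w| <= e / 2.
  by move=> km; apply: Vn_approx => // s w'; apply: hk.
have h1 := h k.+1 n v; have h2 : `|iter k.+1 (avgfam D p) V n v - avg D p (V n.+1) v| <= e / 2.
  by rewrite iterS /avgfam -/(avgfam D p); apply: avg_dist => w; rewrite distrC h// leq_addr.
apply: le_trans (ler_distD (iter k.+1 (avgfam D p) V n v) _ _) _.
rewrite [leRHS]splitr; apply: lerD => //; apply: h1.
by rewrite addSn ltnW// ltnS leq_addr.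
Qed.

Lemma continuous_lin f g a b : continuous (f : limX -> R) -> continuous (g : limX -> R) ->
  continuous ((fun x => a * f x + b * g x) : limX -> R).
Proof.
move=> cf cg z.
exact: (@cvgD R R limX (nbhs z) _ (fun x => a * f x) (fun x => b * g x) _ _ (cvgM (cvg_cst a) (cf z)) (cvgM (cvg_cst b) (cg z))).
Qed.

Lemma Vn_lin f g a b n (v : vertex (Gr S n)) : continuous (f : limX -> R) ->
  continuous (g : limX -> R) -> continuous ((fun x => a * f x + b * g x) : limX -> R) ->
  Vn p (fun x => a * f x + b * g x) v = a * Vn p f v + b * Vn p g v.
Proof.
move=> cf cg cfg; pose H : fam := fun m v => a * Vn p f v + b * Vn p g v.
apply: (@Vn_eq _ 0 H) => //.
  move=> m _ w; rewrite /H (Vn_avg _ cf) (Vn_avg _ cg) /avg !mulr_sumr -big_split /=.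
  by apply: eq_bigr => x _; rewrite mulrDr mulrCA [in RHS]mulrCA [X in _ + X]mulrCA; ring.
move=> e e0; pose B := `|a| + `|b| + 1.
have B0 : 0 < B by rewrite /B; have := normr_ge0 a; have := normr_ge0 b; lra.
have eB : 0 < e / B by rewrite divr_gt0.
have [k1 h1] := Vn_traces cf eB; have [k2 h2] := Vn_traces cg eB.
exists (maxn k1 k2) => m; rewrite geq_max => /andP[m1 m2] s w ws; rewrite /H.
have -> : a * f (chi s) + b * g (chi s) - (a * Vn p f w + b * Vn p g w) =
  a * (f (chi s) - Vn p f w) + b * (g (chi s) - Vn p g w) by ring.
apply: le_trans (ler_normD _ _) _; rewrite !normrM.
have l1 := ler_wpM2l (normr_ge0 a) (h1 _ m1 s w ws).
have l2 := ler_wpM2l (normr_ge0 b) (h2 _ m2 s w ws).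
apply: le_trans (lerD l1 l2) _; rewrite -mulrDl.
rewrite mulrA ler_pdivrMr// mulrC ler_pM2l// /B; lra.
Qed.

Definition En f n : R := M ^- n * energy p (@Vn R S D p n f).

Let M0 : 0 < M. Proof. exact: Mp_gt0. Qed.

Lemma En_ge0 f n : 0 <= En f n.
Proof. by rewrite mulr_ge0 ?energy_ge0// invr_ge0 exprn_ge0// ltW// M0. Qed.

(** [flow_average_le] in every cell: the values of [avg W] at the two ends of e differ by the flow
    average of the increments of W between paired gates in e. *)
Lemma energy_avg m (W : vertex (Gr S m.+1) -> R) :
  M * energy p (avg D p W : vertex (Gr S m) -> R) <= energy p W.
Proof.
rewrite /energy mulr_sumr /=.
rewrite -(pair_bigA _ (fun y z => `|W (@oend (Gr S m.+1) true (y, z)) -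
  W (@oend (Gr S m.+1) false (y, z))| `^ p)) /=.
apply: ler_sum => e _.
have := flow_average_le D p1 hcu (fun z => W (cls z e)).
rewrite (_ : \sum_a _ = avg D p W (oend true e) - avg D p W (oend false e)) //.
rewrite /avg -sumrB; apply: eq_bigr => a _; by rewrite !vmulE mulrBr.
Qed.

Lemma En_leS f n : continuous (f : limX -> R) -> En f n <= En f n.+1.
Proof.
move=> cf; rewrite /En; have -> : @Vn R S D p n f = avg D p (@Vn R S D p n.+1 f).
  by apply/funext => v; exact: Vn_avg.
rewrite exprS invfM (mulrC M^-1) -mulrA ler_wpM2l ?invr_ge0 ?exprn_ge0 ?(ltW M0)//.
by rewrite mulrC ler_pdivlMr ?M0// mulrC energy_avg.
Qed.

Lemma En_le f m n : continuous (f : limX -> R) -> (m <= n)%N -> En f m <= En f n.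
Proof.
move=> cf; move: m n; apply/nondecreasing_seqP => n; exact: En_leS.
Qed.

Lemma EcalE f : continuous (f : limX -> R) -> Ecal p f = ereal_sup (range (fun n => (En f n)%:E)).
Proof.
move=> cf; apply/cvg_lim => //; apply: ereal_nondecreasing_cvgn.
by move=> m n mn; rewrite lee_fin; exact: En_le.
Qed.

Lemma En_le_Ecal f n : continuous (f : limX -> R) -> ((En f n)%:E <= Ecal p f)%E.
Proof. by move=> cf; rewrite EcalE//; apply: ereal_sup_ubound; exists n. Qed.

Lemma Ecal_le f n0 x : continuous (f : limX -> R) ->
  (forall n, (n0 <= n)%N -> ((En f n)%:E <= x)%E) -> (Ecal p f <= x)%E.
Proof.
move=> cf h; rewrite EcalE//; apply: ge_ereal_sup => _ [n _ <-].
by apply: le_trans (h (maxn n0 n) (leq_maxl _ _)); rewrite lee_fin En_le// leq_maxr.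
Qed.

Lemma Ecal_ge0 f : continuous (f : limX -> R) -> (0 <= Ecal p f)%E.
Proof. by move=> cf; apply: le_trans (En_le_Ecal 0 cf); rewrite lee_fin En_ge0. Qed.

Lemma Cp_le f n0 B : continuous (f : limX -> R) ->
  (forall n, (n0 <= n)%N -> En f n <= B) -> Cp p f /\ fine (Ecal p f) <= B.
Proof.
move=> cf h; have hB : (Ecal p f <= B%:E)%E.
  by apply: (Ecal_le (n0 := n0)) => // n /h; rewrite lee_fin.
have oo : (Ecal p f < +oo)%E by apply: le_lt_trans hB _; rewrite ltry.
split=> //; rewrite -lee_fin fineK// ge0_fin_numE//; exact: Ecal_ge0.
Qed.

Lemma Cp_fin_num f : Cp p f -> Ecal p f \is a fin_num.
Proof. by move=> [cf oo]; rewrite ge0_fin_numE// Ecal_ge0. Qed.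

Lemma Cp_En_le f n : Cp p f -> En f n <= fine (Ecal p f).
Proof.
by move=> Cf; rewrite -lee_fin fineK; [exact/En_le_Ecal/Cf.1|exact: Cp_fin_num].
Qed.

(** V_n is linear, so an inequality between p-th powers of numbers applies to the gradients edge by
    edge. *)
Lemma En_lin_le f g a b x y n : 0 <= x -> 0 <= y ->
  continuous (f : limX -> R) -> continuous (g : limX -> R) ->
  (forall u v : R, `|a * u + b * v| `^ p <= x * `|u| `^ p + y * `|v| `^ p) ->
  En (fun z => a * f z + b * g z) n <= x * En f n + y * En g n.
Proof.
move=> x0 y0 cf cg h.
have cfg : continuous ((fun z => a * f z + b * g z) : limX -> R) by exact: continuous_lin.
rewrite /En mulrCA [y * _]mulrCA -mulrDr ler_wpM2l ?invr_ge0 ?exprn_ge0 ?(ltW M0)//.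
rewrite /energy !mulr_sumr -big_split /=; apply: ler_sum => e _.
by rewrite !Vn_lin// opprD addrACA -!mulrBr; exact: h.
Qed.

End Energies.

(** * Integrals over pairs of meeting cells *)

Section NonnegativeIntegrals.
Context d (T : measurableType d) (R : realType) (P : probability T R).
Implicit Types F G H : T -> R.

Lemma ge0_integral_le F G : measurable_fun setT F -> measurable_fun setT G ->
  (forall s, 0 <= F s) -> (forall s, F s <= G s) ->
  (\int[P]_s (F s)%:E <= \int[P]_s (G s)%:E)%E.
Proof.
move=> mF mG F0 FG; apply: ge0_le_integral => //.
- by move=> s _; rewrite lee_fin.
- exact/measurable_EFinP.
- exact/measurable_EFinP.
- by move=> s _; rewrite lee_fin.
Qed.

Lemma ge0_integral_comb G H a b : measurable_fun setT G -> measurable_fun setT H ->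
  (forall s, 0 <= G s) -> (forall s, 0 <= H s) -> 0 <= a -> 0 <= b ->
  (\int[P]_s (a * G s + b * H s)%:E = a%:E * \int[P]_s (G s)%:E + b%:E * \int[P]_s (H s)%:E)%E.
Proof.
move=> mG mH G0 H0 a0 b0.
have mZ c (K : T -> R) : measurable_fun setT K -> measurable_fun setT (fun s => (c%:E * (K s)%:E)%E).
  by move=> mK; under eq_fun do rewrite -EFinM; apply/measurable_EFinP; exact: measurable_funM.
under eq_integral do rewrite EFinD !EFinM.
rewrite ge0_integralD//.
- by rewrite !ge0_integralZl_EFin//; try exact/measurable_EFinP; move=> s _; rewrite lee_fin.
- by move=> s _; rewrite -EFinM lee_fin mulr_ge0.
- exact: mZ.
- by move=> s _; rewrite -EFinM lee_fin mulr_ge0.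
- exact: mZ.
Qed.

Lemma ge0_integral_le_comb F G H a b : measurable_fun setT F -> measurable_fun setT G ->
  measurable_fun setT H -> (forall s, 0 <= F s) -> (forall s, 0 <= G s) -> (forall s, 0 <= H s) ->
  0 <= a -> 0 <= b -> (forall s, F s <= a * G s + b * H s) ->
  (\int[P]_s (F s)%:E <= a%:E * \int[P]_s (G s)%:E + b%:E * \int[P]_s (H s)%:E)%E.
Proof.
move=> mF mG mH F0 G0 H0 a0 b0 h; rewrite -ge0_integral_comb//.
by apply: ge0_integral_le => //; apply: measurable_funD; exact: measurable_funM.
Qed.

Lemma measurable_powRB F G p : measurable_fun setT F -> measurable_fun setT G ->
  measurable_fun setT (fun s => `|F s - G s| `^ p).
Proof.
move=> mF mG; apply: (measurableT_comp (measurable_powR p)).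
by apply: measurableT_comp => //; exact: measurable_funB.
Qed.

Lemma integral_const1 (c : R) : (\int[P]_s (c : R)%:E = c%:E)%E.
Proof.
have := @integral_cst _ _ _ P setT measurableT c%:E; rewrite /cst => ->.
by rewrite [X in (_ * X)%E](_ : _ = 1%E) ?mule1//; exact: probability_setT.
Qed.

End NonnegativeIntegrals.

Lemma small_powR (R : realType) (p e : R) : 0 < p -> 0 < e -> exists2 x : R, 0 < x & x `^ p <= e.
Proof.
move=> p0 e0; exists (e `^ p^-1); first exact: powR_gt0.
by rewrite -powRrM mulVf ?gt_eqF// powRr1// ltW.
Qed.

Section Bernoulli.
Context (R : realType) (S : simple_igs) (D : doubling S).
Local Notation N := (#|edge S|%:R : R).
Local Notation T := (mseqspace (edge0 D)).
Local Notation P := (bernoulli R D).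
Local Notation pre := (@pre S D).
Local Notation meets := (@meets S D).
Implicit Types s t : T.

Lemma measurable_integral2 (f : T * T -> \bar R) : measurable_fun setT f ->
  (forall st, 0 <= f st)%E -> measurable_fun setT (fun s : T => \int[P]_t f (s, t))%E.
Proof. exact: measurable_fun_fubini_tonelli_F. Qed.

Lemma card_edge_gt0 : (0 < #|edge S|)%N.
Proof. by apply/card_gt0P; exists (edge0 D). Qed.

Lemma N_gt0 : 0 < N.
Proof. by rewrite ltr0n card_edge_gt0. Qed.

Lemma bernoulli_cylinder u : P (cylinder u) = (N ^- size u)%:E.
Proof.
rewrite /bernoulli product_measureP.
- by rewrite big_const_seq count_predT iter_mulr_1 exprVn.
- by move=> _; rewrite invr_ge0 ltW// N_gt0.
- by rewrite sumr_const -[LHS]mulr_natl divff// gt_eqF// N_gt0.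
Qed.

Lemma pre_cylinder n (e : edge (Gr S n)) : [set s : T | pre s n = e] = cylinder (word e).
Proof.
apply/seteqP; split=> s /=; rewrite /cylinder /= size_word => h; first by rewrite -h word_pre.
by apply: word_inj; rewrite word_pre.
Qed.

Lemma measurable_pre n (e : edge (Gr S n)) : measurable [set s : T | pre s n = e].
Proof. by rewrite pre_cylinder; exact: measurable_cylinder. Qed.

Lemma measurable_fun_pre d (Y : measurableType d) n (c : edge (Gr S n) -> Y) :
  measurable_fun setT (fun s : T => c (pre s n)).
Proof. by apply: (@measurable_fun_finite _ T _ (fun s => pre s n)) => e; exact: measurable_pre. Qed.

Lemma integral_pre n (c : edge (Gr S n) -> R) :
  (\int[P]_s (c (pre s n))%:E = (N ^- n * \sum_e c e)%:E)%E.
Proof.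
rewrite (@integral_finite _ T R P _ (fun s => pre s n) (@measurable_pre n)).
congr (_%:E); rewrite mulr_sumr; apply: eq_bigr => e _.
by rewrite pre_cylinder bernoulli_cylinder size_word /= mulrC.
Qed.

Lemma measurable_meets n s : measurable [set t : T | meets n s t].
Proof.
exact: (@measurable_finite_preimage _ T _ (fun t => pre t n) (@measurable_pre n) [set e | meet (pre s n) e]).
Qed.

Lemma bernoulli_meets n s :
  P [set t : T | meets n s t] = (N ^- n * #|[set e' | meet (pre s n) e']%SET|%:R)%:E.
Proof.
rewrite -[X in P X]setIT -(integral_indic P measurableT (measurable_meets n s)).
transitivity (\int[P]_t ((meet (pre s n) (pre t n))%:R)%:E)%E.
  apply: eq_integral => t _; rewrite indicE; congr ((nat_of_bool _)%:R)%:E.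
  by apply/idP/idP; [exact: set_mem|exact: mem_set].
rewrite (integral_pre (fun e => (meet (pre s n) e)%:R)); congr (_ * _)%:E.
by rewrite -natr_sum -sum1_card [in RHS]big_mkcond /=; congr (_%:R); apply: eq_bigr => e _; rewrite finset.inE.
Qed.

Lemma bernoulli_meets_le n s : (P [set t : T | meets n s t] <= (2 * N * N ^- n)%:E)%E.
Proof.
rewrite bernoulli_meets lee_fin mulrC ler_wpM2r ?invr_ge0 ?exprn_ge0 ?(ltW N_gt0)//.
by rewrite -natrM ler_nat card_meet.
Qed.

Lemma bernoulli_meets_ge n s : ((N ^- n)%:E <= P [set t : T | meets n s t])%E.
Proof.
rewrite bernoulli_meets lee_fin ler_peMr ?invr_ge0 ?exprn_ge0 ?(ltW N_gt0)//.
by rewrite ler1n; apply/card_gt0P; exists (pre s n); rewrite finset.inE meet_refl.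
Qed.

Lemma measurable_meets2 n : measurable [set st : T * T | meets n st.1 st.2].
Proof.
apply: (@measurable_finite_preimage _ (T * T)%type _ (fun st => (pre st.1 n, pre st.2 n)) _
  [set ee | meet ee.1 ee.2]) => -[e e'].
rewrite (_ : [set st | _] = [set s : T | pre s n = e] `*` [set t : T | pre t n = e']).
  by apply: measurableX; exact: measurable_pre.
by apply/seteqP; split=> -[s t] /= [-> ->].
Qed.

Lemma measurable_fun_meets n : measurable_fun setT (fun st : T * T => (meets n st.1 st.2)%:R : R).
Proof.
rewrite (_ : (fun _ => _) = \1_[set st : T * T | meets n st.1 st.2]).
  by apply: measurable_indic; exact: measurable_meets2.
apply/funext => st; rewrite indicE; congr ((nat_of_bool _)%:R).
by apply/idP/idP; [exact: mem_set|exact: set_mem].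
Qed.

Lemma measurable_fun_meets1 n s : measurable_fun setT (fun t : T => (meets n s t)%:R : R).
Proof. exact: (@measurable_fun_pre _ R n (fun e => (meet (pre s n) e)%:R)). Qed.

Lemma integral_meets n s (c : R) : 0 <= c ->
  (\int[P]_t (((meets n s t)%:R : R) * c)%:E <= (2 * N * N ^- n * c)%:E)%E.
Proof.
move=> c0; rewrite (integral_pre (fun e => (meet (pre s n) e)%:R * c)) lee_fin.
rewrite -mulr_suml mulrA ler_wpM2r// mulrC ler_wpM2r ?invr_ge0 ?exprn_ge0 ?(ltW N_gt0)//.
rewrite -natr_sum -natrM ler_nat; apply: leq_trans (card_meet D (pre s n)).
rewrite -sum1_card [leqRHS]big_mkcond /=; apply: leq_sum => e _; by rewrite finset.inE; case: meet.
Qed.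

Section Phi.
Context (phi : T -> R) (mphi : measurable_fun setT phi) (phi0 : forall s, 0 <= phi s).

Let integral_meets1 n :
  (\int[P]_s \int[P]_t (((meets n s t)%:R : R) * phi s)%:E <=
   (2 * N * N ^- n)%:E * \int[P]_s (phi s)%:E)%E.
Proof.
have c0 : 0 <= 2 * N * N ^- n by rewrite !mulr_ge0// ?invr_ge0 ?exprn_ge0 ?(ltW N_gt0).
rewrite -ge0_integralZl_EFin//; last 2 first.
- by move=> s _; rewrite lee_fin.
- exact/measurable_EFinP.
have mf : measurable_fun setT (fun st : T * T => (((meets n st.1 st.2)%:R : R) * phi st.1)%:E).
  apply/measurable_EFinP; apply: measurable_funM; first exact: measurable_fun_meets.
  exact: (measurableT_comp mphi).
apply: ge0_le_integral => //.
- by move=> s _; apply: integral_ge0 => t _; rewrite lee_fin mulr_ge0.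
- apply: (measurable_integral2 mf) => st.
  by rewrite lee_fin mulr_ge0.
- by apply: measurable_funeM; exact/measurable_EFinP.
- by move=> s _; rewrite -EFinM; exact: integral_meets.
Qed.

(** Tonelli and the symmetry of [meets] reduce both summands to phi s; integrating over t gives the
    mass of the cells meeting that of s, at most 2 N N^-n. *)
Lemma integral_meets_sym n :
  (\int[P]_s \int[P]_t (((meets n s t)%:R : R) * (phi s + phi t))%:E <=
   (4 * N * N ^- n)%:E * \int[P]_s (phi s)%:E)%E.
Proof.
have mf : measurable_fun setT (fun st : T * T => (((meets n st.1 st.2)%:R : R) * phi st.1)%:E).
  apply/measurable_EFinP; apply: measurable_funM; first exact: measurable_fun_meets.
  exact: (measurableT_comp mphi).
have mf2 : measurable_fun setT (fun st : T * T => (((meets n st.1 st.2)%:R : R) * phi st.2)%:E).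
  apply/measurable_EFinP; apply: measurable_funM; first exact: measurable_fun_meets.
  exact: (measurableT_comp mphi).
under eq_integral => s _.
  under eq_integral do rewrite mulrDr EFinD.
  rewrite ge0_integralD//; last 4 first.
  - by move=> t _; rewrite lee_fin mulr_ge0.
  - apply/measurable_EFinP; apply: measurable_funM => //; exact: measurable_fun_meets1.
  - by move=> t _; rewrite lee_fin mulr_ge0.
  - apply/measurable_EFinP; apply: measurable_funM => //; exact: measurable_fun_meets1.
  over.
rewrite ge0_integralD//; last 4 first.
- by move=> s _; apply: integral_ge0 => t _; rewrite lee_fin mulr_ge0.
- by apply: (measurable_integral2 mf) => st; rewrite lee_fin mulr_ge0.
- by move=> s _; apply: integral_ge0 => t _; rewrite lee_fin mulr_ge0.
- by apply: (measurable_integral2 mf2) => st; rewrite lee_fin mulr_ge0.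
have -> : 4 * N * N ^- n = 2 * N * N ^- n + 2 * N * N ^- n by ring.
rewrite EFinD ge0_muleDl ?lee_fin ?mulr_ge0 ?invr_ge0 ?exprn_ge0 ?(ltW N_gt0)//.
apply: leeD; first exact: integral_meets1.
have -> : (\int[P]_s \int[P]_t (((meets n s t)%:R : R) * phi t)%:E =
    \int[P]_t \int[P]_s (((meets n s t)%:R : R) * phi t)%:E)%E.
  by apply: (@fubini_tonelli _ _ T T R P P _ mf2) => st; rewrite lee_fin mulr_ge0.
apply: le_trans (integral_meets1 n).
rewrite le_eqVlt; apply/orP; left; apply/eqP.
by apply: eq_integral => s _; apply: eq_integral => t _ /=; rewrite meets_sym.
Qed.

End Phi.

Lemma measurable_kernel (g : T -> R) p n : measurable_fun setT g ->
  measurable_fun setT (fun st : T * T => (((meets n st.1 st.2)%:R : R) * `|g st.1 - g st.2| `^ p)%:E).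
Proof.
move=> mg; apply/measurable_EFinP; apply: measurable_funM; first exact: measurable_fun_meets.
apply: (@measurable_powRB _ _ _ (fun st : T * T => g st.1) (fun st => g st.2)).
  exact: (measurableT_comp mg).
exact: (measurableT_comp mg).
Qed.

Lemma measurable_kernel1 (g : T -> R) p n s : measurable_fun setT g ->
  measurable_fun setT (fun t : T => (((meets n s t)%:R : R) * `|g s - g t| `^ p)%:E).
Proof.
move=> mg; apply/measurable_EFinP; apply: measurable_funM; first exact: measurable_fun_meets1.
by apply: (@measurable_powRB _ _ _ (fun=> g s)).
Qed.

(** [Psi] and [Tn] are the inner and the double integral of D_n before scaling by (N^2 / M)^n. *)
Definition Psi (g : T -> R) p n s : \bar R :=
  (\int[P]_t (((meets n s t)%:R : R) * `|g s - g t| `^ p)%:E)%E.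

Definition Tn (g : T -> R) p n : \bar R := (\int[P]_s Psi g p n s)%E.

Lemma Psi_ge0 g p n s : (0 <= Psi g p n s)%E.
Proof. by apply: integral_ge0 => t _; rewrite lee_fin mulr_ge0// powR_ge0. Qed.

Lemma Tn_ge0 g p n : (0 <= Tn g p n)%E.
Proof. by apply: integral_ge0 => s _; exact: Psi_ge0. Qed.

Lemma measurable_Psi g p n : measurable_fun setT g -> measurable_fun setT (Psi g p n).
Proof.
move=> mg; apply: (measurable_integral2 (measurable_kernel p n mg)) => st.
by rewrite lee_fin mulr_ge0// powR_ge0.
Qed.

Lemma Tn_le_phi (g phi : T -> R) p n : measurable_fun setT g -> measurable_fun setT phi ->
  (forall s, 0 <= phi s) ->
  (forall s t, meets n s t -> `|g s - g t| `^ p <= phi s + phi t) ->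
  (Tn g p n <= (4 * N * N ^- n)%:E * \int[P]_s (phi s)%:E)%E.
Proof.
move=> mg mphi phi0 h; apply: le_trans (integral_meets_sym mphi phi0 n).
have mf : measurable_fun setT (fun st : T * T => (((meets n st.1 st.2)%:R : R) * (phi st.1 + phi st.2))%:E).
  apply/measurable_EFinP; apply: measurable_funM; first exact: measurable_fun_meets.
  by apply: measurable_funD; exact: (measurableT_comp mphi).
apply: ge0_le_integral => //.
- by move=> s _; exact: Psi_ge0.
- exact: measurable_Psi.
- by apply: (measurable_integral2 mf) => st; rewrite lee_fin mulr_ge0 ?addr_ge0.
move=> s _; apply: ge0_le_integral => //.
- exact: measurable_kernel1.
- apply/measurable_EFinP; apply: measurable_funM; first exact: measurable_fun_meets1.
  exact: measurable_funD.
move=> t _; rewrite lee_fin; case: (boolP (meets n s t)) => [/h|_]; last by rewrite !mul0r.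
by rewrite !mul1r.
Qed.

End Bernoulli.

(** * The Poincare inequality *)

Section Poincare.
Context (R : realType) (S : simple_igs) (D : doubling S) (hnd : non_degenerate S).
Context (hcu : conductively_uniform R S) (p : R) (p1 : 1 < p).
Local Notation X := (borel_space R D).
Local Notation limX := (limit_space R D).
Local Notation M := (Mp S p).
Local Notation N := (#|edge S|%:R : R).
Local Notation T := (mseqspace (edge0 D)).
Local Notation P := (bernoulli R D).
Local Notation pre := (@pre S D).
Local Notation meets := (@meets S D).
Local Notation Vn f n := (@Vn R S D p n f).
Local Notation M_gt0 := (Mp_gt0 D p1).
Local Notation N_gt0 := (N_gt0 R D).
Implicit Types (f : X -> R) (s t : T).

Let p0 : 0 < p. Proof. exact: lt_trans p1. Qed.

Lemma powR_path4 (x y z u v : R) : `|x - v| `^ p <=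
  2 `^ p * 2 `^ p * ((`|x - y| `^ p + `|y - z| `^ p) + (`|z - u| `^ p + `|u - v| `^ p)).
Proof.
have h (b d e : R) : `|b - e| `^ p <= 2 `^ p * (`|b - d| `^ p + `|d - e| `^ p).
  by rewrite -[b - e](subrKA d); exact: powRD_le (ltW p0).
apply: le_trans (h _ z _) _; rewrite -mulrA ler_wpM2l ?powR_ge0// mulrDr.
by apply: lerD; exact: h.
Qed.

(** The route is x, V at e^+, V at the common vertex, V at e'^+, y; splitting it twice costs 4^p. *)
Lemma osc_adjacent (G : ograph) (V : vertex G -> R) (e e' : oedge G) b b' (x y : R) :
  oend b e = oend b' e' ->
  `|x - y| `^ p <= 2 `^ p * 2 `^ p *
    ((`|x - V (oend true e)| `^ p + `|V (oend true e) - V (oend false e)| `^ p) +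
     (`|y - V (oend true e')| `^ p + `|V (oend true e') - V (oend false e')| `^ p)).
Proof.
move=> ee; have h (e1 : oedge G) b1 : `|V (oend true e1) - V (oend b1 e1)| `^ p <=
    `|V (oend true e1) - V (oend false e1)| `^ p.
  by apply: norm_powR_le (ltW p0) _; case: b1; rewrite ?subrr ?normr0.
apply: le_trans (powR_path4 _ (V (oend true e)) (V (oend b e)) (V (oend true e')) _) _.
rewrite ler_wpM2l ?mulr_ge0 ?powR_ge0//; apply: lerD; first by rewrite lerD2l.
by rewrite addrC ee distrC (distrC (V _) (V _)) lerD2l.
Qed.

(** Each pair of vertices is joined by a path, which gives a constant for the pair; the finitely
    many constants are summed. *)
Lemma oscillation_generator : exists2 C : R, 0 <= C & forall (W : vertex S -> R) z z',
  `|W z - W z'| `^ p <= C * \sum_(e : edge S) `|W (pole true e) - W (pole false e)| `^ p.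
Proof.
pose V (W : vertex S -> R) := \sum_(e : edge S) `|W (pole true e) - W (pole false e)| `^ p.
have V0 W : 0 <= V W by apply: sumr_ge0 => e _; exact: powR_ge0.
have /choice[C hC] : forall zz : vertex S * vertex S, exists C : R, 0 <= C /\
    forall W, `|W zz.1 - W zz.2| `^ p <= C * V W.
  move=> [z z'] /=.
  pose Q z'' := exists C : R, 0 <= C /\ forall W, `|W z - W z''| `^ p <= C * V W.
  apply: (@connected_G1 S Q _ z); last first.
    by exists 0; split=> // W; rewrite subrr normr0 powR0 ?gt_eqF// mul0r.
  move=> s e [C [C0 hC]]; exists (2 `^ p * (C + 1)); split.
    by rewrite mulr_ge0 ?powR_ge0// addr_ge0.
  move=> W; rewrite -(subrKA (W (pole s e))).
  apply: le_trans (powRD_le _ _ (ltW p0)) _; rewrite -mulrA ler_wpM2l ?powR_ge0// mulrDl mul1r.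
  apply: lerD; first exact: hC.
  have -> : `|W (pole s e) - W (pole (~~ s) e)| = `|W (pole true e) - W (pole false e)|.
    by case: s {hC}; rewrite //= distrC.
  by rewrite /V (bigD1 e) //= lerDl sumr_ge0// => e' _; exact: powR_ge0.
exists (\sum_zz C zz); first by apply: sumr_ge0 => zz _; exact: (hC zz).1.
move=> W z z'; apply: le_trans ((hC (z, z')).2 W) _; apply: ler_wpM2r => //.
by rewrite (bigD1 (z, z')) //= lerDl sumr_ge0// => zz _; exact: (hC zz).1.
Qed.

Lemma Jdens_norm_max (x : symbol S -> R) : exists a, `|\sum_a Jdens p a * x a| <= `|x a|.
Proof.
have [a _ ha] := @arg_maxP _ _ _ (symbol0 S) xpredT (fun a => `|x a|) isT.
by exists a; apply: (Jdens_norm_le D p1) => b; exact: ha.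
Qed.

(** V_n f at an end of e is an average of V_(n+1) f over gate vertices in e, so both values are
    compared inside one copy of the generator. *)
Lemma Vn_step : exists2 C : R, 0 <= C & forall f n (e : edge (Gr S n)) (y : edge S) (s t : bool),
  continuous (f : limX -> R) ->
  `|Vn f n (oend s e) - Vn f n.+1 (@oend (Gr S n.+1) t (e, y))| `^ p <=
  C * \sum_(z : edge S) `|Vn f n.+1 (@oend (Gr S n.+1) true (e, z)) -
                         Vn f n.+1 (@oend (Gr S n.+1) false (e, z))| `^ p.
Proof.
have [C C0 hC] := oscillation_generator; exists C; first exact: C0.
move=> f n e y s t cf.
pose W z : R := Vn f n.+1 (cls z e).
have -> : Vn f n (oend s e) = \sum_a Jdens p a * W (phi s a).
  rewrite (Vn_avg hnd p1 _ cf) /avg; by apply: eq_bigr => a _; rewrite vmulE.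
change (`|\sum_a Jdens p a * W (phi s a) - W (pole t y)| `^ p <=
  C * \sum_z `|W (pole true z) - W (pole false z)| `^ p).
have -> : \sum_a Jdens p a * W (phi s a) - W (pole t y) =
    \sum_a Jdens p a * (W (phi s a) - W (pole t y)).
  rewrite -[in LHS](mul1r (W (pole t y))) -(sum_Jdens D p1) mulr_suml -sumrB.
  by apply: eq_bigr => a _; rewrite mulrBr.
have [a ha] := Jdens_norm_max (fun a => W (phi s a) - W (pole t y)).
by apply: le_trans (hC W (phi s a) (pole t y)); exact: norm_powR_le (ltW p0) ha.
Qed.

Lemma energy_En f n : energy p (Vn f n) = M ^+ n * En p f n.
Proof. by rewrite /En mulVKf// expf_neq0// gt_eqF// M_gt0. Qed.

Let a f n s : R := Vn f n (oend true (pre s n)).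

Let measurable_a f n : measurable_fun setT (a f n).
Proof. exact: (@measurable_fun_pre _ D _ _ n (fun e => Vn f n (oend true e))). Qed.

Let theta : R := M / N.
Let theta0 : 0 < theta. Proof. by rewrite divr_gt0 ?M_gt0 ?N_gt0. Qed.
Let theta1 : theta < 1. Proof. by rewrite ltr_pdivrMr ?N_gt0// mul1r Mp_lt. Qed.

Let a_step : exists2 C : R, 0 <= C & forall f n E, continuous (f : limX -> R) ->
  (forall m, En p f m <= E) ->
  (\int[P]_s (`|a f n.+1 s - a f n s| `^ p)%:E <= (C * theta ^+ n * E)%:E)%E.
Proof.
have [C C0 hC] := Vn_step; exists (C * M); first by rewrite mulr_ge0// ltW// M_gt0.
move=> f n E cf hE.
pose c (e : edge (Gr S n)) := C * \sum_(z : edge S)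
  `|Vn f n.+1 (@oend (Gr S n.+1) true (e, z)) - Vn f n.+1 (@oend (Gr S n.+1) false (e, z))| `^ p.
apply: (@le_trans _ _ (\int[P]_s (c (pre s n))%:E)%E).
  apply: ge0_integral_le.
  - exact: measurable_powRB.
  - exact: (@measurable_fun_pre _ D _ R n c).
  - by move=> s; exact: powR_ge0.
  - by move=> s; rewrite distrC; exact: hC.
rewrite (integral_pre _ c) lee_fin /c -mulr_sumr pair_bigA /=.
have -> : \sum_(q : edge (Gr S n) * edge S) `|Vn f n.+1 (@oend (Gr S n.+1) true (q.1, q.2)) -
    Vn f n.+1 (@oend (Gr S n.+1) false (q.1, q.2))| `^ p = M ^+ n.+1 * En p f n.+1.
  by rewrite -energy_En /energy /=; apply: eq_bigr => -[].
rewrite /theta expr_div_n exprS.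
have -> : N ^- n * (C * (M * M ^+ n * En p f n.+1)) = C * M * (M ^+ n / N ^+ n) * En p f n.+1.
  by ring.
by rewrite ler_wpM2l// !mulr_ge0 ?invr_ge0 ?exprn_ge0// ltW// ?M_gt0 ?N_gt0.
Qed.

(** The geometric series is summed by induction on k, splitting off the first step: the remainder
    gets a factor lam > 1, and lam theta < 1 keeps the constant fixed. *)
Let a_cauchy : exists2 K : R, 0 <= K & forall f k n E, continuous (f : limX -> R) ->
  (forall m, En p f m <= E) ->
  (\int[P]_s (`|a f (n + k) s - a f n s| `^ p)%:E <= (K * theta ^+ n * E)%:E)%E.
Proof.
have [C1 C10 h1] := a_step.
(* Halfway between 1 and 1 / theta. K below is the fixed point of the recursion K = lam theta K + C
   C1. *)
pose lam := (1 + theta^-1) / 2.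
have ti : 1 < theta^-1 by rewrite invf_gt1.
have l1 : 1 < lam by rewrite /lam; lra.
have [C C0 hC] := powRD_le_scale p0 l1.
have lt1 : lam * theta < 1.
  have : theta^-1 * theta = 1 by rewrite mulVf// gt_eqF.
  by rewrite /lam; move: theta1; nra.
pose K := C * C1 / (1 - lam * theta).
have KE : lam * theta * K + C * C1 = K.
  have : K * (1 - lam * theta) = C * C1 by rewrite /K divfK// gt_eqF// subr_gt0.
  by move=> <-; ring.
have K0 : 0 <= K by rewrite /K divr_ge0// ?mulr_ge0// subr_ge0 ltW.
exists K => // f k n E cf hE; have E0 : 0 <= E by apply: le_trans (hE 0%N); exact: En_ge0.
elim: k n => [|k IH] n.
  rewrite addn0; under eq_integral do rewrite subrr normr0 powR0 ?gt_eqF//.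
  by rewrite integral0 lee_fin; apply: mulr_ge0 => //; apply: mulr_ge0 => //; rewrite exprn_ge0// ltW.
rewrite addnS -addSn.
apply: le_trans (_ : (lam%:E * \int[P]_s (`|a f (n.+1 + k) s - a f n.+1 s| `^ p)%:E +
  C%:E * \int[P]_s (`|a f n.+1 s - a f n s| `^ p)%:E <= _)%E).
  apply: ge0_integral_le_comb; try exact: measurable_powRB; try by move=> s; exact: powR_ge0.
  - by rewrite (le_trans _ (ltW l1)).
  - by [].
  - by move=> s; rewrite -(subrKA (a f n.+1 s)); exact: hC.
rewrite -[X in (X * theta ^+ n)%R]KE.
have -> : (lam * theta * K + C * C1) * theta ^+ n * E =
  lam * (K * theta ^+ n.+1 * E) + C * (C1 * theta ^+ n * E) by rewrite exprS; ring.
rewrite EFinD (EFinM lam) (EFinM C); apply: leeD; apply: lee_wpmul2l.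
- by rewrite lee_fin (le_trans _ (ltW l1)).
- exact: IH.
- by rewrite lee_fin.
- exact: h1.
Qed.

Lemma poincare : exists2 K : R, 0 <= K & forall f n E, continuous (f : limX -> R) ->
  (forall m, En p f m <= E) ->
  (\int[P]_s (`|f (chi s) - Vn f n (oend true (pre s n))| `^ p)%:E <= (K * (M / N) ^+ n * E)%:E)%E.
Proof.
have [K K0 hK] := a_cauchy; exists (2 `^ p * K); first by rewrite mulr_ge0// powR_ge0.
move=> f n E cf hE; apply/lee_addgt0Pr => e e0.
have e2 : 0 < e / 2 `^ p by rewrite divr_gt0// powR_gt0.
have [x x0 xe] := small_powR p0 e2.
have [k hk] := Vn_traces hnd p1 cf x0.
have mf : measurable_fun setT (fun s : T => f (chi s)).
  exact: (measurableT_comp (measurable_continuous cf) (measurable_chi hnd)).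
apply: le_trans (_ : ((2 `^ p)%:E * \int[P]_s (`|a f (n + k) s - a f n s| `^ p)%:E +
  (2 `^ p)%:E * \int[P]_s (x `^ p)%:E <= _)%E).
  apply: (@ge0_integral_le_comb _ _ _ _ _ _ (fun=> x `^ p)); try by move=> s; exact: powR_ge0.
  - exact: (measurable_powRB p mf (measurable_a f n)).
  - exact: (measurable_powRB p (measurable_a f (n + k)) (measurable_a f n)).
  - exact: measurable_cst.
  - exact: powR_ge0.
  - exact: powR_ge0.
  move=> s; rewrite -mulrDr -(subrKA (a f (n + k) s)) addrC.
  apply: le_trans (powRD_le _ _ (ltW p0)) _; rewrite ler_wpM2l ?powR_ge0// lerD2l.
  rewrite -(gtr0_norm x0); apply: norm_powR_le (ltW p0) _; rewrite (gtr0_norm x0).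
  by apply: hk; [rewrite leq_addl|exact: oend_ends].
rewrite integral_const1; apply: leeD; last first.
  by rewrite -EFinM lee_fin -ler_pdivlMl ?powR_gt0// mulrC.
by rewrite -!mulrA EFinM; apply: lee_wpmul2l; rewrite ?lee_fin ?powR_ge0// mulrA; exact: hK.
Qed.

(** [osc_adjacent] bounds the kernel by phi s + phi t, with phi made of the Poincare term and the
    gradient of V_n f on the cell; both integrate to order (M / N)^n E. *)
Lemma Tn_le_energy : exists2 K : R, 0 <= K & forall f n E, continuous (f : limX -> R) ->
  (forall m, En p f m <= E) ->
  (Tn (fun s : T => f (chi s)) p n <= (K * (M / N ^+ 2) ^+ n * E)%:E)%E.
Proof.
have [K K0 hK] := poincare.
pose c : R := 2 `^ p * 2 `^ p; have c0 : 0 <= c by rewrite mulr_ge0 ?powR_ge0.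
exists (4 * N * (c * (K + 1))).
  by rewrite !mulr_ge0 ?addr_ge0// ltW// N_gt0.
move=> f n E cf hE.
have := hK f n E cf hE; have := energy_En f n.
move: (Vn f n) => V eV hV.
pose A s := `|f (chi s) - V (oend true (pre s n))| `^ p.
pose B e : R := `|V (oend true e) - V (oend false e)| `^ p.
pose phi s := c * A s + c * B (pre s n).
have mf : measurable_fun setT (fun s : T => f (chi s)).
  exact: (measurableT_comp (measurable_continuous cf) (measurable_chi hnd)).
have mA : measurable_fun setT A.
  apply: measurable_powRB => //.
  exact: (@measurable_fun_pre _ D _ R n (fun e => V (oend true e))).
have mB : measurable_fun setT (fun s : T => B (pre s n)).
  exact: (@measurable_fun_pre _ D _ R n B).
have A0 s : 0 <= A s by exact: powR_ge0.
have B0 s : 0 <= B (pre s n) by exact: powR_ge0.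
have phi0 s : 0 <= phi s by rewrite addr_ge0// mulr_ge0.
have mphi : measurable_fun setT phi.
  by apply: measurable_funD; apply: measurable_funM.
have := @Tn_le_phi R S D (fun s : T => f (chi s)) phi p n mf mphi phi0.
have /[swap]/[apply] h : forall s t, meets n s t -> `|f (chi s) - f (chi t)| `^ p <= phi s + phi t.
  move=> s t /meetP[b [b' st]].
  have := osc_adjacent V (f (chi s)) (f (chi t)) st.
  by rewrite -/c !(mulrDr c).
apply: (le_trans h).
rewrite /phi (ge0_integral_comb _ mA mB)// (integral_pre _ B).
have -> : \sum_(e : edge (Gr S n)) B e = M ^+ n * En p f n by rewrite -eV.
have E0 : 0 <= E by apply: le_trans (hE 0%N); exact: En_ge0.
have h1 : (c%:E * \int[P]_s (A s)%:E +
    c%:E * (N ^- n * (M ^+ n * En p f n))%:E <= (c * ((K + 1) * (M / N) ^+ n * E))%:E)%E.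
  rewrite -mulrA mulrDl mul1r mulrDr EFinD [in leRHS]EFinM; apply: leeD.
    by apply: lee_wpmul2l; rewrite ?lee_fin// mulrA; exact: hV.
  rewrite -EFinM lee_fin ler_wpM2l// expr_div_n mulrA (mulrC _ (M ^+ n)) ler_wpM2l//.
  by rewrite divr_ge0 ?exprn_ge0// ltW// ?M_gt0 ?N_gt0.
have q0 : 0 <= 4 * N * N ^- n by rewrite !mulr_ge0 ?invr_ge0 ?exprn_ge0// ltW// N_gt0.
apply: le_trans (lee_wpmul2l _ h1) _; first by rewrite lee_fin.
rewrite -EFinM lee_fin le_eqVlt; apply/orP; left; apply/eqP.
rewrite !expr_div_n -exprM mulnC exprM expr2 invfM.
by ring.
Qed.

End Poincare.

(** * Extension and discretization *)

Section Extension.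
Context (R : realType) (S : simple_igs) (D : doubling S) (hnd : non_degenerate S).
Context (hcu : conductively_uniform R S) (p : R) (p1 : 1 < p).
Local Notation X := (borel_space R D).
Local Notation limX := (limit_space R D).
Local Notation M := (Mp S p).
Local Notation pre := (@pre S D).
Local Notation meets := (@meets S D).
Implicit Types (s t : Sigma D).
Context (n : nat) (u : vertex (Gr S n) -> R).

Let H m := @extfam S R (Up p) n u m.
Arguments H : clear implicits.
Let aU := (Up_min D p1).1.
Let HS m : (n <= m)%N -> H m.+1 = ext (Up p) (H m).
Proof. exact: (@extfam_extends S R (Up p) n u). Qed.

(** By [Up_eq1] and finiteness, one extension step contracts all gradients by a common factor below
    1. *)
Let maxgrad : exists2 th : R, 0 <= th < 1 & forall e : edge S,
  `|Up p (pole true e) - Up p (pole false e)| <= th.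
Proof.
have [e _ he] := @arg_maxP _ _ _ (edge0 D) xpredT
  (fun e : edge S => `|Up p (pole true e) - Up p (pole false e)| : R) isT.
exists `|Up p (pole true e) - Up p (pole false e)|; last by move=> f; exact: he.
by rewrite normr_ge0 Up_eq1.
Qed.

Let grad m (e : edge (Gr S m)) := `|H m (oend true e) - H m (oend false e)|.

Lemma extension_grad_small (e : R) : 0 < e -> exists k, (n <= k)%N /\
  forall m, (k <= m)%N -> forall g : edge (Gr S m), grad g <= e.
Proof.
have [th /andP[th0 th1] hth] := maxgrad.
pose G0 := \sum_(g : edge (Gr S n)) grad g + 1.
have G00 : 0 < G0 by apply: ltr_wpDl => //; apply: sumr_ge0 => g _; exact: normr_ge0.
have hG j (g : edge (Gr S (j + n))) : grad g <= th ^+ j * G0.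
  elim: j g => [|j IH] g.
    by rewrite mul1r /G0 (bigD1 g) //= -addrA lerDl addr_ge0// sumr_ge0// => ? _; exact: normr_ge0.
  case: g => g f; rewrite /grad HS ?leq_addl// (ext_grad D aU) normrM exprS -mulrA.
  by apply: ler_pM; [exact: normr_ge0|exact: normr_ge0|exact: hth|exact: IH].
move=> e0; have : (fun j => th ^+ j) @ \oo --> (0 : R).
  by apply: cvg_expr; rewrite ger0_norm.
move=> /cvgrPdist_lt /(_ (e / G0) (divr_gt0 e0 G00)) [k _ hk].
exists (k + n)%N; split; first exact: leq_addl.
move=> m km; have nm : (n <= m)%N by apply: leq_trans km; exact: leq_addl.
move: km; rewrite -(subnK nm) leq_add2r => kj g; apply: le_trans (hG _ g) _.
have := hk _ kj; rewrite /= sub0r normrN ger0_norm ?exprn_ge0// ltr_pdivlMr//.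
exact: ltW.
Qed.

Let lo t m := Num.min (H m (oend true (pre t m))) (H m (oend false (pre t m))).
Let hi t m := Num.max (H m (oend true (pre t m))) (H m (oend false (pre t m))).

Let lo_hi t m b : lo t m <= H m (oend b (pre t m)) <= hi t m.
Proof. by rewrite /lo /hi; case: b; rewrite ge_min le_max lexx ?orbT. Qed.

Let nested t m k x y : (n <= m)%N -> (m <= k)%N ->
  (forall b, x <= H m (oend b (pre t m)) <= y) -> forall b, x <= H k (oend b (pre t k)) <= y.
Proof.
move=> nm /subnK <-; elim: (k - m)%N => // j IH h b.
rewrite addSn HS; last by rewrite (leq_trans nm)// leq_addl.
exact: (@ext_itv S D _ R _ aU (H (j + m)%N) (pole b (t (j + m)%N)) (pre t (j + m)%N) _ _ (Up_itv D p1) (IH h)).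
Qed.

(** The values at the two ends of the cell of t span intervals that are nested, by the maximum
    principle, and shrink to a point as the level grows; the supremum of their lower ends is that
    point. *)
Let hs t := sup [set lo t m | m in [set m | (n <= m)%N]].

Let hs_itv t m x y : (n <= m)%N -> (forall b, x <= H m (oend b (pre t m)) <= y) ->
  x <= hs t <= y.
Proof.
move=> nm hm.
have ub k : (n <= k)%N -> lo t k <= y.
  move=> nk; have [km|mk] := leqP k m.
    have h b : lo t k <= H k (oend b (pre t k)) <= hi t k by exact: lo_hi.
    have /andP[h1 _] := nested nk km h true.
    by apply: le_trans h1 _; have /andP[] := hm true.
  have /andP[_] := nested nm (ltnW mk) hm true.
  by apply: le_trans; have /andP[] := lo_hi t k true.
apply/andP; split; last first.
  by apply: ge_sup; [exists (lo t n); exists n => /=|move=> _ [k nk <-]; exact: ub].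
apply: (@le_trans _ _ (lo t m)).
  by rewrite /lo le_min; have /andP[-> _] := hm true; have /andP[-> _] := hm false.
apply: ub_le_sup; last by exists m.
by exists y => _ [k nk <-]; exact: ub.
Qed.

Let hs_dist t m v : (n <= m)%N -> v \in ends (pre t m) -> `|hs t - H m v| <= grad (pre t m).
Proof.
move=> nm /mem_endsP[b ->]; have /andP[h1 h2] := hs_itv nm (lo_hi t m).
have /andP[l1 l2] := lo_hi t m b.
apply: (@le_trans _ _ (hi t m - lo t m)); first by rewrite ler_norml; apply/andP; split; lra.
rewrite /hi /lo /grad; set x := H m _; set y := H m _.
by case: (leP x y) => xy; [rewrite distrC ger0_norm ?subr_ge0//|rewrite ger0_norm// subr_ge0 ltW].
Qed.

Let hs_meets e : 0 < e -> exists k, forall s t, meets k s t -> `|hs s - hs t| <= e.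
Proof.
move=> e0; have e2 : 0 < e / 2 by rewrite divr_gt0.
have [k [nk hk]] := extension_grad_small e2; exists k => s t /finset.set0Pn[v].
rewrite finset.inE => /andP[vs vt]; apply: le_trans (ler_distD (H k v) _ _) _.
rewrite [leRHS]splitr; apply: lerD.
  by apply: le_trans (hs_dist nk vs) _; exact: hk.
by rewrite distrC; apply: le_trans (hs_dist nk vt) _; exact: hk.
Qed.

Let h : X -> R := fun x => hs (rep x).

Let h_chi t : h (chi t) = hs t.
Proof.
apply/eqP; rewrite -subr_eq0 -normr_le0; apply/ler_addgt0Pl => e e0; rewrite addr0.
by have [k hk] := hs_meets e0; apply: hk; exact: (rep_chi t k).
Qed.

Let h_continuous : continuous (h : limX -> R).
Proof.
apply: (continuous_of_chi hnd) => s e e0; have e2 : 0 < e / 2 by rewrite divr_gt0.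
have [k hk] := hs_meets e2; exists k => t st; rewrite !h_chi distrC.
by apply: le_lt_trans (hk _ _ st) _; rewrite ltr_pdivrMr// ltr_pMr// ltr1n.
Qed.

Let H_traces : traces h H.
Proof.
move=> e e0; have [k [nk hk]] := extension_grad_small e0; exists k => m km s w ws.
by rewrite h_chi; apply: le_trans (hs_dist (leq_trans nk km) ws) _; exact: hk.
Qed.

Let H_harmonic : harmonic D p n H.
Proof.
move=> m nm v; have [b [e ->]] := oend_surj D v; rewrite /avg HS//.
rewrite (eq_bigr (fun a => Jdens p a * H m (oend b e))).
  by rewrite -mulr_suml (sum_Jdens D p1) mul1r.
by move=> a _; rewrite vmulE /cls (ext_phi D aU).
Qed.

(** From level n on [En] of h is constant, as each extension multiplies the energy by exactly M. The
    last clause is the maximum principle in the limit. *)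
Lemma extension_exists : exists g : X -> R,
  [/\ Cp p g, fine (Ecal p g) <= M ^- n * energy p u
    & forall t x y, (forall b, x <= u (oend b (pre t n)) <= y) -> x <= g (chi t) <= y].
Proof.
have En_h m : (n <= m)%N -> En p h m = M ^- n * energy p u.
  move=> nm; have M0 := Mp_gt0 D p1.
  rewrite /En (_ : @Vn R S D p m h = H m); last first.
    by apply/funext => v; exact: (Vn_eq hnd p1 v h_continuous H_harmonic H_traces nm).
  rewrite -(subnK nm); elim: (m - n)%N => [|k IH].
    by rewrite add0n /H extfam_start.
  rewrite addSn HS ?leq_addl// (energy_ext D aU) -/M exprS invfM -IH.
  by rewrite (mulrC M^-1) -mulrA mulKf// gt_eqF.
have [Ch hE] : Cp p h /\ fine (Ecal p h) <= M ^- n * energy p u.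
  by apply: (Cp_le hnd hcu p1 h_continuous (n0 := n)) => m /En_h ->.
exists h; split=> // t x y hxy; rewrite h_chi; apply: (hs_itv (leqnn n)).
by rewrite /H extfam_start.
Qed.

End Extension.

Section Discretization.
Context (R : realType) (S : simple_igs) (D : doubling S) (p : R) (p1 : 1 < p).
Local Notation N := (#|edge S|%:R : R).
Local Notation T := (mseqspace (edge0 D)).
Local Notation P := (bernoulli R D).
Local Notation pre := (@pre S D).
Local Notation meets := (@meets S D).
Local Notation N_gt0 := (N_gt0 R D).
Implicit Types (s t : T) (g : T -> R).

Let p0 : 0 < p. Proof. exact: lt_trans p1. Qed.

Lemma sum_le_integral n (psi : T -> \bar R) (c : edge (Gr S n) -> R) :
  measurable_fun setT psi -> (forall e, 0 <= c e) ->
  (forall s, (c (pre s n))%:E <= psi s)%E ->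
  ((N ^- n * \sum_e c e)%:E <= \int[P]_s psi s)%E.
Proof.
move=> mpsi c0 h; rewrite -(integral_pre D c).
apply: ge0_le_integral => //.
- by move=> s _; rewrite lee_fin.
- by apply/measurable_EFinP; exact: measurable_fun_pre.
Qed.

(** The integral of psi is at least N^-n times the sum of its infima over the cells; points are
    chosen where psi is near these infima. *)
Lemma near_minimal_points n (psi : T -> \bar R) eta : measurable_fun setT psi ->
  (forall s, 0 <= psi s)%E -> (\int[P]_s psi s < +oo)%E -> 0 < eta ->
  exists w : edge (Gr S n) -> T, (forall e, pre (w e) n = e) /\
    (\sum_e psi (w e) <= (N ^+ n * fine (\int[P]_s psi s) + eta)%:E)%E.
Proof.
move=> mpsi psi0 fin eta0.
pose b (e : edge (Gr S n)) := ereal_inf [set psi s | s in [set s | pre s n = e]].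
have b0 e : (0 <= b e)%E by apply: le_ereal_inf_tmp => _ [s _ <-].
have bs s : (b (pre s n) <= psi s)%E by apply: ereal_inf_lbound; exists s.
have Nn : 0 < N ^+ n by rewrite exprn_gt0// N_gt0.
have intf : (\int[P]_s psi s)%E \is a fin_num by rewrite ge0_fin_numE// integral_ge0.
have bfin e : b e \is a fin_num.
  rewrite ge0_fin_numE//; rewrite ltNge; apply/negP; rewrite leye_eq => /eqP be.
  (* With this K, an infinite infimum on one cell would make the integral at least itself plus 1. *)
  pose K := N ^+ n * (fine (\int[P]_s psi s) + 1).
  have K0 : 0 <= K by rewrite mulr_ge0 ?(ltW Nn)// addr_ge0// fine_ge0// integral_ge0.
  have := @sum_le_integral n psi (fun e' => if e' == e then K else 0) mpsi.
  rewrite -big_mkcond big_pred1_eq => /(_ _ _)/wrap[].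
    by move=> e'; case: ifP.
  by move=> s; case: eqP => [se|//]; apply: le_trans (bs s); rewrite se be leey.
  rewrite -(fineK intf) lee_fin /K mulKf ?gt_eqF// => /le_lt_trans/(_ (ltr_pwDr ltr01 (lexx _))).
  by rewrite ltxx.
have n0 : 0 < #|edge (Gr S n)|%:R :> R.
  by rewrite ltr0n; apply/card_gt0P; exists (pre point n).
have /choice[w hw] : forall e : edge (Gr S n), exists s : T, pre s n = e /\
    (psi s <= (fine (b e) + eta / #|edge (Gr S n)|%:R)%:E)%E.
  move=> e; have e0 : 0 < eta / #|edge (Gr S n)|%:R by rewrite divr_gt0.
  have [_ [s se <-] hs] := lb_ereal_inf_adherent e0 (bfin e).
  by exists s; split=> //; rewrite EFinD fineK//; exact: ltW.
exists w; split=> [e|]; first exact: (hw e).1.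
apply: (@le_trans _ _ (\sum_e (fine (b e) + eta / #|edge (Gr S n)|%:R)%:E)%E).
  by apply: lee_sum => e _; exact: (hw e).2.
rewrite sumEFin lee_fin big_split /= lerD//.
  rewrite -ler_pdivrMl// -lee_fin fineK//; apply: sum_le_integral => //.
    by move=> e; rewrite fine_ge0.
  by move=> s; rewrite fineK.
by rewrite sumr_const -[X in X <= _]mulr_natr divfK// gt_eqF.
Qed.

(** If v is an end of the cell of t, the cell chosen for v meets it, so |u(v) - g t|^p is one term
    of the sum of the kernels over all chosen points. The energy follows by comparing both ends of
    an edge with g t. *)
Lemma discretize n g eta : measurable_fun setT g -> (Tn g p n < +oo)%E -> 0 < eta ->
  let Z := N ^+ n * fine (Tn g p n) + eta in
  exists u : vertex (Gr S n) -> R,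
  [/\ energy p u <= 2 `^ p * 2 * N ^+ n * Z,
      forall b, (\int[P]_t (`|u (oend b (pre t n)) - g t| `^ p)%:E <= Z%:E)%E
    & forall v, exists t, v \in ends (pre t n) /\ u v = g t].
Proof.
move=> mg fin eta0 Z.
have [w [we hw]] := near_minimal_points n (measurable_Psi p n mg) (Psi_ge0 g p n) fin eta0.
have /choice[ed hed] : forall v : vertex (Gr S n), exists e : edge (Gr S n), v \in ends e.
  by move=> v; have [b [e ->]] := oend_surj D v; exists e; exact: oend_ends.
pose u v := g (w (ed v)).
have mu b : measurable_fun setT (fun t : T => u (oend b (pre t n))).
  exact: (@measurable_fun_pre _ D _ R n (fun e => u (oend b e))).
have hZ b : (\int[P]_t (`|u (oend b (pre t n)) - g t| `^ p)%:E <= Z%:E)%E.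
  apply: le_trans hw; rewrite /Psi.
  rewrite -ge0_integral_sum//; last first.
    by move=> e; exact: measurable_kernel1.
  apply: ge0_le_integral => //.
  - by apply/measurable_EFinP; exact: measurable_powRB.
  - by apply: emeasurable_sum => e; exact: measurable_kernel1.
  move=> t _; rewrite sumEFin lee_fin (bigD1 (ed (oend b (pre t n)))) //=.
  have -> : meets n (w (ed (oend b (pre t n)))) t.
    rewrite /meets we; apply/finset.set0Pn; exists (oend b (pre t n)).
    by rewrite finset.inE hed oend_ends.
  by rewrite mul1r lerDl sumr_ge0// => e _; rewrite mulr_ge0// powR_ge0.
exists u; split=> //; last by move=> v; exists (w (ed v)); rewrite we.
have Nn : 0 < N ^+ n by rewrite exprn_gt0// N_gt0.
rewrite mulrAC -ler_pdivrMr// mulrC -lee_fin /energy -(integral_pre D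
  (fun e => `|u (oend true e) - u (oend false e)| `^ p)).
apply: le_trans (_ : ((2 `^ p)%:E * \int[P]_t (`|u (oend true (pre t n)) - g t| `^ p)%:E +
  (2 `^ p)%:E * \int[P]_t (`|u (oend false (pre t n)) - g t| `^ p)%:E <= _)%E).
  apply: ge0_integral_le_comb; try exact: measurable_powRB; rewrite ?powR_ge0//.
  move=> t; rewrite -mulrDr -(subrKA (g t)) (distrC (u (oend false _))).
  exact: powRD_le (ltW p0).
rewrite -mulrA mulrDl mul1r mulrDr EFinD; apply: leeD; rewrite EFinM lee_wpmul2l// lee_fin powR_ge0.
Qed.

End Discretization.

Lemma norm_powR_hull (R : realType) (p a b h x : R) : 0 < p ->
  Num.min a b <= h <= Num.max a b -> `|h - x| `^ p <= `|a - x| `^ p + `|b - x| `^ p.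
Proof.
move=> p0 /andP[h1 h2].
have [hh|hh] : `|h - x| <= `|a - x| \/ `|h - x| <= `|b - x|.
  apply/orP; rewrite -le_max; move: h1 h2.
  by case: (leP a b) => ab; rewrite le_max !ler_norml; case: (lerP a x) => ax; case: (lerP b x); lra.
- by apply: le_trans (norm_powR_le (ltW p0) hh) _; rewrite lerDl powR_ge0.
- by apply: le_trans (norm_powR_le (ltW p0) hh) _; rewrite lerDr powR_ge0.
Qed.

(** * Approximation in L^p by functions of finite energy *)

Section Approximation.
Context (R : realType) (S : simple_igs) (D : doubling S) (hnd : non_degenerate S).
Context (hcu : conductively_uniform R S) (p : R) (p1 : 1 < p).
Local Notation X := (borel_space R D).
Local Notation limX := (limit_space R D).
Local Notation M := (Mp S p).
Local Notation N := (#|edge S|%:R : R).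
Local Notation T := (mseqspace (edge0 D)).
Local Notation P := (bernoulli R D).
Local Notation mu := (@mu R S D).
Local Notation pre := (@pre S D).
Local Notation meets := (@meets S D).
Local Notation N_gt0 := (N_gt0 R D).
Local Notation M_gt0 := (Mp_gt0 D p1).
Implicit Types (f g h u v w : X -> R) (s t : T).

Let p0 : 0 < p. Proof. exact: lt_trans p1. Qed.

Definition lift f : T -> R := fun s => f (chi s).

Lemma measurable_lift f : measurable_fun setT f -> measurable_fun setT (lift f).
Proof. by move=> mf; exact: (measurableT_comp mf (measurable_chi hnd)). Qed.

Lemma ge0_integral_mu (F : X -> \bar R) A : measurable A -> measurable_fun A F ->
  (forall x, 0 <= F x)%E ->
  (\int[mu]_(x in A) F x = \int[P]_(s in (fun s : T => chi s : X) @^-1` A) F (chi s))%E.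
Proof.
move=> mA mF F0.
by rewrite /Defs.mu (ge0_integral_pushforward (measurable_chi hnd)).
Qed.

Definition dist_p f g : \bar R := (\int[P]_s (`|lift f s - lift g s| `^ p)%:E)%E.

Lemma dist_p_ge0 f g : (0 <= dist_p f g)%E.
Proof. by apply: integral_ge0 => s _; rewrite lee_fin powR_ge0. Qed.

Lemma dist_pE f g : measurable_fun setT f -> measurable_fun setT g ->
  (\int[mu]_x (`|f x - g x| `^ p)%:E = dist_p f g)%E.
Proof.
move=> mf mg; rewrite ge0_integral_mu ?preimage_setT//.
by apply/measurable_EFinP; exact: measurable_powRB.
Qed.

Lemma dist_p_fin f g : Lp p f -> Lp p g -> (dist_p f g < +oo)%E.
Proof.
move=> [mf If] [mg Ig].
have mZ h : measurable_fun setT h -> measurable_fun setT (fun x => `|h x| `^ p).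
  by move=> mh; apply: (measurableT_comp (measurable_powR p)); exact: measurableT_comp.
have I h : measurable_fun setT h -> (\int[mu]_x (`|h x| `^ p)%:E = \int[P]_s (`|lift h s| `^ p)%:E)%E.
  move=> mh; rewrite ge0_integral_mu ?preimage_setT//.
  by apply/measurable_EFinP; exact: mZ.
rewrite (I _ mf) in If; rewrite (I _ mg) in Ig.
have mL h : measurable_fun setT h -> measurable_fun setT (fun s => `|lift h s| `^ p).
  by move=> mh; apply: (measurableT_comp (measurable_powR p)); apply: measurableT_comp => //; exact: measurable_lift.
apply: le_lt_trans (_ : ((2 `^ p)%:E * \int[P]_s (`|lift f s| `^ p)%:E +
   (2 `^ p)%:E * \int[P]_s (`|lift g s| `^ p)%:E < +oo)%E).
  apply: ge0_integral_le_comb; rewrite ?powR_ge0//; try exact: mL.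
    by apply: measurable_powRB; exact: measurable_lift.
  by move=> s; rewrite -mulrDr; exact: powRB_le (ltW p0).
by apply: lte_add_pinfty; apply: lte_mul_pinfty => //; rewrite lee_fin powR_ge0.
Qed.

Lemma dist_p_le_comb f g h u v w a b : 0 <= a -> 0 <= b ->
  measurable_fun setT f -> measurable_fun setT g -> measurable_fun setT h ->
  measurable_fun setT u -> measurable_fun setT v -> measurable_fun setT w ->
  (forall z, `|f z - g z| `^ p <= a * `|h z - u z| `^ p + b * `|v z - w z| `^ p) ->
  (dist_p f g <= a%:E * dist_p h u + b%:E * dist_p v w)%E.
Proof.
move=> a0 b0 mf mg mh mu' mv mw hle.
apply: ge0_integral_le_comb => //; try by apply: measurable_powRB; exact: measurable_lift.
by move=> s; exact: hle.
Qed.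

Lemma continuous_Lp f : continuous (f : limX -> R) -> Lp p f.
Proof.
move=> cf; have mf := measurable_continuous cf; split=> //.
have [B fB] := continuous_bounded hnd cf.
have m1 : measurable_fun setT (fun x : X => `|f x| `^ p).
  by apply: (measurableT_comp (measurable_powR p)); exact: measurableT_comp.
rewrite ge0_integral_mu ?preimage_setT//; last exact/measurable_EFinP.
apply: (@le_lt_trans _ _ (\int[P]_s (`|B| `^ p)%:E)%E); last first.
  by rewrite integral_const1 ltry.
apply: ge0_integral_le => //.
- exact: (measurable_lift m1).
- move=> s; apply: norm_powR_le (ltW p0) _; apply: le_trans (fB _) _; exact: ler_norm.
Qed.

Lemma Tn_le_comb n g h u a b : 0 <= a -> 0 <= b ->
  measurable_fun setT g -> measurable_fun setT h -> measurable_fun setT u ->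
  (forall x y, `|g x - g y| `^ p <= a * `|h x - h y| `^ p + b * `|u x - u y| `^ p) ->
  (Tn (lift g) p n <= a%:E * Tn (lift h) p n + b%:E * Tn (lift u) p n)%E.
Proof.
move=> a0 b0 mg mh mu' hle.
have [mg' mh' mu''] := And3 (measurable_lift mg) (measurable_lift mh) (measurable_lift mu').
rewrite /Tn -!ge0_integralZl_EFin//; try exact: measurable_Psi; try by move=> s _; exact: Psi_ge0.
rewrite -ge0_integralD//; last 4 first.
- by move=> s _; apply: mule_ge0; [rewrite lee_fin|exact: Psi_ge0].
- by apply: measurable_funeM; exact: measurable_Psi.
- by move=> s _; apply: mule_ge0; [rewrite lee_fin|exact: Psi_ge0].
- by apply: measurable_funeM; exact: measurable_Psi.
apply: ge0_le_integral => //.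
- by move=> s _; exact: Psi_ge0.
- exact: measurable_Psi.
- by apply: emeasurable_funD; apply: measurable_funeM; exact: measurable_Psi.
move=> s _; apply: ge0_integral_le_comb => //; try by apply/measurable_EFinP; exact: measurable_kernel1.
move=> t; case: meets; rewrite ?mul0r ?mulr0 ?addr0// !mul1r; exact: hle.
Qed.

(** Continuity of D_n in L^p at a fixed level; after scaling, the constant grows like (N / M)^n. *)
Lemma Tn_le_dist n f g : measurable_fun setT f -> measurable_fun setT g ->
  (Tn (lift (fun x => (f x - g x)%R)) p n <= (2 `^ p * (4 * N * N ^- n))%:E * dist_p f g)%E.
Proof.
move=> mf mg.
have mfg : measurable_fun setT (lift (fun x => (f x - g x)%R)).
  by apply: measurable_lift; exact: measurable_funB.
have mphi : measurable_fun setT (fun s => `|lift f s - lift g s| `^ p).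
  by apply: measurable_powRB; exact: measurable_lift.
rewrite mulrC EFinM -muleA /dist_p -ge0_integralZl_EFin ?powR_ge0//; last first.
  exact/measurable_EFinP.
under eq_integral do rewrite -EFinM.
apply: Tn_le_phi => //.
- exact: measurable_funM.
- by move=> s t _; rewrite -mulrDr; exact: powRB_le (ltW p0).
Qed.

Lemma Tn_fin n f : Lp p f -> Tn (lift f) p n \is a fin_num.
Proof.
move=> Lf; rewrite ge0_fin_numE ?Tn_ge0//.
have L0 : Lp p (fun _ : X => 0 : R) by apply: continuous_Lp; exact: cst_continuous.
have -> : f = (fun x => f x - 0) by apply/funext => x; rewrite subr0.
apply: le_lt_trans (Tn_le_dist n Lf.1 L0.1) _; apply: lte_mul_pinfty => //.
exact: dist_p_fin.
Qed.

Local Notation scale n := ((N ^+ 2 / M) ^+ n).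
Lemma scale_gt0 n : 0 < scale n.
Proof. by rewrite exprn_gt0// divr_gt0 ?M_gt0// exprn_gt0// N_gt0. Qed.

Definition Dn f n : R := scale n * fine (Tn (lift f) p n).

Lemma Dn_ge0 f n : 0 <= Dn f n.
Proof. by rewrite mulr_ge0 ?(ltW (scale_gt0 _))// fine_ge0// Tn_ge0. Qed.

Lemma Dn_le_comb n g h u a b : 0 <= a -> 0 <= b -> Lp p g -> Lp p h -> Lp p u ->
  (forall x y, `|g x - g y| `^ p <= a * `|h x - h y| `^ p + b * `|u x - u y| `^ p) ->
  Dn g n <= a * Dn h n + b * Dn u n.
Proof.
move=> a0 b0 Lg Lh Lu hle; rewrite /Dn mulrCA [b * _]mulrCA -mulrDr ler_wpM2l ?(ltW (scale_gt0 _))//.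
have := Tn_le_comb n a0 b0 Lg.1 Lh.1 Lu.1 hle.
rewrite -(fineK (Tn_fin n Lg)) -(fineK (Tn_fin n Lh)) -(fineK (Tn_fin n Lu)).
by rewrite -!EFinM -EFinD lee_fin.
Qed.

Local Notation Er f := (fine (Ecal p f)).

Lemma Cp_Lp f : Cp p f -> Lp p f. Proof. by move=> [cf _]; exact: continuous_Lp. Qed.

Lemma Er_ge0 f : Cp p f -> 0 <= Er f.
Proof. by move=> [cf _]; apply: fine_ge0; exact: (Ecal_ge0 hnd hcu p1 cf). Qed.

Lemma Dn_le_energy : exists2 K : R, 0 <= K & forall f n, Cp p f -> Dn f n <= K * Er f.
Proof.
have [K K0 hK] := Tn_le_energy D hnd p1; exists K; first exact: K0.
move=> f n Cf.
have := hK f n (Er f) Cf.1 (fun m => Cp_En_le hnd hcu p1 m Cf).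
rewrite -/(lift f) -[Tn _ _ _]fineK ?Tn_fin//; last exact: Cp_Lp.
rewrite lee_fin /Dn -ler_pdivlMl ?scale_gt0//.
rewrite (_ : (scale n)^-1 = (M / N ^+ 2) ^+ n); last by rewrite -exprVn invf_div.
by move=> /le_trans; apply; rewrite le_eqVlt; apply/orP; left; apply/eqP; ring.
Qed.

(** The last clause, uniform closeness, is the maximum principle once more: the vertex values around
    s are values of f at points meeting s at level n. *)
Lemma approximant : exists2 C : R, 0 < C & forall f n eta, Lp p f -> 0 < eta ->
  exists h, [/\ Cp p h, Er h <= C * (Dn f n + eta),
    (dist_p h f <= (C * (M / N) ^+ n * (Dn f n + eta))%:E)%E
    & forall d, (forall s t, meets n s t -> `|lift f s - lift f t| <= d) ->
      forall s, `|lift h s - lift f s| <= d].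
Proof.
have P0 : 0 < 2 `^ p :> R by rewrite powR_gt0.
exists (2 `^ p * 2 + 2); first by rewrite addr_gt0// mulr_gt0.
move=> f n eta Lf eta0; have MN : 0 < (M / N) ^+ n by rewrite exprn_gt0// divr_gt0 ?M_gt0 ?N_gt0.
(* The slack is scaled so that the bound of [discretize] becomes (M / N)^n (D_n f + eta). *)
have e0 : 0 < (M / N) ^+ n * eta by rewrite mulr_gt0.
have fT : (Tn (lift f) p n < +oo)%E by rewrite -(fineK (Tn_fin n Lf)) ltry.
have [u [u1 u2 u3]] := discretize p1 (measurable_lift Lf.1) fT e0.
have [h [Ch hE hh]] := extension_exists D hnd hcu p1 u.
have ZE : N ^+ n * fine (Tn (lift f) p n) + (M / N) ^+ n * eta = (M / N) ^+ n * (Dn f n + eta).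
  rewrite mulrDr; congr (_ + _); rewrite /Dn mulrA -exprMn; congr (_ ^+ _ * _).
  by field; rewrite !gt_eqF ?M_gt0 ?N_gt0.
rewrite {}ZE in u1 u2.
have De0 : 0 <= Dn f n + eta by rewrite addr_ge0 ?Dn_ge0 ?ltW.
have mh := measurable_lift (measurable_continuous Ch.1).
have mf := measurable_lift Lf.1.
have mub b : measurable_fun setT (fun t : T => u (oend b (pre t n))).
  exact: (@measurable_fun_pre _ D _ R n (fun e => u (oend b e))).
exists h; split=> //.
- apply: le_trans hE _; rewrite mulrC ler_pdivrMr ?exprn_gt0 ?M_gt0//.
  apply: le_trans u1 _; rewrite expr_div_n.
  have Nn : N ^+ n != 0 by rewrite expf_neq0// gt_eqF// N_gt0.
  have -> : 2 `^ p * 2 * N ^+ n * (M ^+ n / N ^+ n * (Dn f n + eta)) =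
    2 `^ p * 2 * (Dn f n + eta) * M ^+ n by field.
  rewrite ler_wpM2r ?exprn_ge0 ?(ltW M_gt0)// ler_wpM2r// lerDl//.
- apply: le_trans (_ : (1%:E * \int[P]_t (`|u (oend true (pre t n)) - lift f t| `^ p)%:E +
    1%:E * \int[P]_t (`|u (oend false (pre t n)) - lift f t| `^ p)%:E <= _)%E).
    apply: ge0_integral_le_comb => //; try exact: measurable_powRB.
    move=> t; rewrite !mul1r; apply: (norm_powR_hull _ p0); apply: hh => b.
    by case: b; rewrite ge_min le_max lexx ?orbT.
  rewrite !mul1e; apply: le_trans (leeD (u2 true) (u2 false)) _; rewrite -EFinD lee_fin.
  rewrite -mulrA; have : 0 <= (M / N) ^+ n * (Dn f n + eta) by rewrite mulr_ge0// ltW.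
  move: (_ * (Dn f n + eta)) => q q0; have := mulr_ge0 (ltW P0) q0.
  by move: (2 `^ p) => x xq; rewrite mulrDl; lra.
- move=> d hd s; rewrite ler_distl; apply: hh => b; rewrite -ler_distl.
  have [t [ts ->]] := u3 (oend b (pre s n)); apply: hd.
  by apply/finset.set0Pn; exists (oend b (pre s n)); rewrite finset.inE ts oend_ends.
Qed.

Lemma Vn_dist f h d n (v : vertex (Gr S n)) : continuous (f : limX -> R) ->
  continuous (h : limX -> R) -> (forall s, `|lift h s - lift f s| <= d) ->
  `|Vn p h v - Vn p f v| <= d.
Proof.
move=> cf ch hd; have cl : continuous ((fun x => 1 * h x + -1 * f x) : limX -> R).
  exact: continuous_lin.
have -> : Vn p h v - Vn p f v = Vn p (fun x => 1 * h x + -1 * f x) v.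
  by rewrite (Vn_lin hnd p1)// mul1r mulN1r.
rewrite -[X in `|X|]subr0.
apply: (@Vn_approx _ _ _ hnd _ p1 _ (fun _ _ => 0) n 0) => // s w _.
by rewrite subr0 mul1r mulN1r; exact: hd.
Qed.

Lemma En_uniform f n eta : continuous (f : limX -> R) -> 0 < eta -> exists2 d, 0 < d &
  forall h, continuous (h : limX -> R) -> (forall s, `|lift h s - lift f s| <= d) ->
    En p f n <= 2 `^ p * En p h n + eta.
Proof.
move=> cf eta0.
pose c := M ^- n * #|edge (Gr S n)|%:R * (2 `^ p * 2 `^ p) + 1.
have c0 : 0 < c.
  by rewrite ltr_wpDl// !mulr_ge0 ?powR_ge0// invr_ge0 exprn_ge0// ltW// M_gt0.
have [d d0 dE] := small_powR p0 (divr_gt0 eta0 c0); exists d => // h ch hd.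
have M0 : 0 <= M ^- n by rewrite invr_ge0 exprn_ge0// ltW// M_gt0.
have hV (v : vertex (Gr S n)) := Vn_dist v cf ch hd.
rewrite /En; move: (@Vn _ _ _ p n f) (@Vn _ _ _ p n h) hV => V W hV.
have -> : 2 `^ p * (M ^- n * energy p W) + eta = M ^- n * (2 `^ p * energy p W) + eta by ring.
apply: (@le_trans _ _ (M ^- n * (2 `^ p * energy p W + #|edge (Gr S n)|%:R * (2 `^ p * 2 `^ p * d `^ p)))).
  rewrite ler_wpM2l// /energy mulr_sumr.
  have -> : #|edge (Gr S n)|%:R * (2 `^ p * 2 `^ p * d `^ p) =
      \sum_(e : oedge (Gr S n)) (2 `^ p * 2 `^ p * d `^ p : R) by rewrite sumr_const mulr_natl.
  rewrite -big_split /=; apply: ler_sum => e _.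
  have -> : V (oend true e) - V (oend false e) = (W (oend true e) - W (oend false e)) +
    ((W (oend false e) - V (oend false e)) - (W (oend true e) - V (oend true e))) by ring.
  apply: le_trans (powRD_le _ _ (ltW p0)) _; rewrite mulrDr lerD2l -mulrA ler_wpM2l ?powR_ge0//.
  rewrite -powRM ?(ltW d0)//; apply: ge0_ler_powR; rewrite ?nnegrE ?mulr_ge0 ?(ltW d0) ?(ltW p0)//.
  apply: le_trans (ler_normB _ _) _.
  by have := hV (oend true e); have := hV (oend false e); lra.
rewrite mulrDr lerD2l.
have -> : M ^- n * (#|edge (Gr S n)|%:R * (2 `^ p * 2 `^ p * d `^ p)) = (c - 1) * d `^ p.
  by rewrite /c addrK; ring.
apply: (@le_trans _ _ (c * d `^ p)); first by rewrite ler_wpM2r ?powR_ge0// gerBl.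
by rewrite mulrC -ler_pdivlMr.
Qed.

(** E_m f for one fixed m nearly exhausts E(f). Approximants h from deep levels n are uniformly
    close to f, so up to small errors E_m f <= 2^p E_m h <= 2^p E(h), and E(h) is controlled by D_n
    f. *)
Lemma energy_le_Dn : exists2 C : R, 0 < C & forall f eta, Cp p f -> 0 < eta ->
  exists n0, forall n, (n0 <= n)%N -> Er f <= C * Dn f n + eta.
Proof.
have [C C0 hC] := approximant; exists (2 `^ p * C); first by rewrite mulr_gt0// powR_gt0.
move=> f eta Cf eta0; have cf := Cf.1.
have P0 : 0 < 2 `^ p :> R by rewrite powR_gt0.
have e3 : 0 < eta / 3 by rewrite divr_gt0.
have [m hm] : exists m, Er f <= En p f m + eta / 3.
  apply: contrapT => /forallNP h.
  have : Er f <= Er f - eta / 3.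
    have h' m : (0 <= m)%N -> En p f m <= Er f - eta / 3.
      by have /negP := h m; rewrite -ltNge => /ltW; rewrite lerBrDr.
    exact: (Cp_le hnd hcu p1 cf h').2.
  by rewrite lerBrDr gerDl leNgt e3.
have [d d0 hd] := En_uniform m cf e3.
have [k hk] := uniform_continuous_chi hnd cf d0.
exists k => n kn.
have e4 : 0 < eta / 3 / (2 `^ p * C) by rewrite divr_gt0// mulr_gt0.
have [h [Ch hE _ hf]] := hC f n _ (Cp_Lp Cf) e4.
have hfd : forall s, `|lift h s - lift f s| <= d.
  by apply: hf => s t st; apply/ltW/hk; exact: (meets_le kn st).
apply: le_trans hm _; apply: le_trans (lerD (hd h Ch.1 hfd) (lexx _)) _.
have := Cp_En_le hnd hcu p1 m Ch => /le_trans/(_ hE) hE'.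
have : 2 `^ p * En p h m <= 2 `^ p * (C * (Dn f n + eta / 3 / (2 `^ p * C))).
  by rewrite ler_wpM2l// ltW.
have -> : 2 `^ p * (C * (Dn f n + eta / 3 / (2 `^ p * C))) = 2 `^ p * C * Dn f n + eta / 3.
  by field; rewrite !gt_eqF.
by lra.
Qed.

End Approximation.

(** * The closed energy *)

Section Arithmetic.
Context (R : realType).
Implicit Types a b c d e m x y z w : R.

(** This and the next four lemmas carry the real arithmetic of the epsilon arguments below, for
    abstract numbers. *)
Lemma parallelogram_slack c d e a b m x y z w : 0 <= e -> 0 <= c -> 0 < d ->
  m - d / (c + 1) <= w -> z + c * w <= (e + c / 2) * (x + y) -> x <= a -> y <= b ->
  z <= e * (a + b) + c * ((a + b) / 2 - m) + d.
Proof.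
move=> e0 c0 d0 hw main xa yb.
have h3 : (e + c / 2) * (x + y) <= (e + c / 2) * (a + b).
  by rewrite ler_wpM2l ?lerD// addr_ge0 ?divr_ge0.
have h4 := ler_wpM2l c0 hw.
have h5 : c * (d / (c + 1)) <= d.
  by rewrite mulrA ler_pdivrMr ?ltr_wpDl// mulrC ler_wpM2l ?(ltW d0)// lerDl.
by rewrite mulrBr in h4; move: main h3 h4 h5; rewrite !mulrDl !mulrDr !mulrN; lra.
Qed.

Lemma scale_slack b c e x y z : 0 <= b -> 0 <= c -> 0 < e -> 0 <= y -> y <= b ->
  z <= e / 3 / (c + 1) -> x <= (1 + e / 3 / (b + 1)) * y + c * z -> x - y <= e / 3 + e / 3.
Proof.
move=> b0 c0 e0 y0 yb zs xy.
have h1 : e / 3 / (b + 1) * y <= e / 3.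
  by rewrite mulrAC ler_pdivrMr ?ltr_wpDl// ler_wpM2l ?divr_ge0 ?(ltW e0)//; lra.
have h2 : c * z <= e / 3.
  apply: le_trans (ler_wpM2l c0 zs) _; rewrite mulrA ler_pdivrMr ?ltr_wpDl//.
  by rewrite mulrC ler_wpM2l ?divr_ge0 ?(ltW e0)// lerDl.
by rewrite mulrDl mul1r in xy; lra.
Qed.

Lemma norm_lt_third e x y : 0 < e -> x - y <= e / 3 + e / 3 -> y - x <= e / 3 + e / 3 ->
  `|x - y| < e.
Proof. by move=> e0 h1 h2; rewrite ltr_norml; apply/andP; split; lra. Qed.

Lemma limit_slack a b c d e x y z w m : 0 < a -> 0 < b -> 0 < c -> e = (m - x) / 3 ->
  z <= c * (e / (a * b * c)) -> y <= b * d + b * z -> w <= a * y + e -> m - e <= w ->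
  x <= a * b * d.
Proof.
move=> a0 b0 c0 eE hz hy hw hm.
have h1 : a * b * z <= e.
  apply: le_trans (ler_wpM2l _ hz) _; first by rewrite mulr_ge0// ltW.
  by rewrite le_eqVlt; apply/orP; left; apply/eqP; field; rewrite !gt_eqF.
have h2 := ler_wpM2l (ltW a0) hy.
by rewrite mulrDr !mulrA in h2; lra.
Qed.

Lemma quotient_slack a b e x y : 0 < a * b -> 0 <= a -> x <= b * y -> y <= e / (a * b) -> a * x <= e.
Proof.
move=> ab a0 h1 h2; apply: le_trans (ler_wpM2l a0 h1) _.
by rewrite mulrA mulrC -ler_pdivlMr.
Qed.

End Arithmetic.

Section ClosedEnergy.
Context (R : realType) (S : simple_igs) (D : doubling S) (hnd : non_degenerate S).
Context (hcu : conductively_uniform R S) (p : R) (p1 : 1 < p).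
Local Notation X := (borel_space R D).
Local Notation limX := (limit_space R D).
Local Notation M := (Mp S p).
Local Notation N := (#|edge S|%:R : R).
Local Notation mu := (@mu R S D).
Local Notation Er f := (fine (Ecal p f)).
Implicit Types (f g h u v w : X -> R).

Let p0 : 0 < p. Proof. exact: lt_trans p1. Qed.

Lemma subE f g : (f \- g)%R = (fun z => 1 * f z + -1 * g z).
Proof. by apply/funext => z; rewrite mul1r mulN1r. Qed.

Lemma Er_lin_le f g a b x y : 0 <= x -> 0 <= y -> Cp p f -> Cp p g ->
  (forall u v : R, `|a * u + b * v| `^ p <= x * `|u| `^ p + y * `|v| `^ p) ->
  Cp p (fun z => a * f z + b * g z) /\ Er (fun z => a * f z + b * g z) <= x * Er f + y * Er g.
Proof.
move=> x0 y0 Cf Cg hle; apply: (Cp_le hnd hcu p1 (n0 := 0)); first exact: continuous_lin Cf.1 Cg.1.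
move=> n _; apply: le_trans (En_lin_le hnd p1 n x0 y0 Cf.1 Cg.1 hle) _.
by apply: lerD; apply: ler_wpM2l => //; exact: Cp_En_le.
Qed.

Lemma Cp_lin f g a b : Cp p f -> Cp p g -> Cp p (fun z => a * f z + b * g z).
Proof.
move=> Cf Cg; apply: (Er_lin_le (x := 2 `^ p * `|a| `^ p) (y := 2 `^ p * `|b| `^ p) _ _ Cf Cg _).1.
- by rewrite mulr_ge0 ?powR_ge0.
- by rewrite mulr_ge0 ?powR_ge0.
move=> x y; rewrite -!mulrA -mulrDr -!powRM// -!normrM; exact: powRD_le (ltW p0).
Qed.

Lemma Cp_sub f g : Cp p f -> Cp p g -> Cp p (f \- g)%R.
Proof. by rewrite subE; exact: Cp_lin. Qed.

Lemma Er_le_scale lam C f g : 1 < lam -> 0 <= C ->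
  (forall x y : R, `|x + y| `^ p <= lam * `|x| `^ p + C * `|y| `^ p) ->
  Cp p f -> Cp p g -> Er f <= lam * Er g + C * Er (f \- g)%R.
Proof.
move=> l1 C0 hC Cf Cg.
have hle (u v : R) : `|1 * u + 1 * v| `^ p <= lam * `|u| `^ p + C * `|v| `^ p by rewrite !mul1r.
have := (Er_lin_le (le_trans ler01 (ltW l1)) C0 Cg (Cp_sub Cf Cg) hle).2.
by rewrite (_ : (fun z => 1 * g z + 1 * (f \- g)%R z) = f)//; apply/funext => z /=; ring.
Qed.

(** Uniform convexity edge by edge. Since E_n increases to E, replacing E_n by E is harmless for f
    and g; the midpoint enters with a minus sign, hence n0, from which on its E_n is within d / (C +
    1) of the limit. *)
Lemma Er_parallelogram e C f g : 0 < e -> 0 <= C ->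
  (forall x y : R, `|x - y| `^ p <= e * (`|x| `^ p + `|y| `^ p) +
    C * ((`|x| `^ p + `|y| `^ p) / 2 - `|(x + y) / 2| `^ p)) ->
  Cp p f -> Cp p g -> Er (f \- g)%R <= e * (Er f + Er g) +
    C * ((Er f + Er g) / 2 - Er (fun z => 2^-1 * f z + 2^-1 * g z)).
Proof.
move=> e0 C0 hC Cf Cg; set m := (fun z => 2^-1 * f z + 2^-1 * g z).
have Cm : Cp p m by exact: Cp_lin.
have Cs := Cp_sub Cf Cg.
apply/ler_addgt0Pr => d d0.
have d1 : 0 < d / (C + 1) by rewrite divr_gt0// ltr_wpDl.
have [n0 hn0] : exists n0, Er m - d / (C + 1) <= En p m n0.
  apply: contrapT => /forallNP hno.
  have h' n : (0 <= n)%N -> En p m n <= Er m - d / (C + 1).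
    by move=> _; have /negP := hno n; rewrite -ltNge => /ltW.
  by have := (Cp_le hnd hcu p1 Cm.1 h').2; rewrite lerBrDr gerDl leNgt d1.
apply: (Cp_le hnd hcu p1 Cs.1 (n0 := n0) _).2 => n nn0.
have Em : Er m - d / (C + 1) <= En p m n.
  by apply: le_trans hn0 _; exact: (En_le hnd hcu p1 Cm.1 nn0).
have main : En p (f \- g)%R n + C * En p m n <= (e + C / 2) * (En p f n + En p g n).
  have M0 : 0 <= M ^- n by rewrite invr_ge0 exprn_ge0// ltW// (Mp_gt0 D p1).
  have Vm (x : vertex (Gr S n)) : Vn p m x = 2^-1 * Vn p f x + 2^-1 * Vn p g x.
    by apply: (Vn_lin hnd p1); [exact: Cf.1|exact: Cg.1|exact: Cm.1].
  have Vs (x : vertex (Gr S n)) : Vn p (f \- g)%R x = 1 * Vn p f x + -1 * Vn p g x.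
    rewrite subE; apply: (Vn_lin hnd p1); [exact: Cf.1|exact: Cg.1|].
    by rewrite -subE; exact: Cs.1.
  rewrite /En; move: (@Vn _ _ _ p n f) (@Vn _ _ _ p n g) (@Vn _ _ _ p n m) (@Vn _ _ _ p n (f \- g)%R) Vm Vs.
  move=> U V W Z hW hZ.
  have -> : M ^- n * energy p Z + C * (M ^- n * energy p W) =
    M ^- n * (energy p Z + C * energy p W) by ring.
  have -> : (e + C / 2) * (M ^- n * energy p U + M ^- n * energy p V) =
    M ^- n * ((e + C / 2) * (energy p U + energy p V)) by ring.
  rewrite ler_wpM2l// /energy -big_split /= !mulr_sumr -!big_split /=.
  apply: ler_sum => a _; rewrite !hW !hZ.
  set x1 := U (oend true a); set x2 := U (oend false a).
  set y1 := V (oend true a); set y2 := V (oend false a).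
  have := hC (x1 - x2) (y1 - y2).
  have -> : x1 - x2 - (y1 - y2) = 1 * x1 + -1 * y1 - (1 * x2 + -1 * y2) by ring.
  have -> : (x1 - x2 + (y1 - y2)) / 2 = 2^-1 * x1 + 2^-1 * y1 - (2^-1 * x2 + 2^-1 * y2) by ring.
  move: (`|x1 - x2| `^ p) (`|y1 - y2| `^ p) (`|1 * x1 + _ - _| `^ p) (`|2^-1 * x1 + _ - _| `^ p).
  by move=> a1 a2 a3 a4; lra.
exact: (parallelogram_slack (ltW e0) C0 d0 Em main (Cp_En_le hnd hcu p1 n Cf)
  (Cp_En_le hnd hcu p1 n Cg)).
Qed.

Lemma dist_p_sub f g h : dist_p p (f \- g)%R (fun z => h z - g z) = dist_p p f h.
Proof.
by apply: eq_integral => s _; rewrite /lift /= opprB addrA subrK.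
Qed.

Lemma Dn_le_dist n f g : Lp p f -> Lp p g ->
  Dn p (fun x => f x - g x) n <=
  (N ^+ 2 / M) ^+ n * (2 `^ p * (4 * N * N ^- n)) * fine (dist_p p f g).
Proof.
move=> Lf Lg; rewrite /Dn -mulrA ler_wpM2l ?(ltW (scale_gt0 D p1 n))//.
have c0 : 0 <= 2 `^ p * (4 * N * N ^- n) by rewrite !mulr_ge0 ?powR_ge0// invr_ge0 exprn_ge0.
have df : dist_p p f g \is a fin_num by rewrite ge0_fin_numE ?dist_p_ge0// dist_p_fin.
have := Tn_le_dist hnd p1 n Lf.1 Lg.1.
rewrite -(fineK df) -EFinM => hT.
have fT : Tn (lift (fun x => f x - g x)) p n \is a fin_num.
  by rewrite ge0_fin_numE ?Tn_ge0//; apply: le_lt_trans hT _; rewrite ltry.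
by rewrite -lee_fin (fineK fT).
Qed.

Lemma Lp_sub f g : Lp p f -> Lp p g -> Lp p (fun x => f x - g x).
Proof.
move=> Lf Lg; split; first exact: measurable_funB Lf.1 Lg.1.
by rewrite (dist_pE hnd p Lf.1 Lg.1); exact: dist_p_fin.
Qed.

Lemma Dn_le_add n f g : Lp p f -> Lp p g ->
  Dn p f n <= 2 `^ p * Dn p g n + 2 `^ p * Dn p (fun x => g x - f x) n.
Proof.
move=> Lf Lg; apply: (Dn_le_comb hnd p1 n (powR_ge0 _ _) (powR_ge0 _ _) Lf Lg (Lp_sub Lg Lf)).
move=> x y; rewrite -mulrDr.
have -> : f x - f y = (g x - g y) - (g x - f x - (g y - f y)) by ring.
exact: powRB_le (ltW p0).
Qed.

Definition dist_cvg (fs : nat -> X -> R) f :=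
  forall e : R, 0 < e -> exists k, forall i, (k <= i)%N -> (dist_p p (fs i) f <= e%:E)%E.

(** The error bound [Dn_le_dist] depends on n, but j is chosen after n; the final constant is that
    of [Dn_le_energy], uniform in n. *)
Lemma Dn_limit : exists2 C : R, 0 < C & forall fs f n B J, Lp p f -> dist_cvg fs f ->
  (forall j, (J <= j)%N -> Cp p (fs j) /\ Er (fs j) <= B) -> Dn p f n <= C * B.
Proof.
have [K K0 hK] := Dn_le_energy D hnd hcu p1.
have P0 : 0 < 2 `^ p :> R by rewrite powR_gt0.
exists (2 `^ p * (K + 1)); first by rewrite mulr_gt0// ltr_wpDl.
move=> fs f n B J Lf hd hB; apply/ler_addgt0Pr => e e0.
pose c := 2 `^ p * ((N ^+ 2 / M) ^+ n * (2 `^ p * (4 * N * N ^- n))).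
have c0 : 0 < c.
  rewrite !mulr_gt0 ?(scale_gt0 D p1 n)// ?(N_gt0 R D)// invr_gt0 exprn_gt0// (N_gt0 R D)//.
have [k hk] := hd (e / c) (divr_gt0 e0 c0).
have [Cj Ej] := hB (maxn J k) (leq_maxl _ _).
have dj := hk _ (leq_maxr J k).
have Lj := Cp_Lp hnd p1 Cj.
apply: le_trans (Dn_le_add n Lf Lj) _; apply: lerD.
  rewrite -mulrA ler_wpM2l ?(ltW P0)//; apply: le_trans (hK _ n Cj) _.
  have B0 : 0 <= B by apply: le_trans Ej; exact: Er_ge0.
  by apply: le_trans (ler_wpM2l K0 Ej) _; rewrite ler_wpM2r// lerDl.
apply: (quotient_slack c0 (ltW P0) (Dn_le_dist n Lj Lf)).
have df : dist_p p (fs (maxn J k)) f \is a fin_num.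
  by rewrite ge0_fin_numE ?dist_p_ge0//; exact: dist_p_fin.
by rewrite -lee_fin (fineK df).
Qed.

Lemma approximates_dist_cvg f fs : Lp p f -> approximates p f fs -> dist_cvg fs f.
Proof.
move=> Lf [hC _ hd] e e0; move/fine_cvgP: hd => [[k1 _ h1]] /cvgrPdist_le /(_ e e0) [k2 _ h2].
exists (maxn k1 k2) => i; rewrite geq_max => /andP[i1 i2].
have := h1 i i1; have := h2 i i2; rewrite /= sub0r normrN.
have Li := Cp_Lp hnd p1 (hC i).
rewrite (dist_pE hnd p Li.1 Lf.1) => hle fi.
rewrite -(fineK fi) lee_fin; apply: le_trans hle; exact: ler_norm.
Qed.

Lemma approximates_energy_cauchy f fs : approximates p f fs -> forall e : R, 0 < e ->
  exists k, forall i j, (k <= i)%N -> (k <= j)%N -> Er (fs i \- fs j)%R <= e.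
Proof.
move=> [hC hE _] e e0; have [k hk] := hE e e0; exists k => i j ki kj.
have := ltW (hk i j ki kj); rewrite -lee_fin fineK//.
by apply: (Cp_fin_num hnd hcu p1); exact: Cp_sub.
Qed.

(** [powRD_le_scale] stands in for the triangle inequality: factor 2 bounds the energies by B, then
    factor 1 + e / 3 / (B + 1) compares any two late ones. *)
Lemma approximates_energy_cvg f fs : approximates p f fs -> exists E : R,
  limn (fun i => Ecal p (fs i)) = E%:E /\
  forall e, 0 < e -> exists k, forall i, (k <= i)%N -> `|E - Er (fs i)| <= e.
Proof.
move=> hA; have [hC _ _] := hA; have hcau := approximates_energy_cauchy hA.
have en0 i : 0 <= Er (fs i) by exact: Er_ge0.
have cv : cvgn (fun i => Er (fs i)).
  apply/cauchy_cvgP; apply/cauchy_exP => e e0.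
  have [C2 C20 hC2] := powRD_le_scale p0 (ltr1n R 2).
  have [k1 hk1] := hcau 1 ltr01.
  pose B := 2 * Er (fs k1) + C2 * 1.
  have hB i : (k1 <= i)%N -> Er (fs i) <= B.
    move=> ki; apply: le_trans (Er_le_scale (ltr1n R 2) C20 hC2 (hC i) (hC k1)) _.
    by rewrite lerD2l ler_wpM2l// hk1.
  have B0 : 0 <= B by apply: le_trans (hB k1 (leqnn _)).
  pose lam := 1 + e / 3 / (B + 1).
  have l1 : 1 < lam by rewrite ltrDl !divr_gt0// ltr_wpDl.
  have [C C0 hCl] := powRD_le_scale p0 l1.
  have e3 : 0 < e / 3 / (C + 1) by rewrite !divr_gt0// ltr_wpDl.
  have [k2 hk2] := hcau _ e3.
  have close i j : (maxn k1 k2 <= i)%N -> (maxn k1 k2 <= j)%N -> Er (fs i) - Er (fs j) <= e / 3 + e / 3.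
    rewrite !geq_max => /andP[i1 i2] /andP[j1 j2].
    exact: (scale_slack B0 C0 e0 (en0 j) (hB j j1) (hk2 i j i2 j2)
      (Er_le_scale l1 C0 hCl (hC i) (hC j))).
  exists (Er (fs (maxn k1 k2))); exists (maxn k1 k2) => // i /= ki.
  exact: (norm_lt_third e0 (close _ _ (leqnn _) ki) (close _ _ ki (leqnn _))).
exists (limn (fun i => Er (fs i))); split; last first.
  move=> e e0; move/cvgrPdist_le : cv => /(_ e e0)[k _ hk].
  by exists k => i ki; exact: hk.
rewrite (_ : (fun i => Ecal p (fs i)) = EFin \o (fun i => Er (fs i))); first exact: EFin_lim.
by apply/funext => i /=; rewrite fineK// (Cp_fin_num hnd hcu p1).
Qed.

Lemma Dn_le_limit : exists2 C : R, 0 < C & forall f fs n, Lp p f -> approximates p f fs ->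
  ((Dn p f n)%:E <= C%:E * limn (fun i => Ecal p (fs i)))%E.
Proof.
have [C C0 hC] := Dn_limit; exists C => // f fs n Lf hA.
have [E [-> hE]] := approximates_energy_cvg hA; rewrite -EFinM lee_fin.
apply/ler_addgt0Pr => e e0; have [k hk] := hE _ (divr_gt0 e0 C0).
have -> : C * E + e = C * (E + e / C) by field; rewrite gt_eqF.
apply: (hC fs f n (E + e / C) k Lf (approximates_dist_cvg Lf hA)) => j kj; split.
  by have [] := hA.
by have := hk j kj; rewrite ler_distlC => /andP[_].
Qed.

(** f is replaced by one late member fs i. By [Dn_limit] the error D_n(f - fs i) is bounded by
    energies of fs j - fs i with j large, hence small uniformly in n. *)
Lemma limit_le_Dn : exists2 C : R, 0 < C & forall f fs (x : R), Lp p f -> approximates p f fs ->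
  (x%:E < limn (fun i => Ecal p (fs i)))%E -> exists n0, forall n, (n0 <= n)%N -> x <= C * Dn p f n.
Proof.
have [C1 C10 h1] := energy_le_Dn D hnd hcu p1; have [C2 C20 h2] := Dn_limit.
have P0 : 0 < 2 `^ p :> R by rewrite powR_gt0.
exists (C1 * 2 `^ p); first exact: mulr_gt0.
move=> f fs x Lf hA; have [hC _ _] := hA; have hdc := approximates_dist_cvg Lf hA.
have [E [-> hE]] := approximates_energy_cvg hA; rewrite lte_fin => xE.
have e0 : 0 < (E - x) / 3 by rewrite divr_gt0// subr_gt0.
move: e0; set e := (E - x) / 3 => e0.
have c0 : 0 < C1 * 2 `^ p * C2 by rewrite !mulr_gt0.
have [k1 hk1] := hE e e0.
have [k2 hk2] := approximates_energy_cauchy hA (divr_gt0 e0 c0).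
pose i := maxn k1 k2; have Li := Cp_Lp hnd p1 (hC i).
have [n0 hn0] := h1 (fs i) e (hC i) e0; exists n0 => n nn0.
have hD : Dn p (fun z => f z - fs i z) n <= C2 * (e / (C1 * 2 `^ p * C2)).
  apply: (h2 (fun j => fs j \- fs i)%R _ n _ k2).
  - exact: Lp_sub.
  - move=> d d0; have [k hk] := hdc d d0; exists k => j kj.
    by rewrite dist_p_sub; exact: hk.
  - by move=> j kj; split; [exact: Cp_sub|apply: hk2 => //; exact: leq_maxr].
have hF := Dn_le_add n Li Lf.
have := hk1 i (leq_maxl _ _); rewrite ler_distlC => /andP[h4 _].
exact: (limit_slack C10 P0 C20 erefl hD hF (hn0 n nn0) h4).
Qed.

End ClosedEnergy.

Lemma cauchy_slack (R : realType) (I c e y a b m z : R) : 0 <= I -> 0 <= c -> 0 < e -> y <= 1 ->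
  y <= e / 8 / (c + 1) -> a <= I + y -> b <= I + y -> I - y <= m ->
  z <= e / 8 / (I + 1) * (a + b) + c * ((a + b) / 2 - m) -> z < e.
Proof.
move=> I0 c0 e0 y1 yc ha hb hm hz.
have h1 : e / 8 / (I + 1) * (a + b) <= e / 8 * 2.
  rewrite mulrAC ler_pdivrMr ?ltr_wpDl// -[leRHS]mulrA; apply: ler_wpM2l; last by lra.
  by rewrite divr_ge0// ltW.
have h2 : c * ((a + b) / 2 - m) <= c * (2 * y) by apply: ler_wpM2l => //; lra.
have h3 : c * y <= e / 8.
  apply: le_trans (ler_wpM2l c0 yc) _; rewrite mulrA ler_pdivrMr ?ltr_wpDl//.
  by rewrite mulrC ler_wpM2l ?divr_ge0 ?(ltW e0)// lerDl.
by rewrite mulrCA in h2; lra.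
Qed.

(** * Existence of approximating sequences *)

Section Closure.
Context (R : realType) (S : simple_igs) (D : doubling S) (hnd : non_degenerate S).
Context (hcu : conductively_uniform R S) (p : R) (p1 : 1 < p).
Local Notation X := (borel_space R D).
Local Notation M := (Mp S p).
Local Notation N := (#|edge S|%:R : R).
Local Notation Er f := (fine (Ecal p f)).
Implicit Types (f g h : X -> R).

Let p0 : 0 < p. Proof. exact: lt_trans p1. Qed.

Lemma dist_p_midpoint f g h : Lp p f -> Lp p g -> Lp p h ->
  (dist_p p (fun z => (2^-1 * f z + 2^-1 * g z)%R) h <=
   2^-1%:E * dist_p p f h + 2^-1%:E * dist_p p g h)%E.
Proof.
move=> Lf Lg Lh; have mZ k : Lp p k -> measurable_fun setT (fun z => 2^-1 * k z).
  by move=> Lk; apply: measurable_funM => //; exact: Lk.1.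
apply: (dist_p_le_comb hnd _ _ _ Lh.1 Lf.1 Lh.1 Lg.1 Lh.1); rewrite ?invr_ge0//.
  by apply: measurable_funD; exact: mZ.
move=> z; have -> : 2^-1 * f z + 2^-1 * g z - h z = ((f z - h z) + (g z - h z)) / 2 by field.
by apply: le_trans (powR_midpoint _ _ p1) _; rewrite -mulrDr mulrC.
Qed.

Section Minimizing.
Context (f : X -> R) (Lf : Lp p f) (B : R).
Hypothesis hB : forall n0, exists2 n, (n0 <= n)%N & Dn p f n <= B.

Let near_f : exists2 B1 : R, 0 <= B1 & forall e, 0 < e ->
  exists h, [/\ Cp p h, Er h <= B1 & (dist_p p h f <= e%:E)%E].
Proof.
have [C C0 hC] := approximant D hnd hcu p1.
have B0 : 0 <= B by have [n _] := hB 0%N; apply: le_trans; exact: Dn_ge0.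
have c0 : 0 < C * (B + 1) by rewrite mulr_gt0// ltr_wpDl.
exists (C * (B + 1)); first exact: ltW.
move=> e e0; have MN : 0 <= M / N by rewrite divr_ge0// ltW// (Mp_gt0 D p1).
have : (fun n => (M / N) ^+ n) @ \oo --> (0 : R).
  apply: cvg_expr; rewrite ger0_norm// ltr_pdivrMr ?(N_gt0 R D)// mul1r.
  exact: Mp_lt.
move=> /cvgrPdist_lt/(_ _ (divr_gt0 e0 c0))[k _ hk].
have [n kn Dn_B] := hB k; have [h [Ch h1 h2 _]] := hC f n 1 Lf ltr01.
exists h; split=> //; first by apply: le_trans h1 _; rewrite ler_wpM2l ?(ltW C0)// lerD2r.
apply: le_trans h2 _; rewrite lee_fin.
have := hk n kn; rewrite /= sub0r normrN ger0_norm ?exprn_ge0// ltr_pdivlMr// => /ltW.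
apply: le_trans; rewrite mulrC mulrA mulrC ler_wpM2l ?exprn_ge0//.
by rewrite mulrC ler_wpM2l ?(ltW C0)// lerD2r.
Qed.

(** Relaxation: I k is the infimum of the energy over functions at distance at most 1 / (k + 1) from
    f. It is nondecreasing in k, and bounded by [near_f]; IS is its supremum. *)
Let near k h := Cp p h /\ (dist_p p h f <= (k.+1%:R^-1)%:E)%E.
Let K k := [set Er h | h in near k].
Let I k := inf (K k).

Let K_inf k : has_inf (K k).
Proof.
have [B1 _ hB1] := near_f; split.
  have [|h [Ch _ hd]] := hB1 k.+1%:R^-1; first by rewrite invr_gt0.
  by exists (Er h); exists h.
by exists 0 => _ [h [Ch _] <-]; exact: Er_ge0.
Qed.

Let near_le j k h : (j <= k)%N -> near k h -> near j h.
Proof.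
move=> jk [Ch hd]; split=> //; apply: le_trans hd _; rewrite lee_fin.
by rewrite lef_pV2 ?posrE// ler_nat.
Qed.

Let I_le_Er k h : near k h -> I k <= Er h.
Proof. by move=> hh; apply: ge_inf; [exact: (K_inf k).2|exists h]. Qed.

Let IS := sup (range I).

Let I_sup : has_sup (range I).
Proof.
split; first by exists (I 0%N); exists 0%N.
have [B1 _ hB1] := near_f; exists B1 => _ [k _ <-].
have [|h [Ch h1 hd]] := hB1 k.+1%:R^-1; first by rewrite invr_gt0.
by apply: le_trans h1; apply: I_le_Er.
Qed.

Let I_IS k : I k <= IS.
Proof. by apply: ub_le_sup; [exact: I_sup.2|exists k]. Qed.

Let IS_ge0 : 0 <= IS.
Proof.
apply: le_trans (I_IS 0); apply: lb_le_inf; first exact: (K_inf 0).1.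
by move=> _ [h [Ch _] <-]; exact: Er_ge0.
Qed.

Lemma exists_approximates : exists fs, approximates p f fs.
Proof.
have /choice[fs hfs] : forall k, exists h, near k h /\ Er h <= I k + k.+1%:R^-1.
  move=> k; have k0 : 0 < k.+1%:R^-1 :> R by rewrite invr_gt0.
  by have [_ [h hh <-] hlt] := inf_adherent k0 (K_inf k); exists h; split=> //; exact: ltW.
have inv_le e : 0 < e -> exists k, forall j, (k <= j)%N -> (j.+1%:R^-1 : R) <= e.
  move=> e0; exists (Num.truncn e^-1) => j kj.
  rewrite -[e]invrK lef_pV2 ?posrE ?invr_gt0//; apply/ltW.
  apply: lt_le_trans (truncnS_gt _) _; by rewrite ler_nat.
exists fs; split=> [i|e e0|]; first exact: (hfs i).1.1.
(* The two energies are at most IS + 1, so this coefficient contributes at most e / 4; the choice of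
   y makes the convexity defect contribute at most e / 4 as well. *)
- have e1 : 0 < e / 8 / (IS + 1) by rewrite !divr_gt0// ltr_wpDl.
  have [C C0 hC] := powR_uniform_convex p1 e1.
  have y0 : 0 < Num.min 1 (e / 8 / (C + 1)) by rewrite lt_min ltr01 !divr_gt0// ltr_wpDl.
  have [k1 hk1] := inv_le _ y0.
  have [_ [k2 _ <-] hk2] := sup_adherent y0 I_sup.
  set y := Num.min _ _ in y0 hk1 hk2.
  exists (maxn k1 k2) => i j ki kj.
  have bound l : (maxn k1 k2 <= l)%N -> Er (fs l) <= IS + y.
    rewrite geq_max => /andP[l1 l2]; apply: le_trans (hfs l).2 _.
    by apply: lerD; [exact: I_IS|exact: hk1].
  have near2 l : (maxn k1 k2 <= l)%N -> near k2 (fs l).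
    by rewrite geq_max => /andP[l1 l2]; apply: near_le l2 (hfs l).1.
  have Ci := (hfs i).1.1; have Cj := (hfs j).1.1.
  have Cm : Cp p (fun z => 2^-1 * fs i z + 2^-1 * fs j z) by exact: Cp_lin.
  have hm : IS - y <= Er (fun z => 2^-1 * fs i z + 2^-1 * fs j z).
    apply: le_trans (ltW hk2) _; apply: I_le_Er; split=> //.
    have [_ di] := near2 i ki; have [_ dj] := near2 j kj.
    apply: le_trans (dist_p_midpoint (Cp_Lp hnd p1 Ci) (Cp_Lp hnd p1 Cj) Lf) _.
    apply: le_trans (_ : (2^-1%:E * (k2.+1%:R^-1)%:E + 2^-1%:E * (k2.+1%:R^-1)%:E <= _)%E).
      by apply: leeD; apply: lee_wpmul2l => //; rewrite lee_fin invr_ge0.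
    rewrite -!EFinM -EFinD lee_fin -mulrDl le_eqVlt; apply/orP; left; apply/eqP.
    by rewrite -[RHS]mul1r; congr (_ * _); lra.
  have hz := Er_parallelogram hnd hcu p1 e1 C0 hC Ci Cj.
  have yy : y <= 1 /\ y <= e / 8 / (C + 1).
    by rewrite /y; split; rewrite ge_min lexx ?orbT.
  have := cauchy_slack IS_ge0 C0 e0 yy.1 yy.2 (bound i ki) (bound j kj) hm hz.
  rewrite -lte_fin fineK//.
  by apply: (Cp_fin_num hnd hcu p1); exact: Cp_sub.
- have hd i : (\int[@Defs.mu R S D]_x (`|fs i x - f x| `^ p)%:E = dist_p p (fs i) f)%E.
    by apply: dist_pE => //; [exact: (Cp_Lp hnd p1 (hfs i).1.1).1|exact: Lf.1].
  under eq_fun do rewrite hd.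
  apply: (@squeeze_cvge _ _ _ _ (fun=> 0%E) _ (fun i => (i.+1%:R^-1)%:E)).
  - apply: nearW => i; rewrite dist_p_ge0 /=; exact: (hfs i).1.2.
  - exact: cvg_cst.
  - apply/fine_cvgP; split; first exact: nearW.
    apply/cvgrPdist_le => e e0; have [k hk] := inv_le e e0; exists k => // j /= kj.
    by rewrite sub0r normrN ger0_norm ?invr_ge0// hk.
Qed.

End Minimizing.

Lemma closed_energyP f :
  (exists2 fs, approximates p f fs & closed_energy p f = limn (fun i => Ecal p (fs i))) \/
  ~ (exists fs, approximates p f fs) /\ closed_energy p f = +oo%E.
Proof.
rewrite /closed_energy; case: pselect => [hE|hno]; last by right.
by left; exists (projT1 (cid hE)) => //; exact: (projT2 (cid hE)).
Qed.

Lemma Dn_le_closed : exists2 C : R, 0 < C & forall f n, Lp p f ->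
  ((Dn p f n)%:E <= C%:E * closed_energy p f)%E.
Proof.
have [C C0 hC] := Dn_le_limit D hnd hcu p1; exists C => // f n Lf.
have [[fs hA ->]|[_ ->]] := closed_energyP f; first exact: hC.
by rewrite gt0_muley ?lte_fin// leey.
Qed.

(** If no approximating sequence exists, argue by contraposition: D_n f <= x / C for arbitrarily
    large n would produce one by [exists_approximates]. *)
Lemma closed_le_Dn : exists2 C : R, 0 < C & forall f (x : R), Lp p f ->
  (x%:E < closed_energy p f)%E -> exists n0, forall n, (n0 <= n)%N -> x <= C * Dn p f n.
Proof.
have [C C0 hC] := limit_le_Dn D hnd hcu p1; exists C => // f x Lf.
have [[fs hA ->]|[hno _ _]] := closed_energyP f; first exact: hC.
apply: contrapT => /forallNP hn0; apply: hno.
apply: (exists_approximates Lf (B := x / C)) => n0.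
have /existsNP[n /not_implyP[nn0 /negP]] := hn0 n0; rewrite -ltNge => /ltW hle.
by exists n => //; rewrite ler_pdivlMr// mulrC.
Qed.

Lemma closed_energy_ge0 f : Lp p f -> (0 <= closed_energy p f)%E.
Proof.
have [C C0 hC] := Dn_le_closed => Lf; rewrite -(@lee_pmul2l _ C%:E)// mule0.
by apply: le_trans (hC f 0%N Lf); rewrite lee_fin Dn_ge0.
Qed.

End Closure.

(** * Korevaar-Schoen integrals *)

Lemma measurable_fun_nat_of_bool d (U : measurableType d) (R : realType) (b : U -> bool) :
  measurable [set x | b x] -> measurable_fun setT (fun x => (b x)%:R : R).
Proof.
move=> mb; rewrite (_ : (fun _ => _) = \1_[set x | b x]); first exact: measurable_indic.
apply/funext => x; rewrite indicE; congr ((nat_of_bool _)%:R).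
by apply/idP/idP; [exact: mem_set|exact: set_mem].
Qed.

Lemma integral_nat_of_bool d (U : measurableType d) (R : realType)
    (m : {measure set U -> \bar R}) (b : U -> bool) : measurable [set x | b x] ->
  (\int[m]_x ((b x)%:R : R)%:E = m [set x | b x])%E.
Proof.
move=> mb; rewrite -[X in m X]setIT -integral_indic//; apply: eq_integral => x _.
rewrite indicE; congr ((nat_of_bool _)%:R%:E).
by apply/idP/idP; [exact: mem_set|exact: set_mem].
Qed.

Lemma powR_invl (R : realType) (x d : R) : 0 <= x -> x^-1 `^ d = (x `^ d)^-1.
Proof. by move=> x0; rewrite -powR_inv1// -powRrM mulrC powRrM powR_inv1// powR_ge0. Qed.

Lemma scale_upper (R : realType) (x y c : R) n : y != 0 ->
  x ^+ (n + 3) * (c * (x / y) ^+ n.+1) = x ^+ 3 * (c * (x / y)) * (x ^+ 2 / y) ^+ n.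
Proof.
move=> y0; have -> : x ^+ 2 / y = x * (x / y) by rewrite expr2 mulrA.
rewrite [(x * (x / y)) ^+ n]exprMn exprD [(x / y) ^+ n.+1]exprS; move: (x ^+ n) ((x / y) ^+ n) => a b.
by ring.
Qed.

Lemma scale_lower (R : realType) (x y c : R) m : x != 0 -> y != 0 ->
  (2 * x)^-1 * c * (x ^- 4 * y) * (x ^+ 2 / y) ^+ (m + 3) =
  x ^+ m / (2 * x) * (c * (x / y) ^+ (m + 2)).
Proof.
move=> x0 y0; have -> : x ^+ 2 / y = x * (x / y) by rewrite expr2 mulrA.
rewrite [(x * (x / y)) ^+ (m + 3)]exprMn [x ^+ (m + 3)]exprD.
have -> : (x / y) ^+ (m + 3) = (x / y) ^+ (m + 2) * (x / y) by rewrite -exprSr addnS.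
by move: (x ^+ m) ((x / y) ^+ (m + 2)) => a b; field; rewrite x0 y0.
Qed.

Section KorevaarSchoen.
Context (R : realType) (S : simple_igs) (D : doubling S) (hnd : non_degenerate S).
Context (p : R) (p1 : 1 < p).
Local Notation X := (borel_space R D).
Local Notation M := (Mp S p).
Local Notation N := (#|edge S|%:R : R).
Local Notation L := ((Lstar S)%:R : R).
Local Notation dw := (dwalk S p).
Local Notation T := (mseqspace (edge0 D)).
Local Notation P := (bernoulli R D).
Local Notation mu := (@mu R S D).
Local Notation meets := (@meets S D).
Local Notation dinf := (@dinf R S D).
Local Notation dball := (@dball S D R).
Implicit Types (f : X -> R) (s t : T) (r : R).

Let p0 : 0 < p. Proof. exact: lt_trans p1. Qed.
Let N0 : 0 < N. Proof. exact: (N_gt0 R D). Qed.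
Let dw0 : 0 <= dw. Proof. exact: dwalk_ge0. Qed.
Let M0 : 0 < M. Proof. exact: Mp_gt0. Qed.
Let L2 : 2 <= L. Proof. by rewrite ler_nat; exact: Lstar_ge2. Qed.
Let L0 : 0 < L. Proof. exact: lt_le_trans L2. Qed.
Let Ln0 n : 0 < L ^- n. Proof. by rewrite invr_gt0 exprn_gt0. Qed.
Let LnS n : 2 * L ^- n.+1 <= L ^- n.
Proof. by rewrite exprS invfM mulrA ler_piMl ?(ltW (Ln0 _))// ler_pdivrMr// mul1r. Qed.

(** Joint measurability in both points: a countable union of products of balls around points coded
    by finite words, completed by a default letter. *)
Lemma measurable_dist_lt r :
  measurable [set xt : X * T | dist R xt.1 (chi xt.2) < r].
Proof.
pose c (u : seq (edge S)) : Sigma D := fun i => nth (edge0 D) u i.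
pose F (ku : nat * seq (edge S)) : set (X * T) :=
  (dball (chi (c ku.2)) (3 * L ^- ku.1) : set X) `*`
  ((fun t : T => chi t : X) @^-1` (dball (chi (c ku.2)) (r - 3 * L ^- ku.1) : set X)).
have -> : [set xt : X * T | dist R xt.1 (chi xt.2) < r] = \bigcup_ku F ku.
  apply/seteqP; split=> -[x t] /=.
    have [s <-] := chi_surj x; rewrite dist_chi// => st.
    (* Room for 5 L^-k: the centre is within 2 L^-k of s, which costs 2, and the second radius gives
       up 3 more. *)
    have e0 : 0 < (r - dinf s t) / 5 by rewrite divr_gt0// subr_gt0.
    have /cvgrPdist_lt /(_ _ e0) [k _ hk] := @cvg_Ln R S D hnd.
    have := hk k (leqnn k); rewrite /= sub0r normrN ger0_norm ?(ltW (Ln0 _))// => kr.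
    exists (k, mkseq s k) => //; rewrite /F /= /Defs.dball /= !dist_chi//.
    have /(dinf_meets R hnd) h : meets k (c (mkseq s k)) s.
      apply: meets_mkseq; apply/eq_in_map => i; rewrite mem_iota /= add0n => ik.
      by rewrite /c nth_mkseq.
    have := dinf_triangle R hnd (c (mkseq s k)) s t; have := Ln0 k.
    move: kr st h; move: (dinf _ s) (dinf s t) (dinf _ t) (L ^- k) => a b c' l.
    by move=> kr st h l0 tr; split; lra.
  move=> [[k u] _]; rewrite /F /Defs.dball /=; have [s <-] := chi_surj x.
  rewrite !dist_chi// [dinf (c u) s]dinf_sym//; have := dinf_triangle R hnd s (c u) t.
  by lra.
apply: countable_bigcupT_measurable => // -[k u]; apply: measurableX.
  exact: measurable_dball.
rewrite -[X in measurable X]setTI; apply: (measurable_chi hnd) => //.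
exact: measurable_dball.
Qed.

Let ballmap (x : X) r : set T := [set t | dist R x (chi t) < r].

Let measurable_ballmap x r : measurable (ballmap x r).
Proof.
by have := measurable_chi hnd measurableT (measurable_dball x r); rewrite setTI.
Qed.

Let ind (x : X) r t : R := (dist R x (chi t) < r)%R%:R.

Let measurable_ind r : measurable_fun setT (fun xt : X * T => ind xt.1 r xt.2).
Proof.
exact: (@measurable_fun_nat_of_bool _ _ R (fun xt : X * T => dist R xt.1 (chi xt.2) < r)
  (measurable_dist_lt r)).
Qed.

Definition KSpsi f r s : \bar R :=
  (\int[P]_t (ind (chi s) r t * (`|lift f s - lift f t| `^ p / r `^ dw))%:E)%E.

Let measurable_inner f r : measurable_fun setT f ->
  measurable_fun setT (fun xt : X * T =>
    (ind xt.1 r xt.2 * (`|f xt.1 - lift f xt.2| `^ p / r `^ dw))%:E).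
Proof.
move=> mf; apply/measurable_EFinP; apply: measurable_funM; first exact: measurable_ind.
apply: measurable_funM => //.
apply: (@measurable_powRB _ _ _ (fun xt : X * T => f xt.1) (fun xt => lift f xt.2)).
  exact: (measurableT_comp mf).
exact: (measurableT_comp (measurable_lift hnd mf)).
Qed.

Lemma measurable_integral_section (f : X * T -> \bar R) : measurable_fun setT f ->
  (forall xt, 0 <= f xt)%E -> measurable_fun setT (fun x : X => \int[P]_t f (x, t))%E.
Proof. exact: measurable_fun_fubini_tonelli_F. Qed.

Let mu_ball x r : mu (dball x r) = P (ballmap x r).
Proof. by []. Qed.

Lemma korevaar_schoenE f r : measurable_fun setT f ->
  (korevaar_schoen p f r =
   \int[P]_s ((fine (P (ballmap (chi s) r)))^-1%:E * KSpsi f r s))%E.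
Proof.
move=> mf; have mL := measurable_lift hnd mf.
have innerE x : (\int[mu]_(y in dball x r) (`|f x - f y| `^ p / r `^ dw)%:E =
    \int[P]_t (ind x r t * (`|f x - lift f t| `^ p / r `^ dw))%:E)%E.
  rewrite ge0_integral_mu//; last 3 first.
  - exact: measurable_dball.
  - apply: measurable_funTS; apply/measurable_EFinP; apply: measurable_funM => //.
    exact: (@measurable_powRB _ _ _ (fun=> f x)).
  - by move=> y; rewrite lee_fin divr_ge0// powR_ge0.
  rewrite integral_mkcond; apply: eq_integral => t _.
  rewrite patchE /ind; case: (boolP (dist R x (chi t) < r)) => h.
    by rewrite mem_set ?mul1r.
  by rewrite memNset ?mul0r//; exact/negP.
have E : (fun x : X => (fine (mu (dball x r)))^-1%:E *
     \int[mu]_(y in dball x r) (`|f x - f y| `^ p / r `^ dw)%:E)%E =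
   (fun x : X => (fine (P (ballmap x r)))^-1%:E *
     \int[P]_t (ind x r t * (`|f x - lift f t| `^ p / r `^ dw))%:E)%E.
  by apply/funext => x; rewrite innerE mu_ball.
rewrite /korevaar_schoen E ge0_integral_mu ?preimage_setT//.
- apply: emeasurable_funM; last first.
    apply: (measurable_integral_section (measurable_inner r mf)) => xt.
    by rewrite lee_fin mulr_ge0 ?divr_ge0 ?powR_ge0.
  apply/measurable_EFinP.
  rewrite (_ : (fun x => _) = (fun x => fine (\int[P]_t (ind x r t)%:E)%E `^ (-1))).
    apply: (measurableT_comp (measurable_powR (-1))); apply: measurableT_comp => //.
    apply: (measurable_integral_section (f := fun xt => (ind xt.1 r xt.2)%:E)).
      by apply/measurable_EFinP; exact: measurable_ind.
    by move=> xt; rewrite lee_fin.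
  by apply/funext => x; rewrite (integral_nat_of_bool P (measurable_ballmap x r)) powR_inv1// fine_ge0.
- move=> x; apply: mule_ge0; first by rewrite lee_fin invr_ge0 fine_ge0.
  by apply: integral_ge0 => t _; rewrite lee_fin mulr_ge0 ?divr_ge0 ?powR_ge0.
Qed.

Let KSpsi_ge0 f r s : (0 <= KSpsi f r s)%E.
Proof.
by apply: integral_ge0 => t _; rewrite lee_fin mulr_ge0 ?divr_ge0 ?powR_ge0.
Qed.

Let measurable_KSpsi f r : measurable_fun setT f -> measurable_fun setT (KSpsi f r).
Proof.
move=> mf; apply: (measurable_integral2 (f := fun st : T * T =>
  (ind (chi st.1) r st.2 * (`|lift f st.1 - lift f st.2| `^ p / r `^ dw))%:E)); last first.
  by move=> st; rewrite lee_fin mulr_ge0 ?divr_ge0 ?powR_ge0.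
have mchi : measurable_fun setT (fun st : T * T => ((chi st.1 : X), st.2)).
  apply: measurable_fun_pair => //.
  exact: (measurableT_comp (measurable_chi hnd)).
exact: (measurableT_comp (measurable_inner r mf) mchi).
Qed.

Let measurable_inner1 f r s : measurable_fun setT f -> measurable_fun setT (fun t : T =>
  (ind (chi s) r t * (`|lift f s - lift f t| `^ p / r `^ dw))%:E).
Proof.
move=> mf; apply/measurable_EFinP; apply: measurable_funM.
  exact: (@measurable_fun_nat_of_bool _ _ R (fun t => dist R (chi s) (chi t) < r)
    (measurable_ballmap (chi s) r)).
apply: measurable_funM => //; apply: (@measurable_powRB _ _ _ (fun=> lift f s)) => //.
exact: (measurable_lift hnd mf).
Qed.

Let KSpsi_le f r s n b : measurable_fun setT f -> 0 <= b -> (r `^ dw)^-1 <= b ->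
  (forall t, dinf s t < r -> meets n s t) ->
  (KSpsi f r s <= b%:E * Psi (lift f) p n s)%E.
Proof.
move=> mf b0 rb hmeet; have mL := measurable_lift hnd mf.
rewrite /Psi -ge0_integralZl_EFin//; last exact: measurable_kernel1.
apply: ge0_le_integral => //.
- by move=> t _; rewrite lee_fin mulr_ge0 ?divr_ge0 ?powR_ge0.
- exact: measurable_inner1.
- by apply: measurable_funeM; exact: measurable_kernel1.
move=> t _; rewrite -EFinM lee_fin /ind dist_chi//.
case: (boolP (dinf s t < r)) => [/hmeet ->|_]; last by rewrite mul0r !mulr_ge0 ?powR_ge0.
by rewrite !mul1r mulrC ler_wpM2r ?powR_ge0.
Qed.

Let KSpsi_ge f r s n b : measurable_fun setT f -> 0 <= b -> b <= (r `^ dw)^-1 ->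
  (forall t, meets n s t -> dinf s t < r) ->
  (b%:E * Psi (lift f) p n s <= KSpsi f r s)%E.
Proof.
move=> mf b0 rb hmeet; have mL := measurable_lift hnd mf.
rewrite /Psi -ge0_integralZl_EFin//; last exact: measurable_kernel1.
apply: ge0_le_integral => //.
- by move=> t _; rewrite -EFinM lee_fin !mulr_ge0 ?powR_ge0.
- by apply: measurable_funeM; exact: measurable_kernel1.
- exact: measurable_inner1.
move=> t _; rewrite -EFinM lee_fin /ind dist_chi//.
case: (boolP (meets n s t)) => [/hmeet ->|_]; last by rewrite mul0r mulr0 mulr_ge0 ?divr_ge0 ?powR_ge0.
by rewrite !mul1r mulrC ler_wpM2l ?powR_ge0.
Qed.

Let measurable_weight r : measurable_fun setT (fun s : T => ((fine (P (ballmap (chi s) r)))^-1)%:E).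
Proof.
apply/measurable_EFinP.
rewrite (_ : (fun x => _) = (fun s : T => fine (\int[P]_t (ind (chi s) r t)%:E)%E `^ (-1))).
  apply: (measurableT_comp (measurable_powR (-1))); apply: measurableT_comp => //.
  apply: (measurable_integral2 (f := fun st => (ind (chi st.1) r st.2)%:E)); last by move=> st; rewrite lee_fin.
  apply/measurable_EFinP.
  have mchi : measurable_fun setT (fun st : T * T => ((chi st.1 : X), st.2)).
    apply: measurable_fun_pair => //.
    exact: (measurableT_comp (measurable_chi hnd)).
  exact: (measurableT_comp (measurable_ind r) mchi).
by apply/funext => s; rewrite (integral_nat_of_bool P (measurable_ballmap (chi s) r)) powR_inv1// fine_ge0.
Qed.

Let korevaar_schoen_le f r n a b : Lp p f -> 0 <= a -> 0 <= b -> (r `^ dw)^-1 <= b ->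
  (forall s t, dinf s t < r -> meets n s t) ->
  (forall s, ((a^-1)%:E <= P (ballmap (chi s) r))%E) -> 0 < a ->
  (korevaar_schoen p f r <= (a * b * fine (Tn (lift f) p n))%:E)%E.
Proof.
move=> Lf a0 b0 rb hmeet hP a1; have mf := Lf.1; have mL := measurable_lift hnd mf.
rewrite korevaar_schoenE// EFinM (fineK (Tn_fin hnd p1 n Lf)) /Tn.
rewrite -ge0_integralZl//; last 3 first.
- exact: measurable_Psi.
- by move=> s _; exact: Psi_ge0.
- by rewrite lee_fin mulr_ge0.
apply: ge0_le_integral => //.
- by move=> s _; apply: mule_ge0 => //; rewrite lee_fin invr_ge0 fine_ge0.
- by apply: emeasurable_funM; [exact: measurable_weight|exact: measurable_KSpsi].
- by apply: measurable_funeM; exact: measurable_Psi.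
move=> s _; rewrite EFinM -muleA; apply: lee_pmul => //.
- by rewrite lee_fin invr_ge0 fine_ge0.
- rewrite lee_fin -[leRHS]invrK lef_pV2 ?posrE ?invr_gt0//; last first.
    by rewrite -lte_fin fineK ?fin_num_measure//; apply: lt_le_trans (hP s); rewrite lte_fin invr_gt0.
  by rewrite -lee_fin fineK ?fin_num_measure.
- by apply: KSpsi_le => // t; exact: hmeet.
Qed.

Let korevaar_schoen_ge f r n a b : Lp p f -> 0 < a -> 0 <= b -> b <= (r `^ dw)^-1 ->
  (forall s t, meets n s t -> dinf s t < r) ->
  (forall s, (P (ballmap (chi s) r) <= (a^-1)%:E)%E) ->
  ((a * b * fine (Tn (lift f) p n))%:E <= korevaar_schoen p f r)%E.
Proof.
move=> Lf a0 b0 rb hmeet hP; have mf := Lf.1; have mL := measurable_lift hnd mf.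
rewrite korevaar_schoenE// EFinM (fineK (Tn_fin hnd p1 n Lf)) /Tn.
rewrite -ge0_integralZl//; last 3 first.
- exact: measurable_Psi.
- by move=> s _; exact: Psi_ge0.
- by rewrite lee_fin mulr_ge0// ltW.
have Ppos s : (0 < fine (P (ballmap (chi s) r))).
  rewrite -lte_fin fineK ?fin_num_measure//.
  apply: (@lt_le_trans _ _ (N ^- n)%:E); first by rewrite lte_fin invr_gt0 exprn_gt0.
  apply: le_trans (bernoulli_meets_ge R n s) _; apply: le_measure.
  - by apply: mem_set; exact: measurable_meets.
  - by apply: mem_set; exact: measurable_ballmap.
  - by move=> t /= /hmeet; rewrite /ballmap /= dist_chi.
apply: ge0_le_integral => //.
- by move=> s _; apply: mule_ge0; [rewrite lee_fin mulr_ge0// ltW|exact: Psi_ge0].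
- by apply: measurable_funeM; exact: measurable_Psi.
- by apply: emeasurable_funM; [exact: measurable_weight|exact: measurable_KSpsi].
move=> s _; rewrite EFinM -muleA; apply: lee_pmul => //.
- by rewrite lee_fin ltW.
- by apply: mule_ge0; [rewrite lee_fin|exact: Psi_ge0].
- rewrite lee_fin -[leLHS]invrK lef_pV2 ?posrE ?invr_gt0//.
  by rewrite -lee_fin fineK ?fin_num_measure.
- by apply: KSpsi_ge => // t; exact: hmeet.
Qed.

(** For the least n with L^-(n+1) / 2 < r, either n = 0 or r <= L^-n / 2, so points of a ball meet
    its centre at level n. The ball contains all sequences meeting the centre at level n + 3, of
    mass at least N^-(n+3), and r^-d_w <= 2^d_w (N / M)^(n+1). *)
Lemma korevaar_schoen_le_Dn : exists2 C : R, 0 < C & forall f r, Lp p f -> 0 < r ->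
  exists n, (korevaar_schoen p f r <= (C * Dn p f n)%:E)%E.
Proof.
pose b n := 2 `^ dw * (N / M) ^+ n.+1.
exists (N ^+ 3 * (2 `^ dw * (N / M))).
  by rewrite !mulr_gt0 ?invr_gt0 ?exprn_gt0 ?powR_gt0.
move=> f r Lf r0.
have ex : exists n, L ^- n.+1 / 2 < r.
  have /cvgrPdist_lt /(_ _ r0) [k _ hk] := @cvg_Ln R S D hnd; exists k.
  have := hk k.+1 (leqnSn k); rewrite /= sub0r normrN ger0_norm ?(ltW (Ln0 _))//.
  by have := Ln0 k.+1; lra.
case: (ex_minnP ex) => n hn hmin; exists n.
have hmeet s t : dinf s t < r -> meets n s t.
  case: n hn hmin => [|m] hn hmin st; first exact: meets0.
  apply: (dinf_lt_meets hnd); apply: lt_le_trans st _; rewrite leNgt; apply/negP => /hmin.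
  by rewrite ltnn.
have rb : (r `^ dw)^-1 <= b n.
  rewrite -[leRHS]invrK lef_pV2 ?posrE ?invr_gt0 ?powR_gt0 ?mulr_gt0 ?exprn_gt0 ?divr_gt0 ?powR_gt0//.
  rewrite /b -(powR_dwalk D hnd n.+1 p1) -powRM ?exprn_ge0 ?(ltW L0)//.
  rewrite -powR_invl ?mulr_ge0 ?exprn_ge0 ?(ltW L0)//.
  apply: ge0_ler_powR => //; rewrite ?nnegrE ?invr_ge0 ?mulr_ge0 ?exprn_ge0 ?(ltW L0) ?(ltW r0)//.
  by rewrite invfM mulrC ltW.
have hP s : (((N ^+ (n + 3))^-1)%:E <= P (ballmap (chi s) r))%E.
  apply: le_trans (bernoulli_meets_ge R (n + 3) s) _; apply: le_measure.
  - by apply: mem_set; exact: measurable_meets.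
  - by apply: mem_set; exact: measurable_ballmap.
  - move=> t /= /(dinf_meets R hnd) st; rewrite /ballmap /= dist_chi//.
    apply: le_lt_trans st _; apply: le_lt_trans hn.
    have := LnS n.+1; have := LnS n.+2; rewrite addn3; lra.
have b0 : 0 <= b n by rewrite !mulr_ge0 ?exprn_ge0 ?powR_ge0 ?divr_ge0// ltW.
have a0 : 0 < N ^+ (n + 3) by rewrite exprn_gt0.
apply: le_trans (korevaar_schoen_le Lf (ltW a0) b0 rb hmeet hP a0) _.
rewrite lee_fin /Dn /b; move: (fine _) => x; rewrite mulrA le_eqVlt; apply/orP; left; apply/eqP.
by congr (_ * x); apply: scale_upper; rewrite gt_eqF.
Qed.

(** For the least n with 2 L^-n < r, a ball contains the sequences meeting its centre at level n.
    Minimality gives r <= 2 L^-(n-1) <= L^-(n-3) / 2, so its points meet the centre at level n - 3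
    and its mass is at most 2 N N^-(n-3). *)
Lemma Dn_le_korevaar_schoen : exists2 C : R, 0 < C & forall f n0, Lp p f ->
  exists2 d, 0 < d & forall r, 0 < r -> r < d ->
    exists2 n, (n0 <= n)%N & ((C * Dn p f n)%:E <= korevaar_schoen p f r)%E.
Proof.
exists ((2 * N)^-1 * (2 `^ dw)^-1 * (N ^- 4 * M)).
  by rewrite !mulr_gt0 ?invr_gt0 ?mulr_gt0 ?exprn_gt0 ?powR_gt0.
(* r < L^-(n0+3) forces n > n0 + 3, so n >= n0 and n - 3 makes sense. *)
move=> f n0 Lf; exists (L ^- (n0 + 3)); first exact: Ln0.
move=> r r0 rd.
have ex : exists n, 2 * L ^- n < r.
  have r2 : 0 < r / 2 by rewrite divr_gt0.
  have /cvgrPdist_lt /(_ _ r2) [k _ hk] := @cvg_Ln R S D hnd; exists k.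
  have := hk k (leqnn k); rewrite /= sub0r normrN ger0_norm ?(ltW (Ln0 _))//.
  by lra.
case: (ex_minnP ex) => n hn hmin.
have n3 : (n0 + 3 < n)%N.
  rewrite ltnNge; apply/negP => nn.
  have : L ^- (n0 + 3) <= L ^- n.
    by rewrite lef_pV2 ?posrE ?exprn_gt0// ler_eXn2l// (lt_le_trans _ L2)// ltr1n.
  by have := Ln0 n; lra.
exists n; first by apply: leq_trans (ltnW n3); exact: leq_addr.
have [m nE] : exists m, n = (m + 3)%N.
  by exists (n - 3)%N; rewrite subnK// (leq_trans _ (ltnW n3))// leq_addl.
have rle : r <= 2 * L ^- (m + 2).
  by rewrite leNgt; apply/negP => /hmin; rewrite nE addn3 addn2 ltnn.
pose b := (2 `^ dw)^-1 * (N / M) ^+ (m + 2).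
have rb : b <= (r `^ dw)^-1.
  rewrite -[leLHS]invrK lef_pV2 ?posrE ?invr_gt0 ?powR_gt0 ?mulr_gt0 ?invr_gt0 ?exprn_gt0 ?divr_gt0 ?powR_gt0//.
  rewrite /b -(powR_dwalk D hnd (m + 2) p1) invfM invrK.
  rewrite -powR_invl ?exprn_ge0 ?(ltW L0)// mulrC -powRM ?invr_ge0 ?exprn_ge0 ?(ltW L0)//.
  apply: ge0_ler_powR => //; rewrite ?nnegrE ?mulr_ge0 ?invr_ge0 ?exprn_ge0 ?(ltW L0) ?(ltW r0)//.
  by rewrite mulrC.
have hmeet s t : meets n s t -> dinf s t < r.
  by move=> /(dinf_meets R hnd)/le_lt_trans; apply.
have a0 : 0 < N ^+ m / (2 * N) by rewrite divr_gt0 ?exprn_gt0 ?mulr_gt0.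
have hP s : (P (ballmap (chi s) r) <= ((N ^+ m / (2 * N))^-1)%:E)%E.
  rewrite invf_div; apply: le_trans (bernoulli_meets_le R m s); apply: le_measure.
  - by apply: mem_set; exact: measurable_ballmap.
  - by apply: mem_set; exact: measurable_meets.
  - move=> t; rewrite /ballmap /= dist_chi// => st; apply: (dinf_lt_meets hnd).
    apply: lt_le_trans st _; apply: le_trans rle _; have := LnS m; have := LnS m.+1.
    by rewrite addn2; lra.
have b0 : 0 <= b by rewrite !mulr_ge0 ?invr_ge0 ?exprn_ge0 ?powR_ge0 ?divr_ge0// ltW.
apply: le_trans (korevaar_schoen_ge Lf a0 b0 rb hmeet hP).
rewrite lee_fin /Dn /b; move: (fine _) => x; rewrite mulrA le_eqVlt; apply/orP; left; apply/eqP.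
by congr (_ * x); rewrite nE; apply: scale_lower; rewrite gt_eqF.
Qed.

End KorevaarSchoen.

(** * Lower limits and the final comparison *)

Section Liminf.
Local Open Scope ereal_scope.

Lemma limf_einf_le_sup (R : realType) (f : R -> \bar R) :
  limf_einf f (0^'+)%R <= ereal_sup [set f r | r in [set r | (0 < r)%R]].
Proof.
rewrite limf_einfE; apply: ge_ereal_sup => _ [V V0 <-].
have /filter_ex[r [Vr r0]] : (\forall r \near (0%R : R)^'+, V r /\ (0 < r)%R).
  by apply: filterI; [exact: V0|exact: nbhs_right_gt].
apply: (@le_trans _ _ (f r)).
  by apply: ereal_inf_lbound; exists r.
by apply: ereal_sup_ubound; exists r.
Qed.

Lemma le_limf_einf (R : realType) (f : R -> \bar R) (x : \bar R) (d : R) : (0 < d)%R ->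
  (forall r : R, (0 < r)%R -> (r < d)%R -> x <= f r) -> x <= limf_einf f (0^'+)%R.
Proof.
move=> d0 h; rewrite limf_einfE.
apply: (@le_trans _ _ (ereal_inf (f @` [set r | 0 < r /\ r < d]%R))).
  by apply: le_ereal_inf_tmp => _ [r [r0 rd] <-]; exact: h.
apply: ereal_sup_ubound; exists [set r | 0 < r /\ r < d]%R => //.
by apply: filterI; [exact: nbhs_right_gt|exact: nbhs_right_lt].
Qed.

(** [closed_energy] may be infinite, so the bound is tested on the reals below c. *)
Lemma mule_le_of_lt (R : realType) (a : R) (c y : \bar R) : (0 < a)%R -> 0 <= c ->
  (forall x : R, x%:E < c -> (a * x)%:E <= y) -> a%:E * c <= y.
Proof.
move=> a0 c0 h.
case: y h => [y| |] h; last 2 first.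
- by rewrite leey.
- have c1 : (-1)%:E < c by apply: lt_le_trans c0; rewrite lte_fin ltrN10.
  by have := h _ c1; rewrite leeNy_eq.
case: c c0 h => [c| |] // c0 h.
  rewrite -EFinM lee_fin; apply/ler_addgt0Pr => e e0.
  have := h (c - e / a)%R; rewrite lte_fin ltrBlDr ltrDl divr_gt0// => /(_ isT).
  by rewrite lee_fin mulrBr mulrCA divff ?gt_eqF// mulr1 lerBlDr.
have := h ((y + 1) / a)%R (ltry _); rewrite lee_fin mulrC divfK ?gt_eqF//.
by rewrite gerDl ler10.
Qed.

End Liminf.

Theorem theorem7p1 (R : realType) (S : simple_igs) (D : doubling S)
    (hnd : non_degenerate S) (hcu : conductively_uniform R S)
    (p : R) (hp : 1 < p) :
  exists C : R, 1 <= C /\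
    forall f : borel_space R D -> R, Lp p f ->
      [/\ (C^-1%:E * closed_energy p f
             <= limf_einf (korevaar_schoen p f) (0^'+))%E,
          (limf_einf (korevaar_schoen p f) (0^'+)
             <= ereal_sup [set korevaar_schoen p f r | r in [set r | (0 < r)%R]])%E
        & (ereal_sup [set korevaar_schoen p f r | r in [set r | (0 < r)%R]]
             <= C%:E * closed_energy p f)%E].
Proof.
have [C1 C10 h1] := korevaar_schoen_le_Dn D hnd hp.
have [C2 C20 h2] := Dn_le_closed D hnd hcu hp.
have [C3 C30 h3] := Dn_le_korevaar_schoen D hnd hp.
have [C4 C40 h4] := closed_le_Dn D hnd hcu hp.
(* C1 C2 serves the upper bound, C4 / C3 the lower one. *)
have C0 : 0 < Num.max 1 (Num.max (C1 * C2) (C4 / C3)) by rewrite lt_max ltr01.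
exists (Num.max 1 (Num.max (C1 * C2) (C4 / C3))); split; first by rewrite le_max lexx.
move=> f Lf; have E0 := closed_energy_ge0 hnd hcu hp Lf; split.
- apply: (@le_trans _ _ ((C4 / C3)^-1%:E * closed_energy p f)%E).
    apply: lee_wpmul2r => //; rewrite lee_fin lef_pV2 ?posrE ?divr_gt0//.
    by rewrite !le_max lexx !orbT.
  rewrite invf_div; apply: mule_le_of_lt => //; first exact: divr_gt0.
  (* D_n f >= x / C4 holds for all n >= n0, and every small r selects some n >= n0; this is what
     gives a bound for the lower limit. *)
  move=> x /(h4 f x Lf)[n0 hn0]; have [d d0 hd] := h3 f n0 Lf.
  apply: (le_limf_einf d0) => r r0 rd; have [n nn0 hn] := hd r r0 rd.
  apply: le_trans hn; rewrite lee_fin -mulrA ler_pM2l// mulrC ler_pdivrMr// mulrC.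
  exact: hn0.
- exact: limf_einf_le_sup.
- apply: ge_ereal_sup => _ [r /= r0 <-]; have [n hn] := h1 f r Lf r0.
  apply: le_trans hn _; rewrite EFinM.
  apply: le_trans (lee_wpmul2l _ (h2 f n Lf)) _; first by rewrite lee_fin ltW.
  rewrite muleA -EFinM; apply: lee_wpmul2r => //.
  by rewrite lee_fin !le_max lexx !orbT.
Qed.
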